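(* Let $\Gamma$ be an infinite weighted graph (as in the context) satisfying $(D)$ and $(P_q)$ for some $1\le q<+\infty$, let $q_0=\inf\{q\in[1,\infty):(P_q)\text{ holds}\}$ and let $q_0'$ be its conjugate exponent ($\frac1{q_0}+\frac1{q_0'}=1$). Let $1<p_1<p<p_2<q_0'$ and $$\alpha=\frac{\frac1{p_1}-\frac1p}{\frac1{p_1}-\frac1{p_2}}.$$ Then, for the complex interpolation method, $$\left[W^{-1,p_1}(\Gamma),W^{-1,p_2}(\Gamma)\right]_\alpha=W^{-1,p}(\Gamma)$$ (with equivalent norms).
   Context: Graph. $\Gamma$ is an infinite set with a symmetric weight $h_{xy}=h_{yx}\ge0$, $h_{xx}=0$; $x\sim y$ means $h_{xy}>0$ or $x=y$; $h_x=\sup_{y\sim x}h_{xy}$. Standing assumptions: there is $N$ with $\#\{y:y\sim x\}\le N$ for all $x$; there is $C_W\ge1$ with $C_W^{-1}\le h_{xy}/h_{xz}\le C_W$ whenever $x\sim y$, $x\sim z$, $y\ne x$, $z\ne x$; $\Gamma$ is connected (any $x,y$ are joined by a finite path $x=x_0\sim x_1\sim\dots\sim x_n=y$, of length $\sum_k h_{x_kx_{k+1}}$); coefficients $\mu_{xy}=\mu_{yx}>0$ are given for $x\sim y$ (including $x=y$), with $\mu_{xy}/\mu_{xz}\le C_\mu$ whenever $x\sim y$, $x\sim z$. $d(x,y)$ is the infimum of the lengths of paths joining $x$ to $y$; $B(x,r)=\{y:d(x,y)<r\}$; $m(x)=\sum_{y\sim x}\mu_{xy}$, $m(A)=\sum_{x\in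 A}m(x)$, $V(x,r)=m(B(x,r))$. Function spaces (complex-valued functions). $\|f\|_{L^p(\Gamma)}=(\sum_x|f(x)|^pm(x))^{1/p}$. $\nabla f(x)=\frac1{h_x}\big(\sum_{y\sim x}|f(y)-f(x)|^2\big)^{1/2}$. $W^{1,p}(\Gamma)$: $\|f\|_{W^{1,p}}=\|f\|_{L^p}+\|\nabla f\|_{L^p}<\infty$. For $1<p<\infty$, $W^{-1,p}(\Gamma)$ is the dual of $W^{1,p'}(\Gamma)$, $\frac1p+\frac1{p'}=1$; since finitely supported functions are dense in each $W^{1,p'}(\Gamma)$, these duals are all regarded as spaces of linear functionals on finitely supported functions, which makes them compatible. $(D)$: there is $C$ with $V(x,2r)\le CV(x,r)$ for all $x\in\Gamma$, $r>0$. $(P_q)$: there is $C$ with $\sum_{y\in B}|f(y)-f_B|^qm(y)\le Cr^q\sum_{y\in B}|\nabla f(y)|^qm(y)$ for all balls $B=B(x,r)$, $r>0$, and all functions $f$ on $\Gamma$, where $f_B=\frac1{m(B)}\sum_{y\in B}f(y)m(y)$.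
   Formalization: The density of finitely supported functions in W^{1,s'} for s = p_1, p, p_2, which the setting asserts and needs to regard the W^{-1,s} as compatible spaces of functionals, is an explicit hypothesis, since it can fail for graphs satisfying (D) and (P_q). *)

(* Defs.v *)
From mathcomp Require Import all_boot all_order all_algebra.
From mathcomp Require Import all_classical all_reals all_analysis.
From mathcomp Require Import complex.

Set Implicit Arguments.
Unset Strict Implicit.
Unset Printing Implicit Defensive.

Import Order.TTheory GRing.Theory Num.Theory.

Local Open Scope classical_set_scope.
Local Open Scope ring_scope.
Local Open Scope card_scope.
Local Open Scope complex_scope.

Local Notation normc := ComplexField.Normc.normc.

Section Graph.
Variables (R : realType) (Gamma : choiceType) (h mu : Gamma -> Gamma -> R).

Definition adj : rel Gamma := fun x y => (0 < h x y) || (x == y).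

Definition nbr (x : Gamma) : set Gamma := [set y | adj x y].

Fixpoint path_length (x : Gamma) (s : seq Gamma) : R :=
  if s is y :: s' then h x y + path_length y s' else 0.

Record weighted_graph : Prop := WeightedGraph {
  wg_infinite : infinite_set [set: Gamma];
  wg_h_ge0 : forall x y, 0 <= h x y;
  wg_h_sym : forall x y, h x y = h y x;
  wg_h_diag : forall x, h x x = 0;
  wg_degree : exists N : nat, forall x, nbr x #<= `I_N;
  wg_h_ratio : exists CW : R, 1 <= CW /\
    forall x y z, adj x y -> adj x z -> y != x -> z != x ->
      CW^-1 <= h x y / h x z <= CW;
  wg_connected : forall x y, exists s, path adj x s /\ last x s = y;
  wg_mu_gt0 : forall x y, adj x y -> 0 < mu x y;
  wg_mu_sym : forall x y, adj x y -> mu x y = mu y x;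
  wg_mu_ratio : exists Cmu : R, forall x y z, adj x y -> adj x z ->
    mu x y / mu x z <= Cmu }.

Definition hsup (x : Gamma) : R := sup [set h x y | y in nbr x].

Definition dist (x y : Gamma) : R :=
  inf [set path_length x s | s in [set s | path adj x s /\ last x s = y]].

Definition gball (x : Gamma) (r : R) : set Gamma := [set y | dist x y < r].

Definition vmass (x : Gamma) : R := \sum_(y \in nbr x) mu x y.

Definition mass (A : set Gamma) : \bar R := \esum_(x in A) (vmass x)%:E.

Definition vol (x : Gamma) (r : R) : \bar R := mass (gball x r).

Definition lpnorm (p : R) (f : Gamma -> R[i]) : \bar R :=
  ((\esum_(x in [set: Gamma]) (normc (f x) `^ p * vmass x)%:E) `^ p^-1)%E.

Definition grad (f : Gamma -> R[i]) (x : Gamma) : R :=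
  (hsup x)^-1 * Num.sqrt (\sum_(y \in nbr x) normc (f y - f x) ^+ 2).

(* Equal to +oo outside W^{1,p}. *)
Definition W1norm (p : R) (f : Gamma -> R[i]) : \bar R :=
  (lpnorm p f + lpnorm p (fun x => (grad f x)%:C))%E.

Definition doubling : Prop := exists C : R, forall (x : Gamma) (r : R),
  0 < r -> (vol x (2 * r) <= C%:E * vol x r)%E.

(* Sum of an absolutely summable real family; balls may be infinite. *)
Definition rsum (A : set Gamma) (g : Gamma -> R) : R :=
  fine (\esum_(x in A) (Num.max (g x) 0)%:E) -
  fine (\esum_(x in A) (Num.max (- g x) 0)%:E).

(* When f is not summable on a set B of finite mass the value is irrelevant in
   poincare: for every constant c, |f - c|^q has infinite integral on B. *)
Definition avg (B : set Gamma) (f : Gamma -> R[i]) : R[i] :=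
  let w := (fine (mass B))^-1 in
  (w * rsum B (fun y => complex.Re (f y) * vmass y)) +i*
  (w * rsum B (fun y => complex.Im (f y) * vmass y)).

Definition poincare (q : R) : Prop :=
  exists C : R, forall (x : Gamma) (r : R) (f : Gamma -> R[i]), 0 < r ->
    let B := gball x r in
    (\esum_(y in B) (normc (f y - avg B f) `^ q * vmass y)%:E <=
     C%:E * (r `^ q)%:E * \esum_(y in B) (grad f y `^ q * vmass y)%:E)%E.

Definition poincare_exponent : R := inf [set q | 1 <= q /\ poincare q].

Definition finsupp_fun : Type :=
  {f : Gamma -> R[i] | finite_set [set x | f x != 0]}.

(* Not automatic: on Gamma = nat with h_{k,k+1} = 2^-k and
   mu_{k,k+1} = mu_{k,k} = 2^-k, doubling and poincare 1 hold, but for r > 1 the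
   constant 1 is not a limit of finitely supported functions. Without density,
   an element of the dual of W^{1,r} is not determined by its restriction to
   finitely supported functions. *)
Definition finsupp_dense (r : R) : Prop :=
  forall f : Gamma -> R[i], (W1norm r f < +oo)%E -> forall e : R, 0 < e ->
    exists phi : finsupp_fun,
      (W1norm r (fun x => f x - sval phi x)%R < e%:E)%E.

(* Functionals on W^{1,r} are represented by functions on all of
   Gamma -> R[i]; the values outside W^{1,r} play no role. *)
Definition linear_on_W1 (r : R) (L : (Gamma -> R[i]) -> R[i]) : Prop :=
  forall (a : R[i]) (f g : Gamma -> R[i]),
    (W1norm r f < +oo)%E -> (W1norm r g < +oo)%E ->
    L (fun x => a * f x + g x) = a * L f + L g.

Definition dual_norm (r : R) (L : (Gamma -> R[i]) -> R[i]) : \bar R :=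
  ereal_sup [set (normc (L f))%:E | f in [set f | (W1norm r f <= 1)%E]].

Definition conj_exp (p : R) : R := fine (hoelder_conjugate p%:E).

(* Norm of T in W^{-1,p}, and +oo when T is not in W^{-1,p}. When finitely
   supported functions are dense in W^{1,p'}, at most one of the functionals L
   below is bounded, so the infimum is just its norm. *)
Definition Wm1norm (p : R) (T : finsupp_fun -> R[i]^o) : \bar R :=
  let r := conj_exp p in
  ereal_inf [set dual_norm r L | L in
    [set L | linear_on_W1 r L /\
             forall phi : finsupp_fun, L (sval phi) = T phi]].

End Graph.

(* A compatible couple is a pair of normed spaces inside one vector space V;
   each is given by its norm, extended by +oo outside the space. *)
Section ComplexInterpolation.
Variables (R : realType) (V : lmodType R[i]).

Definition sum_norm (N0 N1 : V -> \bar R) (v : V) : \bar R :=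
  ereal_inf [set (N0 a + N1 (v - a)%R)%E | a in [set: V]].

Definition strip : set R[i] := [set z | 0 <= complex.Re z <= 1].

Record boundary_cond (N : V -> \bar R) (f : R -> V) : Prop := BoundaryCond {
  bc_fin : forall t, (N (f t) < +oo)%E;
  bc_cont : forall (t e : R), 0 < e -> exists2 d : R, 0 < d &
    forall s, `|s - t| < d -> (N (f s - f t)%R < e%:E)%E;
  bc_lim : forall e : R, 0 < e -> exists M : R,
    forall t, M <= `|t| -> (N (f t) < e%:E)%E }.

(* Calderon's space F(X_0, X_1), with X_0 + X_1 normed by sum_norm. The values
   of F outside the strip play no role. *)
Record calderon (N0 N1 : V -> \bar R) (F : R[i] -> V) : Prop := Calderon {
  cal_bounded : exists M : R,
    forall z, strip z -> (sum_norm N0 N1 (F z) <= M%:E)%E;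
  cal_cont : forall z, strip z -> forall e : R, 0 < e ->
    exists2 d : R, 0 < d & forall w, strip w -> normc (w - z) < d ->
      (sum_norm N0 N1 (F w - F z)%R < e%:E)%E;
  cal_analytic : forall z, 0 < complex.Re z < 1 ->
    exists2 v : V, (sum_norm N0 N1 v < +oo)%E & forall e : R, 0 < e ->
      exists2 d : R, 0 < d & forall w, w != z -> normc (w - z) < d ->
        (sum_norm N0 N1 ((w - z)^-1 *: (F w - F z) - v)%R < e%:E)%E;
  cal_left : boundary_cond N0 (fun t => F (0 +i* t));
  cal_right : boundary_cond N1 (fun t => F (1 +i* t)) }.

Definition calderon_norm (N0 N1 : V -> \bar R) (F : R[i] -> V) : \bar R :=
  Order.max (ereal_sup [set N0 (F (0 +i* t)) | t in [set: R]])
            (ereal_sup [set N1 (F (1 +i* t)) | t in [set: R]]).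

Definition interp_norm (N0 N1 : V -> \bar R) (theta : R) (v : V) : \bar R :=
  ereal_inf [set calderon_norm N0 N1 F | F in
    [set F | calderon N0 N1 F /\ F theta%:C = v]].

(* Same space, equivalent norms: since C is finite and positive, N and N' are
   finite at the same vectors. *)
Definition equiv_norms (N N' : V -> \bar R) : Prop :=
  exists2 C : R, 0 < C &
    forall v, (N v <= C%:E * N' v)%E /\ (N' v <= C%:E * N v)%E.

End ComplexInterpolation.

(* Main.v *)
(** A bounded functional on W^{1,r} is a coefficient functional
    phi |-> sum u * grd phi, with u in l^p over the edges (Hahn-Banach);
    replacing u by u |u|^{c(z)} puts it in an analytic family, which bounds the
    interpolation norm by the norm of W^{-1,p}.

    Conversely let T = F(alpha) with F in Calderon's space, and let f be a
    finitely supported real function. By doubling and Poincare, f is Lipschitz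
    with constant C l on {M <= l}, where M^q is a maximal function of
    |f|^q + |grad f|^q. The differences psi_k of the McShane extensions of f
    from these sets, at dyadic heights l_k, decompose f; multiplying psi_k by
    l_k^{c(z)}, where c(alpha) = 0, turns a bound in W^{1,p'} into bounds in
    W^{1,p1'} and W^{1,p2'} on the two sides of the strip. The maximum
    principle, applied to z |-> sum_k l_k^{c(z)} F(z)(psi_k), bounds T f. It is
    derived from a Cauchy estimate for the powers of a complex differentiable
    function, so Goursat's theorem suffices. *)
Require Import Defs.
From mathcomp Require Import all_boot all_order all_algebra.
From mathcomp Require Import finmap all_classical all_reals all_analysis.
From mathcomp Require Import complex.
From mathcomp Require Import ring lra.

Set Implicit Arguments.
Unset Strict Implicit.
Unset Printing Implicit Defensive.

Import Order.TTheory GRing.Theory Num.Theory.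
Import numFieldNormedType.Exports.

Local Open Scope classical_set_scope.
Local Open Scope ring_scope.
Local Open Scope complex_scope.

Local Notation normc := ComplexField.Normc.normc.

(** * The maximum principle on a strip *)

(** The exponents dictate the weights. A layer at height l has slope about l on {M > l}, so with r =
    p' the W^{1,s} energy of the sum of l_k^(r/s - 1) psi_k is governed by the sum of l_k^(r/s) over
    l_k < M, comparable with M^(r/s), whose s-th power is M^r. As 1/r interpolates 1/p1' and 1/p2'
    at alpha, the exponent r/s - 1, made affine in z, vanishes there. The maximal function is
    bounded on L^(s/q) for s > q, and s goes down to p2': the hypothesis p2 < q0' leaves room for a
    Poincare exponent below p2'. Two obstacles remain. F(z) acts on finitely supported functions,
    which the layers are not, so each layer is approximated in both Sobolev spaces by one finitely
    supported function. And heights below some delta are replaced by a single McShane extension; it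
    is small in both spaces because M is also in L^t for some t < p2', f being finitely supported.
    In the other direction, a factor 1/(1 + z) supplies the decay at infinity that Calderon's space
    demands. *)

Section ComplexModulus.
Variable R : realType.
Implicit Types z w : R[i].

Lemma normc_ge0 z : 0 <= normc z.
Proof. by case: z => a b; rewrite sqrtr_ge0. Qed.

Lemma normc0E : normc (0 : R[i]) = 0.
Proof. by rewrite /= expr0n /= addr0 sqrtr0. Qed.

Lemma normc1E : normc (1 : R[i]) = 1.
Proof. by rewrite /= expr0n /= addr0 expr1n sqrtr1. Qed.

Lemma ler_normcD z w : normc (z + w) <= normc z + normc w.
Proof. exact: le_normcD. Qed.

Lemma normcN' z : normc (- z) = normc z.
Proof. exact: normcN. Qed.

Lemma ler_normcB z w : normc (z - w) <= normc z + normc w.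
Proof. by rewrite -(normcN' w) ler_normcD. Qed.

Lemma normc_distC z w : normc (z - w) = normc (w - z).
Proof. by rewrite -normcN' opprB. Qed.

Lemma normcME z w : normc (z * w) = normc z * normc w.
Proof. exact: ComplexField.Normc.normcM. Qed.

Lemma normcVE z : normc z^-1 = (normc z)^-1.
Proof. exact: ComplexField.Normc.normcV. Qed.

Lemma normcXE z n : normc (z ^+ n) = normc z ^+ n.
Proof. by elim: n => [|n IH]; rewrite ?expr0 ?normc1E// !exprS normcME IH. Qed.

Lemma normcR (x : R) : normc x%:C = `|x|.
Proof. by rewrite /= expr0n /= addr0 sqrtr_sqr. Qed.

Lemma normc_eq0E z : (normc z == 0) = (z == 0).
Proof.
apply/eqP/eqP => [|->]; last exact: normc0E.
exact: ComplexField.Normc.eq0_normc.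
Qed.

Lemma normc_gt0 z : (0 < normc z) = (z != 0).
Proof. by rewrite lt_neqAle normc_ge0 andbT eq_sym normc_eq0E. Qed.

Lemma normc_ge_absRe z : `|complex.Re z| <= normc z.
Proof.
case: z => a b /=; rewrite -sqrtr_sqr ler_sqrt ?lerDl ?sqr_ge0//.
by rewrite addr_ge0 ?sqr_ge0.
Qed.

Lemma normc_ge_absIm z : `|complex.Im z| <= normc z.
Proof.
case: z => a b /=; rewrite -sqrtr_sqr ler_sqrt ?lerDr ?sqr_ge0//.
by rewrite addr_ge0 ?sqr_ge0.
Qed.

Lemma normc_le_ReIm z : normc z <= `|complex.Re z| + `|complex.Im z|.
Proof.
case: z => a b /=; rewrite -[leRHS]ger0_norm ?addr_ge0// -sqrtr_sqr.
rewrite ler_sqrt ?sqr_ge0// sqrrD !real_normK ?num_real//.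
by rewrite lerD2r lerDl mulrn_wge0 ?mulr_ge0.
Qed.

Lemma normc_i : normc ('i : R[i]) = 1.
Proof. by rewrite /= expr0n /= add0r expr1n sqrtr1. Qed.

Lemma ReD z w : complex.Re (z + w) = complex.Re z + complex.Re w.
Proof. by case: z; case: w. Qed.
Lemma ImD z w : complex.Im (z + w) = complex.Im z + complex.Im w.
Proof. by case: z; case: w. Qed.
Lemma ReB z w : complex.Re (z - w) = complex.Re z - complex.Re w.
Proof. by case: z; case: w. Qed.
Lemma ImB z w : complex.Im (z - w) = complex.Im z - complex.Im w.
Proof. by case: z; case: w. Qed.
Lemma ReM z w : complex.Re (z * w) =
  complex.Re z * complex.Re w - complex.Im z * complex.Im w.
Proof. by case: z; case: w. Qed.
Lemma ImM z w : complex.Im (z * w) =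
  complex.Re z * complex.Im w + complex.Im z * complex.Re w.
Proof. by case: z; case: w. Qed.

Lemma complex_eqP z w : complex.Re z = complex.Re w ->
  complex.Im z = complex.Im w -> z = w.
Proof. by case: z => a b; case: w => c d /= -> ->. Qed.

End ComplexModulus.

Arguments ComplexField.Normc.normc : simpl never.

Section ComplexDifferentiability.
Variable R : realType.
Implicit Types (f g : R[i] -> R[i]) (z w l : R[i]).

(** The expansion form includes w = z and passes through sums, products and compositions without
    dividing by w - z. *)
Definition cxderiv f z l := forall e : R, 0 < e -> exists2 d : R, 0 < d &
  forall w, normc (w - z) < d -> normc (f w - f z - l * (w - z)) <= e * normc (w - z).

Definition cxdiff f z := exists l, cxderiv f z l.

Definition cxcont f z := forall e : R, 0 < e -> exists2 d : R, 0 < d &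
  forall w, normc (w - z) < d -> normc (f w - f z) < e.

Lemma cxderiv_lip f z l : cxderiv f z l -> exists2 d : R, 0 < d &
  forall w, normc (w - z) < d -> normc (f w - f z) <= (normc l + 1) * normc (w - z).
Proof.
move=> /(_ 1 ltr01)[d d0 H]; exists d => // w /H.
rewrite mul1r mulrDl mul1r => {}H.
rewrite -[f w - f z](subrK (l * (w - z))) (le_trans (ler_normcD _ _))//.
by rewrite normcME addrC lerD2l.
Qed.

Lemma cxdiff_cont f z : cxdiff f z -> cxcont f z.
Proof.
move=> [l /cxderiv_lip[d d0 H]] e e0.
have l0 : 0 < normc l + 1 by rewrite ltr_wpDl// normc_ge0.
exists (Num.min d (e / (normc l + 1))); first by rewrite lt_min d0 divr_gt0.
move=> w; rewrite lt_min => /andP[/H wd we]; apply: le_lt_trans wd _.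
by rewrite mulrC -ltr_pdivlMr.
Qed.

Lemma cxderiv_cst c z : cxderiv (fun=> c) z 0.
Proof. by move=> e e0; exists 1 => // w _; rewrite subrr mul0r subr0 normc0E mulr_ge0 ?normc_ge0 ?ltW. Qed.

Lemma cxderiv_id z : cxderiv id z 1.
Proof. by move=> e e0; exists 1 => // w _; rewrite mul1r subrr normc0E mulr_ge0 ?normc_ge0 ?ltW. Qed.

Lemma cxderivD f g z a b : cxderiv f z a -> cxderiv g z b ->
  cxderiv (fun w => f w + g w) z (a + b).
Proof.
move=> fa gb e e0; have e2 : 0 < e / 2 by rewrite divr_gt0.
have [d d0 Hd] := fa _ e2; have [d' d'0 Hd'] := gb _ e2.
exists (Num.min d d') => [|w]; first by rewrite lt_min d0.
rewrite lt_min => /andP[/Hd A /Hd' B].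
rewrite (_ : _ - _ - _ = (f w - f z - a * (w - z)) + (g w - g z - b * (w - z))); last by ring.
apply: le_trans (ler_normcD _ _) _; apply: le_trans (lerD A B) _.
by rewrite -mulrDl -splitr.
Qed.

Lemma cxderivM f g z a b : cxderiv f z a -> cxderiv g z b ->
  cxderiv (fun w => f w * g w) z (a * g z + f z * b).
Proof.
move=> fa gb e e0.
have [d1 d10 L] := cxderiv_lip fa.
(* The three error terms below add up to N - 1 times e' n; the extra 1 keeps N positive. *)
set A := normc a + 1; set N := normc (g z) + normc (f z) + 1 + A.
have A0 : 0 < A by rewrite ltr_wpDl// normc_ge0.
have N0 : 0 < N by rewrite ltr_wpDl// !addr_ge0// normc_ge0.
have e2 : 0 < e / (2 * N) by rewrite divr_gt0// mulr_gt0.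
have [d d0 Hd] := fa _ e2; have [d' d'0 Hd'] := gb _ e2.
have [d3 d30 L'] := cxdiff_cont (ex_intro _ b gb) e2.
exists (Num.min (Num.min d d') (Num.min d1 d3)) => [|w].
  by rewrite !lt_min d0 d'0 d10.
rewrite !lt_min => /andP[/andP[/Hd P /Hd' Q] /andP[/L S /L' T]].
rewrite (_ : _ - _ - _ = (f w - f z - a * (w - z)) * g z +
  (f z * (g w - g z - b * (w - z)) + (f w - f z) * (g w - g z))); last by ring.
set n := normc (w - z) in P Q S *; have n0 : 0 <= n by exact: normc_ge0.
apply: le_trans (ler_normcD _ _) _; rewrite normcME.
apply: le_trans (lerD (lexx _) (ler_normcD _ _)) _; rewrite !normcME.
set e' := e / _ in e2 P Q T.
have H1 : normc (f w - f z - a * (w - z)) * normc (g z) <= e' * n * normc (g z).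
  by rewrite ler_wpM2r ?normc_ge0.
have H2 : normc (f z) * normc (g w - g z - b * (w - z)) <= normc (f z) * (e' * n).
  by rewrite ler_wpM2l ?normc_ge0.
have H3 : normc (f w - f z) * normc (g w - g z) <= A * n * e'.
  by apply: ler_pM; [exact: normc_ge0|exact: normc_ge0|exact: S|exact: ltW].
apply: le_trans (lerD H1 (lerD H2 H3)) _.
have -> : e' * n * normc (g z) + (normc (f z) * (e' * n) + A * n * e') = (N - 1) * e' * n.
  by rewrite /N; ring.
rewrite ler_wpM2r// /e' mulrA ler_pdivrMr ?mulr_gt0//.
rewrite mulrC ler_wpM2l ?ltW//; nra.
Qed.

Lemma cxderivV z : z != 0 -> cxderiv (fun w => w^-1) z (- z^-1 ^+ 2).
Proof.
move=> z0 e e0; set n := normc z; have n0 : 0 < n by rewrite normc_gt0.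
(* The remainder is (w - z)^2 / (z^2 w): the first radius gives |w| >= n / 2, the second then makes
   one factor |w - z| pay for e. *)
exists (Num.min (n / 2) (e * n ^+ 3 / 2)).
  by rewrite lt_min !divr_gt0// mulr_gt0// exprn_gt0.
move=> w; rewrite lt_min => /andP[A B].
have nw : n / 2 <= normc w.
  have : n <= normc (w - z) + normc w.
    by rewrite normc_distC -[X in X <= _]/(normc z) -{1}[z](subrK w) ler_normcD.
  lra.
have w0 : w != 0 by rewrite -normc_gt0; apply: lt_le_trans nw; rewrite divr_gt0.
rewrite (_ : _ - _ - _ = (w - z) ^+ 2 * (z^-1 ^+ 2 * w^-1)); last by field; rewrite w0 z0.
rewrite !(normcME, normcXE, normcVE) -/n expr2 -mulrA [leLHS]mulrC ler_wpM2r ?normc_ge0//.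
have ni : 0 <= n^-1 / n by rewrite mulr_ge0 ?invr_ge0 ?normc_ge0.
have P : normc (w - z) * (n^-1 / n / normc w) <= e * n ^+ 3 / 2 * (n^-1 / n / (n / 2)).
  apply: ler_pM; [exact: normc_ge0|by rewrite divr_ge0 ?normc_ge0|exact: ltW|].
  rewrite ler_wpM2l// lef_pV2 ?posrE ?divr_gt0//.
  by apply: lt_le_trans nw; rewrite divr_gt0.
by apply: le_trans P _; rewrite le_eqVlt; apply/orP; left; apply/eqP; field; rewrite gt_eqF.
Qed.

Lemma cxderiv_ext f g z l (d : R) : 0 < d ->
  (forall w, normc (w - z) < d -> f w = g w) -> cxderiv f z l -> cxderiv g z l.
Proof.
move=> d0 fg fl e e0; have [d' d'0 H] := fl _ e0.
exists (Num.min d d'); first by rewrite lt_min d0.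
move=> w; rewrite lt_min => /andP[wd /H]; rewrite fg// fg//.
by rewrite subrr normc0E.
Qed.

Lemma cxderiv_comp f g z a b : cxderiv f z a -> cxderiv g (f z) b ->
  cxderiv (fun w => g (f w)) z (b * a).
Proof.
move=> fa gb e e0.
have [d1 d10 L] := cxderiv_lip fa.
set A := normc a + 1 in L *.
have A0 : 0 < A by rewrite ltr_wpDl// normc_ge0.
have b0 : 0 < normc b + 1 by rewrite ltr_wpDl// normc_ge0.
have [d d0 Hd] := fa (e / 2 / (normc b + 1)) ltac:(by rewrite !divr_gt0).
have [d' d'0 Hd'] := gb (e / 2 / A) ltac:(by rewrite !divr_gt0).
exists (Num.min (Num.min d d1) (d' / A)) => [|w].
  by rewrite !lt_min d0 d10 divr_gt0.
rewrite !lt_min => /andP[/andP[/Hd P /L Q]].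
rewrite ltr_pdivlMr// mulrC => S.
have {}S := Hd' _ (le_lt_trans Q S).
rewrite (_ : _ - _ - _ = (g (f w) - g (f z) - b * (f w - f z)) + b * (f w - f z - a * (w - z))); last by ring.
apply: le_trans (ler_normcD _ _) _; rewrite normcME (splitr e) mulrDl lerD//.
  apply: le_trans S _; rewrite -mulrA ler_wpM2l ?divr_ge0 ?(ltW e0)//.
  by rewrite mulrC ler_pdivrMr// [_ * A]mulrC.
apply: le_trans (ler_wpM2l (normc_ge0 b) P) _.
rewrite mulrA ler_wpM2r ?normc_ge0// mulrA ler_pdivrMr//.
by rewrite mulrC ler_wpM2l ?divr_ge0 ?(ltW e0)// lerDl.
Qed.

Lemma cxcontD f g z : cxcont f z -> cxcont g z -> cxcont (fun w => f w + g w) z.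
Proof.
move=> cf cg e e0; have e2 : 0 < e / 2 by rewrite divr_gt0.
have [d d0 Hd] := cf _ e2; have [d' d'0 Hd'] := cg _ e2.
exists (Num.min d d') => [|w]; first by rewrite lt_min d0.
rewrite lt_min => /andP[/Hd A /Hd' B]; rewrite opprD addrACA (splitr e).
exact: le_lt_trans (ler_normcD _ _) (ltrD A B).
Qed.

Lemma cxdiff_cst c z : cxdiff (fun=> c) z. Proof. by exists 0; exact: cxderiv_cst. Qed.
Lemma cxdiff_id z : cxdiff id z. Proof. by exists 1; exact: cxderiv_id. Qed.
Lemma cxdiffD f g z : cxdiff f z -> cxdiff g z -> cxdiff (fun w => f w + g w) z.
Proof. by move=> [a fa] [b gb]; exists (a + b); exact: cxderivD. Qed.
Lemma cxdiffM f g z : cxdiff f z -> cxdiff g z -> cxdiff (fun w => f w * g w) z.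
Proof. by move=> [a fa] [b gb]; eexists; exact: cxderivM fa gb. Qed.
Lemma cxdiffX f n z : cxdiff f z -> cxdiff (fun w => f w ^+ n) z.
Proof.
move=> df; elim: n => [|n IH].
  by under eq_fun do rewrite expr0; exact: cxdiff_cst.
by under eq_fun do rewrite exprS; exact: cxdiffM.
Qed.
Lemma cxdiffV f z : f z != 0 -> cxdiff f z -> cxdiff (fun w => (f w)^-1) z.
Proof.
by move=> fz [a fa]; eexists; exact: (cxderiv_comp fa (cxderivV fz)).
Qed.
End ComplexDifferentiability.

(** * Integrals along segments and around rectangles *)

Section SegmentIntegral.
Variable R : realType.
Implicit Types (a b c M : R) (f g : R -> R).
Local Notation mu := (@lebesgue_measure R).

(** Two-sided continuity even at the end points: the integrands are restrictions of functions
    continuous in a plane neighbourhood of the segment. *)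
Definition scont a b f := forall x, a <= x <= b -> {for x, continuous f}.

Definition segint a b f : R := (\int[mu]_(x in `[a, b]) f x)%R.

Lemma scont_integrable a b f : scont a b f -> mu.-integrable `[a, b] (EFin \o f).
Proof.
move=> cf; apply: continuous_compact_integrable; first exact: segment_compact.
by apply: continuous_in_subspaceT => x; rewrite inE /= in_itv /= => /cf.
Qed.

Lemma segintD a b f g : scont a b f -> scont a b g ->
  segint a b (fun x => f x + g x) = segint a b f + segint a b g.
Proof. by move=> cf cg; apply: RintegralD => //; exact: scont_integrable. Qed.

Lemma segintB a b f g : scont a b f -> scont a b g ->
  segint a b (fun x => f x - g x) = segint a b f - segint a b g.
Proof. by move=> cf cg; apply: RintegralB => //; exact: scont_integrable. Qed.

Lemma segintZ a b f c : scont a b f ->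
  segint a b (fun x => c * f x) = c * segint a b f.
Proof. by move=> cf; apply: RintegralZl => //; exact: scont_integrable. Qed.

Lemma segint_cst a b c : a <= b -> segint a b (fun=> c) = c * (b - a).
Proof.
move=> ab; have E : mu `[a, b]%classic = (b - a)%:E.
  rewrite lebesgue_measure_itv /= lte_fin.
  by case: (ltgtP a b) ab => [ab _|//|-> _]; rewrite ?subrr.
by rewrite /segint Rintegral_cst//; congr (_ * _); exact: (congr1 fine E).
Qed.

Lemma segint_eq a b f g : (forall x, a <= x <= b -> f x = g x) ->
  segint a b f = segint a b g.
Proof. by move=> fg; apply: eq_Rintegral => x; rewrite inE /= in_itv /= => /fg. Qed.

Lemma le_segint a b f g : scont a b f -> scont a b g ->
  (forall x, a <= x <= b -> f x <= g x) -> segint a b f <= segint a b g.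
Proof.
move=> cf cg fg; apply: le_Rintegral => //; try exact: scont_integrable.
Qed.

Lemma segint_bound a b f M : a <= b -> scont a b f ->
  (forall x, a <= x <= b -> `|f x| <= M) -> `|segint a b f| <= M * (b - a).
Proof.
move=> ab cf fM; have cc c : scont a b (fun=> c) by move=> x _; exact: cvg_cst.
rewrite ler_norml -mulNr -!segint_cst//; apply/andP; split; apply: le_segint => // x /fM;
  by rewrite ler_norml => /andP[].
Qed.

Lemma segint_cat a b c f : a <= b <= c -> scont a c f ->
  segint a c f = segint a b f + segint b c f.
Proof.
move=> /andP[ab bc] cf; have fi := scont_integrable cf.
suff E : segint a c f - segint a b f = segint b c f by rewrite -E addrC subrK.
rewrite /segint (Rintegral_itvB (x := b) fi) ?bnd_simp//.
rewrite Rintegral_itv_obnd_cbnd//; apply: integrableS fi => //.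
by apply: subset_itvr; rewrite bnd_simp.
Qed.

End SegmentIntegral.

Section RectangleIntegral.
Variable R : realType.
Implicit Types (f g : R[i] -> R[i]) (u v : R -> R[i]).

Definition ccont (a b : R) u :=
  scont a b (fun x => complex.Re (u x)) /\ scont a b (fun x => complex.Im (u x)).

Definition csegint (a b : R) u : R[i] :=
  segint a b (fun x => complex.Re (u x)) +i* segint a b (fun x => complex.Im (u x)).

Lemma scontZ a b (c : R) (f : R -> R) : scont a b f -> scont a b (fun x => c * f x).
Proof. by move=> cf x xab; apply: continuousM; [exact: cvg_cst|exact: cf]. Qed.

Lemma csegintD a b u v : ccont a b u -> ccont a b v ->
  csegint a b (fun x => u x + v x) = csegint a b u + csegint a b v.
Proof.
move=> [u1 u2] [v1 v2]; apply: complex_eqP; rewrite /csegint ?ReD ?ImD /=.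
  by rewrite -segintD//; apply: segint_eq => x _; rewrite ReD.
by rewrite -segintD//; apply: segint_eq => x _; rewrite ImD.
Qed.

Lemma csegintZ a b (c : R[i]) u : ccont a b u ->
  csegint a b (fun x => c * u x) = c * csegint a b u.
Proof.
move=> [u1 u2]; apply: complex_eqP; rewrite ?ReM ?ImM /csegint /=.
  rewrite -!segintZ// -segintB; try exact: scontZ.
  by apply: segint_eq => x _; rewrite ReM.
rewrite -!segintZ// -segintD; try exact: scontZ.
by apply: segint_eq => x _; rewrite ImM.
Qed.

Lemma csegint_eq a b u v : (forall x, a <= x <= b -> u x = v x) ->
  csegint a b u = csegint a b v.
Proof. by move=> uv; congr (_ +i* _); apply: segint_eq => x /uv ->. Qed.

Lemma csegint_cst a b (c : R[i]) : a <= b -> csegint a b (fun=> c) = (b - a)%:C * c.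
Proof.
move=> ab; case: c => c d; rewrite /csegint /= !segint_cst//.
by apply: complex_eqP => /=; ring.
Qed.

(** Real and imaginary parts are bounded separately, hence the factor 2. Goursat's estimate and the
    power trick in the maximum principle absorb any absolute constant. *)
Lemma csegint_bound a b u (M : R) : a <= b -> ccont a b u ->
  (forall x, a <= x <= b -> normc (u x) <= M) -> normc (csegint a b u) <= 2 * M * (b - a).
Proof.
move=> ab [u1 u2] uM; apply: le_trans (normc_le_ReIm _) _.
have -> : 2 * M * (b - a) = M * (b - a) + M * (b - a) by ring.
apply: lerD; rewrite /csegint /=; apply: segint_bound => // x /uM; apply: le_trans.
  exact: normc_ge_absRe.
exact: normc_ge_absIm.
Qed.

Lemma csegint_cat a b c u : a <= b <= c -> ccont a c u ->
  csegint a c u = csegint a b u + csegint b c u.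
Proof.
by move=> abc [u1 u2]; apply: complex_eqP; rewrite /csegint /=; exact: segint_cat.
Qed.

Lemma cxcont_seg (a b : R) (g : R[i] -> R[i]) (p : R -> R[i]) :
  (forall x y, normc (p x - p y) = `|x - y|) ->
  (forall x, a <= x <= b -> cxcont g (p x)) -> ccont a b (fun x => g (p x)).
Proof.
move=> pd cg; split => x /cg gx; apply/cvgrPdist_lt => e e0;
  have [d d0 H] := gx _ e0; near=> t;
  (have tx : normc (p t - p x) < d by rewrite pd; near: t; exact: (@cvgr_distC_lt _ _ _ (nbhs x) _ id x cvg_id));
  apply: le_lt_trans (H _ tx); rewrite normc_distC.
  by rewrite -ReB normc_ge_absRe.
by rewrite -ImB normc_ge_absIm.
Unshelve. all: by end_near.
Qed.

Lemma normc_hseg (y s t : R) : normc (s +i* y - t +i* y) = `|s - t|.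
Proof. by rewrite -normcR; congr normc; apply: complex_eqP => /=; rewrite ?subrr. Qed.

Lemma normc_vseg (x s t : R) : normc (x +i* s - x +i* t) = `|s - t|.
Proof.
rewrite -normcR -[RHS]mul1r -(normc_i R).
by rewrite -normcME; congr normc; apply: complex_eqP => /=; ring.
Qed.

Definition oint g (x0 x1 y0 y1 : R) : R[i] :=
  csegint x0 x1 (fun x => g (x +i* y0)) - csegint x0 x1 (fun x => g (x +i* y1)) +
  'i * (csegint y0 y1 (fun y => g (x1 +i* y)) - csegint y0 y1 (fun y => g (x0 +i* y))).

Definition rbd (x0 x1 y0 y1 : R) (z : R[i]) : Prop :=
  (x0 <= complex.Re z <= x1 /\ (complex.Im z = y0 \/ complex.Im z = y1)) \/
  (y0 <= complex.Im z <= y1 /\ (complex.Re z = x0 \/ complex.Re z = x1)).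

Definition rcont g x0 x1 y0 y1 := forall z, rbd x0 x1 y0 y1 z -> cxcont g z.

Lemma rcontP g x0 x1 y0 y1 : rcont g x0 x1 y0 y1 ->
  [/\ ccont x0 x1 (fun x => g (x +i* y0)), ccont x0 x1 (fun x => g (x +i* y1)),
      ccont y0 y1 (fun y => g (x0 +i* y)) & ccont y0 y1 (fun y => g (x1 +i* y))].
Proof.
move=> H; split; apply: cxcont_seg => [s t|s st]; rewrite ?normc_hseg ?normc_vseg//;
  apply: H; [left|left|right|right]; split => //=; by [left|right].
Qed.

Lemma ointD f g x0 x1 y0 y1 : rcont f x0 x1 y0 y1 -> rcont g x0 x1 y0 y1 ->
  oint (fun z => f z + g z) x0 x1 y0 y1 = oint f x0 x1 y0 y1 + oint g x0 x1 y0 y1.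
Proof.
move=> /rcontP[a b c d] /rcontP[a' b' c' d'].
by rewrite /oint !csegintD//; ring.
Qed.

Lemma ointZ k g x0 x1 y0 y1 : rcont g x0 x1 y0 y1 ->
  oint (fun z => k * g z) x0 x1 y0 y1 = k * oint g x0 x1 y0 y1.
Proof. by move=> /rcontP[a b c d]; rewrite /oint !csegintZ//; ring. Qed.

Lemma oint_eq f g x0 x1 y0 y1 : x0 <= x1 -> y0 <= y1 ->
  (forall z, rbd x0 x1 y0 y1 z -> f z = g z) ->
  oint f x0 x1 y0 y1 = oint g x0 x1 y0 y1.
Proof.
move=> x01 y01 fg; rewrite /oint; congr (_ - _ + _ * (_ - _)); apply: csegint_eq => s st; apply: fg.
- by left; split => //; left.
- by left; split => //; right.
- by right; split => //; right.
- by right; split => //; left.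
Qed.

Lemma oint_bound g x0 x1 y0 y1 (M : R) : x0 <= x1 -> y0 <= y1 -> rcont g x0 x1 y0 y1 ->
  (forall z, rbd x0 x1 y0 y1 z -> normc (g z) <= M) ->
  normc (oint g x0 x1 y0 y1) <= 4 * M * ((x1 - x0) + (y1 - y0)).
Proof.
move=> x01 y01 /rcontP[a b c d] gM.
have A : normc (csegint x0 x1 (fun x => g (x +i* y0))) <= 2 * M * (x1 - x0).
  by apply: csegint_bound => // s st; apply: gM; left; split => //; left.
have B : normc (csegint x0 x1 (fun x => g (x +i* y1))) <= 2 * M * (x1 - x0).
  by apply: csegint_bound => // s st; apply: gM; left; split => //; right.
have C : normc (csegint y0 y1 (fun y => g (x1 +i* y))) <= 2 * M * (y1 - y0).
  by apply: csegint_bound => // s st; apply: gM; right; split => //; right.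
have D : normc (csegint y0 y1 (fun y => g (x0 +i* y))) <= 2 * M * (y1 - y0).
  by apply: csegint_bound => // s st; apply: gM; right; split => //; left.
rewrite /oint; apply: le_trans (ler_normcD _ _) _.
rewrite normcME normc_i mul1r.
apply: le_trans (lerD (ler_normcB _ _) (ler_normcB _ _)) _.
by move: A B C D; lra.
Qed.

Lemma oint_splitx g x0 xm x1 y0 y1 : x0 <= xm <= x1 -> rcont g x0 x1 y0 y1 ->
  oint g x0 x1 y0 y1 = oint g x0 xm y0 y1 + oint g xm x1 y0 y1.
Proof.
move=> xm01 /rcontP[a b c d]; rewrite /oint.
by rewrite (csegint_cat xm01 a) (csegint_cat xm01 b); ring.
Qed.

Lemma oint_splity g x0 x1 y0 ym y1 : y0 <= ym <= y1 -> rcont g x0 x1 y0 y1 ->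
  oint g x0 x1 y0 y1 = oint g x0 x1 y0 ym + oint g x0 x1 ym y1.
Proof.
move=> ym01 /rcontP[a b c d]; rewrite /oint.
by rewrite (csegint_cat ym01 c) (csegint_cat ym01 d); ring.
Qed.

(** On opposite edges the integrands differ by a constant, and the two resulting terms cancel.
    Goursat's estimate subtracts such an affine part. *)
Lemma oint_affine (k l z0 : R[i]) x0 x1 y0 y1 : x0 <= x1 -> y0 <= y1 ->
  oint (fun z => k + l * (z - z0)) x0 x1 y0 y1 = 0.
Proof.
move=> x01 y01.
have cc (a b : R) (c : R[i]) : ccont a b (fun=> c).
  by split => x _; exact: cvg_cst.
have cs (p : R -> R[i]) a b : (forall x y, normc (p x - p y) = `|x - y|) ->
    ccont a b (fun x => k + l * (p x - z0)).
  move=> pp; apply: (@cxcont_seg _ _ (fun z => k + l * (z - z0))) => // s _.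
  apply: cxdiff_cont; apply: cxdiffD; first exact: cxdiff_cst.
  apply: cxdiffM; first exact: cxdiff_cst.
  by apply: cxdiffD; [exact: cxdiff_id|exact: cxdiff_cst].
have H : csegint x0 x1 (fun x => k + l * (x +i* y0 - z0)) =
    csegint x0 x1 (fun x => k + l * (x +i* y1 - z0)) + (x1 - x0)%:C * (l * (0 +i* (y0 - y1))).
  rewrite -csegint_cst// -csegintD//; last by apply: cs => s t; exact: normc_hseg.
  apply: csegint_eq => s _.
  by rewrite -addrA -mulrDr; congr (_ + _ * _); apply: complex_eqP; rewrite /= ?ReD ?ImD ?ReB ?ImB /=; ring.
have V : csegint y0 y1 (fun y => k + l * (x1 +i* y - z0)) =
    csegint y0 y1 (fun y => k + l * (x0 +i* y - z0)) + (y1 - y0)%:C * (l * (x1 - x0)%:C).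
  rewrite -csegint_cst// -csegintD//; last by apply: cs => s t; exact: normc_vseg.
  apply: csegint_eq => s _.
  by rewrite -addrA -mulrDr; congr (_ + _ * _); apply: complex_eqP; rewrite /= ?ReD ?ImD ?ReB ?ImB /=; ring.
rewrite /oint H V [X in X + _](_ : _ = (x1 - x0)%:C * (l * (0 +i* (y0 - y1)))); last by ring.
rewrite [X in 'i * X]addrAC subrr add0r.
by clear; case: l => a b; apply: complex_eqP => /=; ring.
Qed.

End RectangleIntegral.

(** * Goursat's theorem by bisection *)

Section Goursat.
Variable R : realType.
Implicit Types (f g : R[i] -> R[i]).

Section Cousin.
Variables (P : nat -> R * R -> Prop) (W H : R).
Hypotheses (W0 : 0 <= W) (H0 : 0 <= H).
Let w n := W * 2^-1 ^+ n.
Let h n := H * 2^-1 ^+ n.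

Let w2 n : w n = w n.+1 + w n.+1.
Proof. by rewrite /w exprS; field. Qed.
Let h2 n : h n = h n.+1 + h n.+1.
Proof. by rewrite /h exprS; field. Qed.
Let wge0 n : 0 <= w n.
Proof. by rewrite mulr_ge0// exprn_ge0// invr_ge0. Qed.
Let hge0 n : 0 <= h n.
Proof. by rewrite mulr_ge0// exprn_ge0// invr_ge0. Qed.

(** [P n p] speaks of the rectangle with corner p and sides W / 2^n, H / 2^n. If it fails at the
    top, it fails along nested quarters, which shrink to a point where the local hypothesis
    contradicts it. *)
Lemma cousin_rectangle (p0 : R * R) :
  (forall n a c, P n.+1 (a, c) -> P n.+1 (a + w n.+1, c) ->
     P n.+1 (a, c + h n.+1) -> P n.+1 (a + w n.+1, c + h n.+1) -> P n (a, c)) ->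
  (forall x y, p0.1 <= x <= p0.1 + W -> p0.2 <= y <= p0.2 + H ->
     exists N, forall n a c, (N <= n)%N -> a <= x <= a + w n -> c <= y <= c + h n -> P n (a, c)) ->
  P 0 p0.
Proof.
move=> split4 local; apply: contrapT => nP0.
(* The existential stands outside the implication so that choice gives a total successor
   function. *)
have step n p : exists p' : R * R, ~ P n p ->
    [/\ ~ P n.+1 p', p.1 <= p'.1 <= p.1 + w n.+1 & p.2 <= p'.2 <= p.2 + h n.+1].
  have [Pp|nP] := pselect (P n p); first by exists p.
  have a0 := wge0 n.+1; have b0 := hge0 n.+1.
  have [//|n1] := pselect (P n.+1 (p.1, p.2)); last by exists (p.1, p.2) => _; split => //=; lra.
  have [//|n2] := pselect (P n.+1 (p.1 + w n.+1, p.2)); last first.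
    by exists (p.1 + w n.+1, p.2) => _; split => //=; lra.
  have [//|n3] := pselect (P n.+1 (p.1, p.2 + h n.+1)); last first.
    by exists (p.1, p.2 + h n.+1) => _; split => //=; lra.
  have [n4|n4] := pselect (P n.+1 (p.1 + w n.+1, p.2 + h n.+1)); last first.
    by exists (p.1 + w n.+1, p.2 + h n.+1) => _; split => //=; lra.
  by move=> P3 P2 P1; exfalso; apply: nP; case: p P1 P2 P3 n4 => a c /= *; exact: split4.
pose nx n p := sval (cid (step n p)).
pose s := fix s n := if n is m.+1 then nx m (s m) else p0.
have nPs n : ~ P n (s n).
  by elim: n => [//|n IH] /=; have [] := svalP (cid (step n (s n))) IH.
have ss n : (s n).1 <= (s n.+1).1 <= (s n).1 + w n.+1 /\ (s n).2 <= (s n.+1).2 <= (s n).2 + h n.+1.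
  by have [] := svalP (cid (step n (s n))) (nPs n).
have mono n m : (n <= m)%N ->
    (s n).1 <= (s m).1 /\ (s m).1 + w m <= (s n).1 + w n /\
    (s n).2 <= (s m).2 /\ (s m).2 + h m <= (s n).2 + h n.
  move/subnK <-; elim: (m - n)%N => [|k IH]; first by rewrite add0n.
  rewrite addSn; have := ss (k + n)%N; have := w2 (k + n)%N; have := h2 (k + n)%N.
  by lra.
have ub n m : (s m).1 <= (s n).1 + w n /\ (s m).2 <= (s n).2 + h n.
  have := wge0 m; have := hge0 m; have := wge0 n; have := hge0 n.
  by have [/mono|/ltnW/mono] := leqP n m; lra.
pose X := [set (s n).1 | n in setT]; pose Y := [set (s n).2 | n in setT].
have X0 : X !=set0 by exists (s 0).1, 0%N.
have Y0 : Y !=set0 by exists (s 0).2, 0%N.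
have bX n : ubound X ((s n).1 + w n) by move=> _ [m _ <-]; have [] := ub n m.
have bY n : ubound Y ((s n).2 + h n) by move=> _ [m _ <-]; have [] := ub n m.
have sX n : (s n).1 <= sup X <= (s n).1 + w n.
  apply/andP; split; last exact: ge_sup.
  by apply: ub_le_sup; [exists ((s 0).1 + w 0); exact: bX|exists n].
have sY n : (s n).2 <= sup Y <= (s n).2 + h n.
  apply/andP; split; last exact: ge_sup.
  by apply: ub_le_sup; [exists ((s 0).2 + h 0); exact: bY|exists n].
have sX0 : p0.1 <= sup X <= p0.1 + W by have := sX 0; rewrite /w expr0 mulr1.
have sY0 : p0.2 <= sup Y <= p0.2 + H by have := sY 0; rewrite /h expr0 mulr1.
have [N HN] := local _ _ sX0 sY0.
apply: (nPs N); move: (HN N (s N).1 (s N).2 (leqnn _) (sX N) (sY N)).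
by case: (s N).
Qed.

End Cousin.

Definition rect (x0 x1 y0 y1 : R) (z : R[i]) :=
  (x0 <= complex.Re z <= x1) && (y0 <= complex.Im z <= y1).

Lemma rbd_rect x0 x1 y0 y1 z : x0 <= x1 -> y0 <= y1 -> rbd x0 x1 y0 y1 z -> rect x0 x1 y0 y1 z.
Proof. by rewrite /rect => xx yy [[? [->|->]]|[? [->|->]]]; lra. Qed.

Lemma le_normc_oint_quarters g (a c w h B : R) : 0 <= w -> 0 <= h ->
  (forall z, rect a (a + (w + w)) c (c + (h + h)) z -> cxcont g z) ->
  normc (oint g a (a + w) c (c + h)) <= B ->
  normc (oint g (a + w) (a + w + w) c (c + h)) <= B ->
  normc (oint g a (a + w) (c + h) (c + h + h)) <= B ->
  normc (oint g (a + w) (a + w + w) (c + h) (c + h + h)) <= B ->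
  normc (oint g a (a + (w + w)) c (c + (h + h))) <= 4 * B.
Proof.
move=> w0 h0 cg B1 B2 B3 B4.
have rc a' b' c' d' : a <= a' -> a' <= b' -> b' <= a + (w + w) ->
    c <= c' -> c' <= d' -> d' <= c + (h + h) -> rcont g a' b' c' d'.
  move=> A1 A2 A3 A4 A5 A6 z /(rbd_rect A2 A5); rewrite /rect => zr; apply: cg.
  by rewrite /rect; lra.
have aw : a <= a + w <= a + (w + w) by lra.
have ch : c <= c + h <= c + (h + h) by lra.
have [aw1 aw2] := andP aw; have [ch1 ch2] := andP ch.
have ww : a <= a + (w + w) by lra.
have hh : c <= c + (h + h) by lra.
rewrite (oint_splitx aw); last by apply: rc.
rewrite (oint_splity ch (x0 := a)); last by apply: rc.
rewrite (oint_splity ch (x0 := a + w)); last by apply: rc.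
rewrite -?addrA in B1 B2 B3 B4.
apply: le_trans (ler_normcD _ _) _.
apply: le_trans (lerD (ler_normcD _ _) (ler_normcD _ _)) _.
have -> : 4 * B = B + B + (B + B) by ring.
by do ![apply: lerD].
Qed.

(** Once the affine part is removed, the integrand is at most e (w + h) on a boundary of length 2 (w
    + h). The bound is quadratic in the size. *)
Lemma normc_oint_small g (z0 l : R[i]) (a c w h e : R) : 0 <= w -> 0 <= h -> 0 < e ->
  rect a (a + w) c (c + h) z0 ->
  (forall z, rect a (a + w) c (c + h) z -> cxcont g z) ->
  (forall z, normc (z - z0) <= w + h ->
     normc (g z - g z0 - l * (z - z0)) <= e * normc (z - z0)) ->
  normc (oint g a (a + w) c (c + h)) <= 4 * e * (w + h) ^+ 2.
Proof.
move=> w0 h0 e0 zr0 cg lg.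
have aw : a <= a + w by rewrite lerDl.
have ch : c <= c + h by rewrite lerDl.
pose rem := fun z => g z + (- g z0 + - l * (z - z0)).
have {}cg z : rbd a (a + w) c (c + h) z -> cxcont g z by move=> /(rbd_rect aw ch)/cg.
have cl k l' z : cxcont (fun z => k + l' * (z - z0)) z.
  apply: cxdiff_cont; apply: cxdiffD; first exact: cxdiff_cst.
  apply: cxdiffM; first exact: cxdiff_cst.
  by apply: cxdiffD; [exact: cxdiff_id|exact: cxdiff_cst].
have E : oint g a (a + w) c (c + h) = oint rem a (a + w) c (c + h).
  by rewrite ointD// ?oint_affine ?addr0// => z _; exact: cl.
rewrite E; pose M := e * (w + h).
have -> : 4 * e * (w + h) ^+ 2 = 4 * M * ((a + w - a) + (c + h - c)) by rewrite /M; ring.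
apply: oint_bound => // [z /cg gz|z /(rbd_rect aw ch)].
  by apply: cxcontD.
rewrite /rect => zr; rewrite /rect in zr0.
have zd : normc (z - z0) <= w + h.
  apply: le_trans (normc_le_ReIm _) _; rewrite ReB ImB.
  by clear -zr zr0; apply: lerD; rewrite ler_norml; lra.
by rewrite /rem addrA mulNr; apply: le_trans (lg _ zd) _; rewrite ler_wpM2l ?(ltW e0).
Qed.

(** A quadratic bound grows by 4 when the sides double, exactly as the sum over four quarters does,
    so it passes from the quarters to the whole. *)
Lemma le_normc_oint_eps g (x0 y0 W H e : R) : 0 <= W -> 0 <= H -> 0 < e ->
  (forall z, rect x0 (x0 + W) y0 (y0 + H) z -> cxdiff g z) ->
  normc (oint g x0 (x0 + W) y0 (y0 + H)) <= 4 * e * (W + H) ^+ 2.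
Proof.
move=> W0 H0 e0 dg.
(* Containment in the big rectangle is a premise inside [P], since [cousin_rectangle] quantifies
   over all corners. *)
pose P n (p : R * R) := x0 <= p.1 -> p.1 + W * 2^-1 ^+ n <= x0 + W ->
  y0 <= p.2 -> p.2 + H * 2^-1 ^+ n <= y0 + H ->
  normc (oint g p.1 (p.1 + W * 2^-1 ^+ n) p.2 (p.2 + H * 2^-1 ^+ n)) <=
    4 * e * (W * 2^-1 ^+ n + H * 2^-1 ^+ n) ^+ 2.
have hw n : 0 <= W * 2^-1 ^+ n by rewrite mulr_ge0// exprn_ge0// invr_ge0.
have hh n : 0 <= H * 2^-1 ^+ n by rewrite mulr_ge0// exprn_ge0// invr_ge0.
suff : P 0 (x0, y0) by rewrite /P /= !expr0 !mulr1; exact.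
apply: (@cousin_rectangle P W H) => //= [n a c|x y xr yr].
  rewrite /P /=.
  have w2 : W * 2^-1 ^+ n = W * 2^-1 ^+ n.+1 + W * 2^-1 ^+ n.+1 by rewrite exprS; field.
  have h2 : H * 2^-1 ^+ n = H * 2^-1 ^+ n.+1 + H * 2^-1 ^+ n.+1 by rewrite exprS; field.
  rewrite w2 h2; have := hw n.+1; have := hh n.+1.
  move: (W * _) (H * _) => w h h0 w0 P1 P2 P3 P4 A B C D.
  have -> : 4 * e * (w + w + (h + h)) ^+ 2 = 4 * (4 * e * (w + h) ^+ 2) by ring.
  apply: le_normc_oint_quarters => //.
  - move=> z; rewrite /rect => zr; apply: cxdiff_cont; apply: dg; rewrite /rect.
    by clear -A B C D zr; lra.
  - by apply: P1; clear -A B C D h0 w0; lra.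
  - by apply: P2; clear -A B C D h0 w0; lra.
  - by apply: P3; clear -A B C D h0 w0; lra.
  - by apply: P4; clear -A B C D h0 w0; lra.
have zr : rect x0 (x0 + W) y0 (y0 + H) (x +i* y) by rewrite /rect /= xr yr.
have [l gl] := dg _ zr; have [d d0 Hd] := gl _ e0.
have [N HN] : exists N, forall n, (N <= n)%N -> W * 2^-1 ^+ n + H * 2^-1 ^+ n < d.
  have := @cvg_geometric R (W + H) 2^-1.
  rewrite ger0_norm ?invr_ge0// invf_lt1// ltr1n => /(_ isT) /cvgrPdist_lt /(_ _ d0) [N _ HN].
  exists N => n /HN /=; rewrite sub0r normrN; apply: le_lt_trans.
  by rewrite -mulrDl ler_norm.
exists N => n a c /HN; have := hw n; have := hh n.
rewrite /P /=; move: (W * _ ^+ n) (H * _ ^+ n) => w h h0 w0 whd xa yc A B C D.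
apply: (@normc_oint_small g (x +i* y) l) => //.
- by rewrite /rect /= xa yc.
- move=> z; rewrite /rect => zr'; apply: cxdiff_cont; apply: dg; rewrite /rect.
  by clear -A B C D zr'; lra.
- by move=> z /le_lt_trans/(_ whd)/Hd.
Qed.

Lemma goursat g (x0 x1 y0 y1 : R) : x0 <= x1 -> y0 <= y1 ->
  (forall z, rect x0 x1 y0 y1 z -> cxdiff g z) -> oint g x0 x1 y0 y1 = 0.
Proof.
move=> xx yy; rewrite -[x1](subrK x0) -[y1](subrK y0) ![_ - _ + _]addrC.
have : 0 <= x1 - x0 by rewrite subr_ge0.
have : 0 <= y1 - y0 by rewrite subr_ge0.
move: (x1 - x0) (y1 - y0) => W H H0 W0 dg.
apply/eqP; rewrite -normc_eq0E; apply/eqP/le_anti; rewrite normc_ge0 andbT.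
have K0 : 0 < 4 * (W + H) ^+ 2 + 1 by rewrite ltr_wpDl// mulr_ge0// sqr_ge0.
apply/ler_addgt0Pl => e0 e00; rewrite addr0.
have e_gt0 : 0 < e0 / (4 * (W + H) ^+ 2 + 1) by rewrite divr_gt0.
apply: le_trans (le_normc_oint_eps W0 H0 e_gt0 dg) _.
have -> : 4 * (e0 / (4 * (W + H) ^+ 2 + 1)) * (W + H) ^+ 2 =
    e0 * (4 * (W + H) ^+ 2 / (4 * (W + H) ^+ 2 + 1)) by ring.
by rewrite ler_piMr ?(ltW e00)// ler_pdivrMr// mul1r lerDl.
Qed.

End Goursat.

(** * Cauchy's formula and the maximum principle *)

Section MaximumModulus.
Variable R : realType.
Implicit Types (f g h : R[i] -> R[i]).

Lemma rbd_neq (u v x0 x1 y0 y1 : R) z : x0 < u < x1 -> y0 < v < y1 ->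
  rbd x0 x1 y0 y1 z -> z != u +i* v.
Proof.
move=> uu vv zr; apply/eqP => E; move: zr; rewrite E /rbd /= => zr.
by clear E; case: zr => [[_ [E|E]]|[_ [E|E]]]; lra.
Qed.

(* The slope of f at an interior point p is holomorphic off p and bounded
   near p; cutting out small squares around p kills its boundary integral. *)
Lemma oint_slope f (u v x0 x1 y0 y1 : R) : x0 < u < x1 -> y0 < v < y1 ->
  (forall z, rect x0 x1 y0 y1 z -> cxdiff f z) ->
  oint (fun z => (f z - f (u +i* v)) / (z - (u +i* v))) x0 x1 y0 y1 = 0.
Proof.
move=> uu vv df; set p := u +i* v.
have pr : rect x0 x1 y0 y1 p by rewrite /rect /=; clear df; lra.
have [l fl] := df _ pr.
(* The value l at p makes the slope continuous there, hence bounded near p. *)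
pose k z := if z == p then l else (f z - f p) / (z - p).
have x01 : x0 <= x1 by clear df; lra.
have y01 : y0 <= y1 by clear df; lra.
transitivity (oint k x0 x1 y0 y1).
  apply: oint_eq => // z /(rbd_neq uu vv) zp.
  by rewrite /k -/p (negbTE zp).
have kl z : z != p -> k z - l = (f z - f p - l * (z - p)) / (z - p).
  move=> zp; rewrite /k (negbTE zp); field.
  by rewrite subr_eq0.
have kc : cxcont k p.
  move=> e e0; have e2 : 0 < e / 2 by rewrite divr_gt0.
  have [d d0 H] := fl _ e2; exists d => // w wd.
  have [->|wp] := eqVneq w p; first by rewrite subrr normc0E.
  rewrite [k p]/k eqxx kl// normcME normcVE ltr_pdivrMr ?normc_gt0 ?subr_eq0//.
  apply: le_lt_trans (H _ wd) _.
  by rewrite ltr_pM2r ?normc_gt0 ?subr_eq0// ltr_pdivrMr// ltr_pMr// ltr1n.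
have kd z : rect x0 x1 y0 y1 z -> z != p -> cxdiff k z.
  move=> zr zp; have zp0 : z - p != 0 by rewrite subr_eq0.
  have [m fm] : cxdiff (fun z => (f z - f p) * (z - p)^-1) z.
    apply: cxdiffM; first by apply: cxdiffD; [exact: df|exact: cxdiff_cst].
    apply: (@cxdiffV _ (fun z => z - p)) => //.
    by apply: cxdiffD; [exact: cxdiff_id|exact: cxdiff_cst].
  exists m; apply: (@cxderiv_ext _ _ _ _ _ (normc (z - p)) _ _ fm); first by rewrite normc_gt0.
  move=> w wz; rewrite /k; case: eqVneq => // wp; move: wz.
  by rewrite wp normc_distC ltxx.
have kcont z : rect x0 x1 y0 y1 z -> cxcont k z.
  by move=> zr; have [->//|/(kd _ zr)/cxdiff_cont] := eqVneq z p.
have [d d0 Hd] := kc _ ltr01.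
pose M := normc l + 1.
have kM z : normc (z - p) < d -> normc (k z) <= M.
  move=> /Hd zd; rewrite -[k z](subrK (k p)) (le_trans (ler_normcD _ _))//.
  by rewrite addrC lerD ?(ltW zd)// /k eqxx.
have M0 : 0 <= M by rewrite addr_ge0 ?normc_ge0.
have small s : 0 < s -> s <= u - x0 -> s <= x1 - u -> s <= v - y0 -> s <= y1 - v ->
    s + s < d -> normc (oint k x0 x1 y0 y1) <= 16 * M * s.
  move=> s0 s1 s2 s3 s4 sd; clear uu vv df kl kc Hd fl.
  have go a b c d' : x0 <= a -> a <= b -> b <= x1 -> y0 <= c -> c <= d' -> d' <= y1 ->
      ~~ rect a b c d' p -> oint k a b c d' = 0.
    move=> A1 A2 A3 A4 A5 A6 np; apply: goursat => // z zr; apply: kd.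
      by move: zr; rewrite /rect; clear -A1 A2 A3 A4 A5 A6; lra.
    by apply: contra np => /eqP <-.
  have rc a b c d' : x0 <= a -> a <= b -> b <= x1 -> y0 <= c -> c <= d' -> d' <= y1 -> rcont k a b c d'.
    move=> A1 A2 A3 A4 A5 A6 z /(rbd_rect A2 A5) zr; apply: kcont.
    by move: zr; rewrite /rect; clear -A1 A2 A3 A4 A5 A6; lra.
  clear kd kcont.
  (* The left, right, lower and upper strips are cut off in turn. None contains p, so Goursat
     removes them and the square of half side s about p remains. *)
  rewrite (@oint_splitx _ _ _ (u - s)); [|clear rc go; lra|by apply: rc; clear go; lra].
  rewrite go ?add0r; try (rewrite /rect /=; clear rc go; lra).
  rewrite (@oint_splitx _ _ _ (u + s)); [|clear rc go; lra|by apply: rc; clear go; lra].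
  rewrite (go (u + s)) ?addr0; try (rewrite /rect /=; clear rc go; lra).
  rewrite (@oint_splity _ _ _ _ _ (v - s)); [|clear rc go; lra|by apply: rc; clear go; lra].
  rewrite go ?add0r; try (rewrite /rect /=; clear rc go; lra).
  rewrite (@oint_splity _ _ _ _ _ (v + s)); [|clear rc go; lra|by apply: rc; clear go; lra].
  rewrite (go _ _ (v + s)) ?addr0; try (rewrite /rect /=; clear rc go; lra).
  have -> : 16 * M * s = 4 * M * ((u + s - (u - s)) + (v + s - (v - s))) by ring.
  apply: oint_bound; [clear rc go; lra|clear rc go; lra|by apply: rc; clear go; lra|].
  have us : u - s <= u + s by clear -s0; lra.
  have vs : v - s <= v + s by clear -s0; lra.
  move=> z /(rbd_rect us vs); rewrite /rect => zr; apply: kM; apply: le_lt_trans sd.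
  apply: le_trans (normc_le_ReIm _) _; rewrite ReB ImB /p /=.
  by clear -zr; apply: lerD; rewrite ler_norml; lra.
apply/eqP; rewrite -normc_eq0E; apply/eqP/le_anti; rewrite normc_ge0 andbT.
apply/ler_addgt0Pl => e e0; rewrite addr0.
pose s := Num.min (Num.min (Num.min (u - x0) (x1 - u)) (Num.min (v - y0) (y1 - v)))
  (Num.min (d / 3) (e / (16 * M + 1))).
have M1 : 0 < 16 * M + 1 by rewrite ltr_wpDl// mulr_ge0.
have s0 : 0 < s by rewrite !lt_min !divr_gt0// !subr_gt0; case/andP: uu => -> ->; case/andP: vv => -> ->.
have : s <= s by []. 
rewrite {2}/s !le_min => /andP[/andP[/andP[a1 a2] /andP[a3 a4]] /andP[a5 a6]].
apply: le_trans (small s s0 a1 a2 a3 a4 _) _.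
  by clear -a5 d0; lra.
move: a6; rewrite ler_pdivlMr// => a6; clear -a6 s0; lra.
Qed.

Lemma Re_inv (z : R[i]) : complex.Re z^-1 =
  complex.Re z / (complex.Re z ^+ 2 + complex.Im z ^+ 2).
Proof. by case: z. Qed.

Lemma Im_inv (z : R[i]) : complex.Im z^-1 =
  - (complex.Im z / (complex.Re z ^+ 2 + complex.Im z ^+ 2)).
Proof. by case: z. Qed.

Lemma rcont_cauchy_kernel (u v x0 x1 y0 y1 : R) : x0 < u < x1 -> y0 < v < y1 ->
  rcont (fun z => (z - (u +i* v))^-1) x0 x1 y0 y1.
Proof.
move=> uu vv z /(rbd_neq uu vv) zp; apply: cxdiff_cont.
apply: (@cxdiffV _ (fun z => z - _)); first by rewrite subr_eq0.
by apply: cxdiffD; [exact: cxdiff_id|exact: cxdiff_cst].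
Qed.

(** Non-vanishing takes the place of the value 2 pi i: each of the four edges contributes a
    nonnegative amount to the imaginary part, the bottom edge a positive one. *)
Lemma oint_cauchy_kernel_neq0 (u v x0 x1 y0 y1 : R) : x0 < u < x1 -> y0 < v < y1 ->
  oint (fun z => (z - (u +i* v))^-1) x0 x1 y0 y1 != 0.
Proof.
move=> uu vv; have /rcontP[[_ c1] [_ c2] [c3 _] [c4 _]] := rcont_cauchy_kernel uu vv.
suff H : 0 < complex.Im (oint (fun z => (z - (u +i* v))^-1) x0 x1 y0 y1).
  by apply/eqP => E; rewrite E ltxx in H.
have cc a b (c : R) : scont a b (fun=> c) by move=> x _; exact: cvg_cst.
have x01 : x0 <= x1 by lra.
have y01 : y0 <= y1 by lra.
pose D := (x1 - x0) ^+ 2 + (y1 - y0) ^+ 2.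
have D0 : 0 < D by rewrite /D; apply: ltr_pwDl; rewrite ?sqr_ge0// exprn_gt0// subr_gt0; lra.
pose K := fun z : R[i] => (z - (u +i* v))^-1.
have sq0 (a b : R) : 0 <= a ^+ 2 + b ^+ 2 by rewrite addr_ge0 ?sqr_ge0.
have H1 : (v - y0) / D * (x1 - x0) <= segint x0 x1 (fun x => complex.Im (K (x +i* y0))).
  rewrite -segint_cst//; apply: le_segint => // x xx; rewrite Im_inv ImB ReB /=.
  rewrite -mulNr opprB ler_wpM2l ?subr_ge0//; first by clear -vv; lra.
  have E0 : 0 < (x - u) ^+ 2 + (y0 - v) ^+ 2.
    by apply: ltr_wpDl; rewrite ?sqr_ge0// exprn_even_gt0//= subr_eq0; apply/eqP; clear -vv; lra.
  rewrite lef_pV2 ?posrE// /D; apply: lerD; rewrite -ler_sqrt ?sqr_ge0// !sqrtr_sqr.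
    by rewrite [leRHS]ger0_norm ?subr_ge0// ler_norml; clear -xx uu; lra.
  by rewrite [leRHS]ger0_norm ?subr_ge0// ler_norml; clear -vv; lra.
have H2 : segint x0 x1 (fun x => complex.Im (K (x +i* y1))) <= 0.
  rewrite -[leRHS](mul0r (x1 - x0)) -segint_cst//; apply: le_segint => // x xx.
  rewrite Im_inv ImB ReB /= oppr_le0 divr_ge0 ?sq0//; clear -vv; lra.
have H3 : 0 <= segint y0 y1 (fun y => complex.Re (K (x1 +i* y))).
  rewrite -[leLHS](mul0r (y1 - y0)) -segint_cst//; apply: le_segint => // x xx.
  rewrite Re_inv ImB ReB /= divr_ge0 ?sq0//; clear -uu; lra.
have H4 : segint y0 y1 (fun y => complex.Re (K (x0 +i* y))) <= 0.
  rewrite -[leRHS](mul0r (y1 - y0)) -segint_cst//; apply: le_segint => // x xx.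
  rewrite Re_inv ImB ReB /= mulr_le0_ge0 ?invr_ge0 ?sq0//; clear -uu; lra.
have H5 : 0 < (v - y0) / D * (x1 - x0).
  by rewrite mulr_gt0 ?divr_gt0//; clear -uu vv; lra.
rewrite /oint ImD ImB ImM ReB /= mul0r mul1r add0r.
move: H1 H2 H3 H4 H5; rewrite /csegint /K /=; clear; lra.
Qed.

Lemma bernoulli_ineq (t : R) n : 0 <= t -> 1 + n%:R * t <= (1 + t) ^+ n.
Proof.
move=> t0; elim: n => [|n IH]; first by rewrite mul0r addr0 expr0.
rewrite exprS; apply: le_trans (_ : (1 + t) * (1 + n%:R * t) <= _).
  have P : 0 <= n%:R * t * t by rewrite !mulr_ge0.
  by rewrite -natr1; clear -P; nra.
by rewrite ler_wpM2l// addr_ge0.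
Qed.

(** By Bernoulli the powers of a / b are unbounded if a > b. A constant independent of n thus
    disappears, however crude. *)
Lemma le_of_powers_le (a b C : R) : 0 <= a -> 0 < b ->
  (forall n, a ^+ n <= C * b ^+ n) -> a <= b.
Proof.
move=> a0 b0 H; rewrite leNgt; apply/negP => ba.
pose t := a / b - 1; have t0 : 0 < t by rewrite subr_gt0 ltr_pdivlMr// mul1r.
pose n := Num.bound `|C / t|.
have E : 1 + t = a / b by rewrite addrC subrK.
have := bernoulli_ineq n (ltW t0); rewrite E expr_div_n.
rewrite ler_pdivlMr ?exprn_gt0// => /le_trans/(_ (H n)).
rewrite ler_pM2r ?exprn_gt0//; apply/negP; rewrite -ltNge.
have : `|C / t| < n%:R by apply: archi_boundP; exact: normr_ge0.
move=> /(le_lt_trans (ler_norm _)); rewrite ltr_pdivrMr// => /lt_trans; apply.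
by rewrite ltrDr.
Qed.

(* The Cauchy formula for h ^+ n, whose constant does not depend on n,
   gives |h p|^n <= C A^n. *)
Lemma maximum_modulus_rectangle h (u v x0 x1 y0 y1 A : R) : x0 < u < x1 -> y0 < v < y1 ->
  (forall z, rect x0 x1 y0 y1 z -> cxdiff h z) -> 0 < A ->
  (forall z, rbd x0 x1 y0 y1 z -> normc (h z) <= A) -> normc (h (u +i* v)) <= A.
Proof.
move=> uu vv dh A0 hA; set p := u +i* v.
pose K := fun z : R[i] => (z - p)^-1.
have x01 : x0 <= x1 by clear -uu; lra.
have y01 : y0 <= y1 by clear -vv; lra.
have Kc : rcont K x0 x1 y0 y1 := rcont_cauchy_kernel uu vv.
have c0 : 0 < normc (oint K x0 x1 y0 y1) by rewrite normc_gt0; exact: oint_cauchy_kernel_neq0.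
set c := normc _ in c0.
pose del := Num.min (Num.min (u - x0) (x1 - u)) (Num.min (v - y0) (y1 - v)).
have del0 : 0 < del.
  by rewrite !lt_min !subr_gt0; case/andP: uu => -> ->; case/andP: vv => -> ->.
have zdel z : rbd x0 x1 y0 y1 z -> del <= normc (z - p).
  have : del <= del by []; rewrite {2}/del !le_min => /andP[/andP[d1 d2] /andP[d3 d4]].
  have A1 : `|complex.Re z - u| <= normc (z - p) by rewrite -(ReB z p) normc_ge_absRe.
  have A2 : `|complex.Im z - v| <= normc (z - p) by rewrite -(ImB z p) normc_ge_absIm.
  by case=> [[_ [E|E]]|[_ [E|E]]]; rewrite E in A1 A2;
    [apply: le_trans A2|apply: le_trans A2|apply: le_trans A1|apply: le_trans A1];
    rewrite ler_normr; apply/orP; clear -d1 d2 d3 d4; lra.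
pose L := (x1 - x0) + (y1 - y0).
have L0 : 0 <= L by rewrite addr_ge0 ?subr_ge0.
apply: (@le_of_powers_le _ _ (4 * del^-1 * L / c)) => [||n]; rewrite ?normc_ge0//.
have dH z : rect x0 x1 y0 y1 z -> cxdiff (fun z => h z ^+ n) z by move=> /dh; exact: cxdiffX.
have HK : rcont (fun z => h z ^+ n * K z) x0 x1 y0 y1.
  move=> z zb; apply: cxdiff_cont; apply: cxdiffM; first by apply: dH; exact: rbd_rect.
  apply: (@cxdiffV _ (fun z => z - p)); first by rewrite subr_eq0 (rbd_neq uu vv).
  by apply: cxdiffD; [exact: cxdiff_id|exact: cxdiff_cst].
have Kc' : rcont (fun z => - (h p ^+ n) * K z) x0 x1 y0 y1.
  move=> z zb; apply: cxdiff_cont; apply: cxdiffM; first exact: cxdiff_cst.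
  apply: (@cxdiffV _ (fun z => z - p)); first by rewrite subr_eq0 (rbd_neq uu vv).
  by apply: cxdiffD; [exact: cxdiff_id|exact: cxdiff_cst].
(* Cauchy's formula for h^n: the slope of h^n at p has zero integral by [oint_slope]. *)
have E : h p ^+ n * oint K x0 x1 y0 y1 = oint (fun z => h z ^+ n * K z) x0 x1 y0 y1.
  have := oint_slope uu vv dH.
  rewrite (_ : (fun z => _) = (fun z => h z ^+ n * K z + - (h p ^+ n) * K z)); last first.
    by apply/funext => z; rewrite /K -mulrDl.
  by rewrite ointD// ointZ// mulNr => /eqP; rewrite subr_eq0 => /eqP ->.
have := @oint_bound _ (fun z => h z ^+ n * K z) x0 x1 y0 y1 (A ^+ n / del) x01 y01 HK.
rewrite -E normcME normcXE -/c => H.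
rewrite mulrAC ler_pdivlMr//; apply: le_trans (H _) _; last first.
  by rewrite le_eqVlt; apply/orP; left; apply/eqP; rewrite /L; ring.
move=> z zb; rewrite normcME normcXE normcVE; apply: ler_pM.
- by rewrite exprn_ge0// normc_ge0.
- by rewrite invr_ge0 normc_ge0.
- by rewrite lerXn2r ?nnegrE ?normc_ge0 ?(ltW A0)//; exact: hA.
- by rewrite lef_pV2 ?posrE ?normc_gt0 ?subr_eq0 ?(rbd_neq uu vv)//; exact: zdel.
Qed.

(** Compactness of [-T, T] makes the local radii uniform. This carries a boundary bound to nearby
    vertical lines inside the strip, where the function is differentiable. *)
Lemma tube_bound (phi : R -> R -> R) (B T : R) :
  (forall t, exists2 d, 0 < d & forall s t', 0 <= s < d -> `|t' - t| < d -> phi s t' <= B) ->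
  exists2 d, 0 < d & forall s t, 0 <= s < d -> `|t| <= T -> phi s t <= B.
Proof.
move=> H; have /compact_near_coveringP cK : compact `[- T, T]%classic by exact: segment_compact.
have := cK R (nbhs (0 : R)) (fun s t => 0 <= s -> phi s t <= B) _.
case=> [t _|d /= d0 Hd].
  have [d d0 Hd] := H t; exists (ball t d, ball (0 : R) d) => /=.
    by split; exact: nbhsx_ballx.
  move=> [t' s] [/= td sd] s0; apply: Hd; last by rewrite distrC.
  by rewrite s0 /=; move: sd; rewrite /ball /= sub0r normrN ger0_norm.
exists d => // s t /andP[s0 sd] tT; apply: (Hd s) => //.
  by rewrite /ball /= sub0r normrN ger0_norm.
by rewrite /= in_itv /= -ler_norml.
Qed.

(** Dividing by 1 + eps z makes h small on the far horizontal edges of a rectangle, where only the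
    bound M is known; [tube_bound] moves the vertical edges inside the strip at the cost e. Then e
    and eps tend to 0. *)
Lemma maximum_modulus_strip h (A M : R) (z0 : R[i]) : 0 <= A ->
  (forall z, strip z -> normc (h z) <= M) ->
  (forall z, strip z -> forall e : R, 0 < e -> exists2 d : R, 0 < d &
     forall w, strip w -> normc (w - z) < d -> normc (h w - h z) < e) ->
  (forall z, 0 < complex.Re z < 1 -> cxdiff h z) ->
  (forall t, normc (h (0 +i* t)) <= A) -> (forall t, normc (h (1 +i* t)) <= A) ->
  0 < complex.Re z0 < 1 -> normc (h z0) <= A.
Proof.
move=> A0 hM ch dh hl hr; case: z0 => u v /= uu.
have M0 : 0 <= M by apply: le_trans (hM (0 +i* 0) _); rewrite ?normc_ge0//= /strip /= lexx ler01.
pose z0 := u +i* v; pose N := normc z0; have N0 : 0 <= N by exact: normc_ge0.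
suff key (e eps : R) : 0 < e -> 0 < eps -> normc (h z0) <= (A + e) * (1 + eps * N).
  apply/ler_addgt0Pl => e e0.
  have e2 : 0 < e / 2 by rewrite divr_gt0.
  have Ae : 0 < A + e / 2 by rewrite ltr_wpDl.
  have N1 : 0 < N + 1 by rewrite ltr_wpDl.
  apply: le_trans (key (e / 2) (e / 2 / ((A + e / 2) * (N + 1))) e2 _) _.
    by rewrite !divr_gt0// mulr_gt0.
  have -> : (A + e / 2) * (1 + e / 2 / ((A + e / 2) * (N + 1)) * N) =
      A + e / 2 + e / 2 * (N / (N + 1)).
    by field; rewrite !gt_eqF//; clear -A0 e0; lra.
  rewrite [leRHS]addrC {3}(splitr e) addrA lerD2l ler_piMr ?(ltW e2)//.
  by rewrite ler_pdivrMr// mul1r lerDl.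
move=> e0 eps0.
pose g z := h z * (1 + eps%:C * z)^-1.
have Re_den z : complex.Re (1 + eps%:C * z) = 1 + eps * complex.Re z.
  by rewrite ReD ReM /= mul0r subr0.
have Im_den z : complex.Im (1 + eps%:C * z) = eps * complex.Im z.
  by rewrite ImD ImM /= mul0r addr0 add0r.
have den1 z : 0 <= complex.Re z -> 1 <= normc (1 + eps%:C * z).
  move=> z0'; apply: le_trans (normc_ge_absRe _); rewrite Re_den ler_normr.
  by rewrite lerDl mulr_ge0 ?(ltW eps0).
have gh z : 0 <= complex.Re z -> normc (g z) <= normc (h z).
  move=> /den1 H; rewrite normcME normcVE ler_piMr ?normc_ge0// invf_le1//.
  exact: lt_le_trans H.
(* At height T the damped function is at most M / (eps T) <= e, and z0 lies below that height. *)
pose T := `|v| + 1 + M / (eps * e).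
have T0 : 0 < T by rewrite ltr_pwDl ?divr_ge0 ?mulr_ge0 ?(ltW e0) ?(ltW eps0)// ltr_wpDl.
have tube (p : R -> R -> R[i]) : (forall s t, 0 <= s < 1 -> strip (p s t)) ->
    (forall s t t', 0 <= s -> normc (p s t' - p 0 t) <= s + `|t' - t|) ->
    (forall t, normc (h (p 0 t)) <= A) ->
    exists2 d, 0 < d & forall s t, 0 <= s < d -> `|t| <= T -> normc (h (p s t)) <= A + e.
  move=> ps pd pA; apply: tube_bound => t.
  have p0 : strip (p 0 t) by apply: ps; rewrite lexx ltr01.
  have [d d0 Hd] := ch _ p0 _ e0.
  exists (Num.min 1 (d / 2)); first by rewrite lt_min ltr01 divr_gt0.
  move=> s t' /andP[s0]; rewrite !lt_min => /andP[s1 sd] /andP[_ td].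
  have /Hd : strip (p s t') by apply: ps; rewrite s0 s1.
  have : normc (p s t' - p 0 t) < d.
    apply: le_lt_trans (pd _ _ _ s0) _; clear -sd td; lra.
  move=> H /(_ H) {}H; rewrite -[h _](subrK (h (p 0 t))) (le_trans (ler_normcD _ _))//.
  by rewrite addrC lerD ?pA// ltW.
have [d1 d10 H1] : exists2 d, 0 < d & forall s t, 0 <= s < d -> `|t| <= T -> normc (h (s +i* t)) <= A + e.
  apply: tube => // [s t /andP[s0 s1]|s t t' s0]; first by rewrite /strip /= s0 ltW.
  by apply: le_trans (normc_le_ReIm _) _; rewrite ReB ImB /= subr0 ger0_norm.
have [d2 d20 H2] : exists2 d, 0 < d & forall s t, 0 <= s < d -> `|t| <= T -> normc (h ((1 - s) +i* t)) <= A + e.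
  apply: (tube (fun s t => (1 - s) +i* t)) => [s t /andP[s0 s1]|s t t' s0|t].
  - by rewrite /strip /= subr_ge0 (ltW s1) gerBl.
  - apply: le_trans (normc_le_ReIm _) _; rewrite ReB ImB /= lerD2r.
    by rewrite subr0 addrAC subrr sub0r normrN ger0_norm.
  - by rewrite subr0.
pose s := Num.min (Num.min (d1 / 2) (d2 / 2)) (Num.min (u / 2) ((1 - u) / 2)).
have s0 : 0 < s by rewrite !lt_min !divr_gt0//=; clear -uu; lra.
have : s <= s by [].
rewrite {2}/s !le_min => /andP[/andP[a1 a2] /andP[a3 a4]].
have Ae : 0 < A + e by rewrite ltr_wpDl.
have : normc (g z0) <= A + e.
  apply: (@maximum_modulus_rectangle g u v s (1 - s) (- T) T).
  - by clear -uu s0 a3 a4; lra.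
  - have vT : `|v| < T.
      rewrite /T -addrA ltrDl addrC ltr_wpDl ?ltr01// divr_ge0 ?mulr_ge0 ?(ltW e0) ?(ltW eps0)//.
    by rewrite -ltr_norml.
  - move=> z; rewrite /rect => zr; apply: cxdiffM; first by apply: dh; clear -zr s0; lra.
    apply: (@cxdiffV _ (fun z => 1 + eps%:C * z)).
      rewrite -normc_gt0; apply: lt_le_trans (den1 _ _) => //; clear -zr s0; lra.
    apply: cxdiffD; first exact: cxdiff_cst.
    by apply: cxdiffM; [exact: cxdiff_cst|exact: cxdiff_id].
  - exact: Ae.
  - move=> [x y]; rewrite /rbd /= => -[[xx yT]|[yy [->|->]]].
    + apply: le_trans (_ : M / (eps * T) <= _); last first.
        rewrite ler_pdivrMr ?mulr_gt0// /T.
        have : M / (eps * e) * (eps * e) = M by rewrite divfK// mulf_neq0 ?gt_eqF.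
        have : 0 <= M / (eps * e) by rewrite divr_ge0// mulr_ge0 ?ltW.
        move: (M / _) (`|v|) (normr_ge0 v) => q w w0 q0 qE.
        rewrite -qE (_ : q * (eps * e) = e * (eps * q)); last by ring.
        apply: ler_pM; rewrite ?mulr_ge0 ?(ltW e0) ?(ltW eps0)// ?lerDr//.
        by rewrite ler_pM2l// lerDr addr_ge0.
      rewrite normcME normcVE; apply: ler_pM.
      * exact: normc_ge0.
      * by rewrite invr_ge0 normc_ge0.
      * by apply: hM; rewrite /strip /=; clear -xx s0; lra.
      * have Tn : eps * T <= normc (1 + eps%:C * (x +i* y)).
          apply: le_trans (normc_ge_absIm _); rewrite Im_den /= normrM (ger0_norm (ltW eps0)).
          by rewrite ler_pM2l//; case: yT => ->; rewrite ?normrN ger0_norm ?(ltW T0).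
        by rewrite lef_pV2 ?posrE ?mulr_gt0// (lt_le_trans _ Tn)// mulr_gt0.
    + apply: le_trans (gh _ _) _; first exact: ltW.
      by apply: H1; rewrite ?ler_norml//; clear -s0 a1 d10; lra.
    + apply: le_trans (gh _ _) _; first by rewrite /=; clear -uu a4 a3; lra.
      by apply: H2; rewrite ?ler_norml//; clear -s0 a2 d20; lra.
have z0n : 1 <= normc (1 + eps%:C * z0) by apply: den1 => /=; clear -uu; lra.
rewrite normcME normcVE ler_pdivrMr; last exact: lt_le_trans z0n.
move/le_trans; apply; rewrite ler_pM2l//.
apply: le_trans (ler_normcD _ _) _; rewrite normc1E normcME normcR.
by rewrite (ger0_norm (ltW eps0)).
Qed.

End MaximumModulus.

(** * Weighted power sums and Hahn-Banach *)

Section BoundedSums.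
Variable R : realType.

Lemma ler_sum_subseq (J : eqType) (g : J -> R) (s t : seq J) : uniq s -> uniq t ->
  (forall j, 0 <= g j) -> {subset s <= t} -> \sum_(j <- s) g j <= \sum_(j <- t) g j.
Proof.
move=> us ut g0 st; rewrite [leRHS](bigID (mem s)) /= -[X in _ <= X + _]big_filter.
suff pp : perm_eq [seq j <- t | j \in s] s by rewrite (perm_big _ pp) /= lerDl sumr_ge0.
apply: uniq_perm => //; first by rewrite filter_uniq.
by move=> j; rewrite mem_filter; case: (boolP (j \in s)) => // /st ->.
Qed.

(** For nonnegative g this is a bound on the extended sum [\esum] (see [esum_bsum]), kept in R where
    ordinary arithmetic applies. *)
Definition bsum (J : eqType) (g : J -> R) (K : R) :=
  forall s : seq J, uniq s -> \sum_(j <- s) g j <= K.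

Section OneType.
Variable J : eqType.
Implicit Types (g : J -> R) (K : R).

Lemma bsum_ge0 g K : bsum g K -> 0 <= K.
Proof. by move=> /(_ [::] isT); rewrite big_nil. Qed.

Lemma bsum_pt g K j : bsum g K -> g j <= K.
Proof. by move=> /(_ [:: j] isT); rewrite big_seq1. Qed.

Lemma bsumW g g' K K' : (forall j, g j <= g' j) -> K' <= K -> bsum g' K' -> bsum g K.
Proof. by move=> gg KK H s us; apply: le_trans KK; apply: le_trans (H s us); exact: ler_sum. Qed.

Lemma bsumS g g' K : (forall j, g j <= g' j) -> bsum g' K -> bsum g K.
Proof. by move=> gg; exact: bsumW. Qed.

Lemma bsum_le g K K' : K' <= K -> bsum g K' -> bsum g K.
Proof. by move=> KK; exact: bsumW. Qed.

Lemma bsumD g g' K K' : bsum g K -> bsum g' K' -> bsum (fun j => g j + g' j) (K + K').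
Proof. by move=> H H' s us; rewrite big_split /= lerD ?H ?H'. Qed.

Lemma bsumZ (c : R) g K : 0 <= c -> bsum g K -> bsum (fun j => c * g j) (c * K).
Proof. by move=> c0 H s us; rewrite -mulr_sumr ler_wpM2l ?H. Qed.

Lemma bsum_supp g (t : seq J) : uniq t -> (forall j, 0 <= g j) ->
  (forall j, j \notin t -> g j = 0) -> bsum g (\sum_(j <- t) g j).
Proof.
move=> ut g0 gt s us; rewrite (bigID (mem t)) /= [X in _ + X]big1 ?addr0; last first.
  by move=> j /gt.
rewrite -big_filter; apply: ler_sum_subseq => //; first exact: filter_uniq.
by move=> j; rewrite mem_filter => /andP[].
Qed.

(** A finite list whose sum is within e of the supremum of the partial sums leaves at most e
    outside. *)
Lemma bsum_tail g K (e : R) : (forall j, 0 <= g j) -> bsum g K -> 0 < e ->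
  exists2 t : seq J, uniq t & bsum (fun j => if j \in t then 0 else g j) e.
Proof.
move=> g0 gK e0; pose X := [set x | exists2 s, uniq s & x = \sum_(j <- s) g j].
have Xub : has_sup X.
  split; first by exists 0, [::] => //; rewrite big_nil.
  by exists K => _ [s us ->]; exact: gK.
have [_ [t ut ->] tX] := sup_adherent e0 Xub; exists t => // s us.
rewrite (bigID (mem t)) /= big1 ?add0r; last by move=> j ->.
under eq_bigr => j /negbTE -> do [].
rewrite -big_filter; set s' := [seq _ <- _ | _].
have : \sum_(j <- t ++ s') g j <= sup X.
  apply: (ub_le_sup (proj2 Xub)); exists (t ++ s') => //.
  rewrite cat_uniq ut filter_uniq// andbT; apply/hasPn => j.
  by rewrite mem_filter => /andP[].
by rewrite big_cat /=; move: tX; lra.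
Qed.

End OneType.

Lemma bsum_inj (I J : eqType) (f : I -> J) (g : J -> R) K : injective f ->
  bsum g K -> bsum (fun i => g (f i)) K.
Proof. by move=> fi H s us; rewrite -(big_map f xpredT g) H// map_inj_uniq. Qed.

(** Tonelli as an upper bound: any finite list of pairs sits inside a product of two lists. *)
Lemma bsum_pair (I J : eqType) (F : I * J -> R) (G : I -> R) K :
  (forall j, 0 <= F j) -> (forall i, bsum (fun j => F (i, j)) (G i)) -> bsum G K -> bsum F K.
Proof.
move=> F0 FG GK s us; pose X := undup (map fst s); pose Y := undup (map snd s).
apply: le_trans (_ : \sum_(p <- [seq (x, y) | x <- X, y <- Y]) F p <= _).
  apply: ler_sum_subseq => //.
    by apply: allpairs_uniq; rewrite ?undup_uniq// => -[a b] [c d] /= _ _ [-> ->].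
  move=> [x y] xys; apply/allpairsP; exists (x, y); rewrite !mem_undup; split => //.
    by apply/mapP; exists (x, y).
  by apply/mapP; exists (x, y).
rewrite big_allpairs /=; apply: le_trans (GK X (undup_uniq _)).
by apply: ler_sum => i _; apply: FG; exact: undup_uniq.
Qed.

Lemma bsum_swap (I J : eqType) (F : I -> J -> R) K : bsum (fun p : I * J => F p.1 p.2) K ->
  bsum (fun p : J * I => F p.2 p.1) K.
Proof.
move=> H; have := @bsum_inj _ _ (fun p : J * I => (p.2, p.1)) (fun p : I * J => F p.1 p.2) K _ H.
by apply; move=> [a b] [c d] /= [-> ->].
Qed.

(** Goes back from sums over pairs to sums over vertices; the finite list over x will be x itself or
    its neighbours. *)
Lemma bsum_fst (I J : eqType) (F : I * J -> R) (g : I -> R) K : (forall p, 0 <= F p) ->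
  (forall i, exists2 s, uniq s & g i <= \sum_(j <- s) F (i, j)) -> bsum F K -> bsum g K.
Proof.
move=> F0 gF FK s us; pose t i := sval (cid2 (gF i)).
have ut i : uniq (t i) by rewrite /t; case: cid2.
have gt i : g i <= \sum_(j <- t i) F (i, j) by rewrite /t; case: cid2.
apply: le_trans (ler_sum _ (fun i _ => gt i)) _.
rewrite -(big_allpairs_dep (h := pair) (F := F)); apply: FK.
by apply: allpairs_uniq_dep => // -[a b] [c d] /= _ _ [-> ->].
Qed.

Lemma esum_bsum (J : choiceType) (A : set J) (g : J -> R) K : (forall j, 0 <= g j) ->
  (\esum_(j in A) (g j)%:E <= K%:E)%E <-> bsum (fun j => if j \in A then g j else 0) K.
Proof.
move=> g0; rewrite esum_mkcond; split => [H s us|H].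
  have : (\sum_(j <- s) (if j \in A then g j else 0)%:E <= K%:E)%E; last by rewrite sumEFin lee_fin.
  apply: le_trans H; apply: esum_ge; exists [set` s].
    by split => //; exact: finite_seq.
  rewrite -fsbig_seq//; apply: lee_sum => j _; by case: ifP.
apply: ge_ereal_sup => _ [F [Ff _] <-].
rewrite fsbig_finite//= (eq_bigr (fun j => (if j \in A then g j else 0)%:E)); last by move=> j _; case: ifP.
by rewrite sumEFin lee_fin; apply: H; exact: finmap.fset_uniq.
Qed.

End BoundedSums.

Section WeightedPowerSums.
Variables (R : realType) (J : eqType) (w : J -> R).
Hypothesis w0 : forall j, 0 <= w j.
Implicit Types (f g : J -> R[i]) (r k l : R).

(** K bounds the r-th power of the weighted l^r norm; it is mostly written k^r, so that k bounds the
    norm. *)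
Definition en r f (K : R) := bsum (fun j => normc (f j) `^ r * w j) K.

Lemma powRV0 (x r : R) : 0 <= x -> (x^-1) `^ r = (x `^ r)^-1.
Proof. by move=> x0; rewrite -powR_inv1// -powRrM mulN1r powRN. Qed.

Lemma powRM_normc (a b : R[i]) r : normc (a * b) `^ r = normc a `^ r * normc b `^ r.
Proof. by rewrite normcME powRM ?normc_ge0. Qed.

(** Convexity of the r-th power at (a + b) / (k + l) with weights k / (k + l) and l / (k + l). With
    k, l bounding the norms this is Minkowski's inequality before summation. *)
Lemma powR_convex_comb (a b k l r : R) : 1 <= r -> 0 <= a -> 0 <= b -> 0 < k -> 0 < l ->
  (a + b) `^ r <= (k + l) `^ r * (k / (k + l) * (a / k) `^ r + l / (k + l) * (b / l) `^ r).
Proof.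
move=> r1 a0 b0 k0 l0; have kl : 0 < k + l by rewrite addr_gt0.
have tP : 0 <= k / (k + l) <= 1 by rewrite divr_ge0 ?(ltW k0) ?(ltW kl)//= ler_pdivrMr// mul1r lerDl ltW.
pose t := Itv01 (proj1 (andP tP)) (proj2 (andP tP)).
have := @convex_powR R r r1 t (a / k) (b / l).
rewrite !inE /= !in_itv /= !andbT !divr_ge0 ?(ltW k0) ?(ltW l0)// => /(_ isT isT).
rewrite !convRE /= => H.
have {H} : (k / (k + l) * (a / k) + (1 - k / (k + l)) * (b / l)) `^ r <=
  k / (k + l) * (a / k) `^ r + (1 - k / (k + l)) * (b / l) `^ r := H.
have -> : 1 - k / (k + l) = l / (k + l) by field; rewrite gt_eqF.
have -> : k / (k + l) * (a / k) + l / (k + l) * (b / l) = (a + b) / (k + l).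
  by field; rewrite !gt_eqF.
move=> H; have kl0 : k + l != 0 by rewrite gt_eqF.
rewrite -[X in X `^ r <= _](divfK kl0).
have q0 : 0 <= (a + b) / (k + l) by rewrite divr_ge0 ?addr_ge0 ?(ltW k0) ?(ltW l0).
by rewrite (powRM _ q0 (ltW kl)) mulrC; apply: ler_wpM2l => //; exact: powR_ge0.
Qed.

(** Minkowski, by summing [powR_convex_comb]; that inequality divides by k and l, so zero norms are
    treated apart. *)
Lemma enD f g r k l : 1 <= r -> 0 <= k -> 0 <= l -> en r f (k `^ r) -> en r g (l `^ r) ->
  en r (fun j => f j + g j) ((k + l) `^ r).
Proof.
move=> r1; have r0 : r != 0 by rewrite gt_eqF// (lt_le_trans _ r1).
have z (h : J -> R[i]) : en r h (0 `^ r) -> forall j, h j = 0 \/ w j = 0.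
  move=> H j; have := bsum_pt j H; rewrite powR0// => H0.
  have : normc (h j) `^ r * w j == 0 by rewrite eq_le H0 mulr_ge0 ?powR_ge0.
  rewrite mulf_eq0 => /orP[|/eqP ->]; last by right.
  by rewrite powR_eq0 normc_eq0E => /andP[/eqP -> _]; left.
rewrite !le_eqVlt => /predU1P[<-|k0] /predU1P[<-|l0] ef eg.
- rewrite addr0; apply: bsumS ef => j /=.
  by case: (z _ eg j) => -> ; rewrite ?addr0 ?mulr0// mulr_ge0 ?powR_ge0.
- rewrite add0r; apply: bsumS eg => j /=.
  by case: (z _ ef j) => -> ; rewrite ?add0r ?mulr0// mulr_ge0 ?powR_ge0.
- rewrite addr0; apply: bsumS ef => j /=.
  by case: (z _ eg j) => -> ; rewrite ?addr0 ?mulr0// mulr_ge0 ?powR_ge0.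
have kl : 0 < k + l by rewrite addr_gt0.
have k'0 : 0 < k `^ r by rewrite powR_gt0.
have l'0 : 0 < l `^ r by rewrite powR_gt0.
pose c1 := (k + l) `^ r * (k / (k + l)) / k `^ r.
pose c2 := (k + l) `^ r * (l / (k + l)) / l `^ r.
have c10 : 0 <= c1 by rewrite divr_ge0 ?mulr_ge0 ?powR_ge0 ?invr_ge0 ?(ltW k0) ?(ltW kl).
have c20 : 0 <= c2 by rewrite divr_ge0 ?mulr_ge0 ?powR_ge0 ?invr_ge0 ?(ltW l0) ?(ltW kl).
apply: (@bsumW _ _ _ _ _ (c1 * k `^ r + c2 * l `^ r)); last first.
- exact: bsumD (bsumZ c10 ef) (bsumZ c20 eg).
- rewrite le_eqVlt; apply/orP; left; apply/eqP; rewrite /c1 /c2.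
  by field; rewrite !gt_eqF.
move=> j /=; rewrite !mulrA -mulrDl ler_wpM2r//.
apply: le_trans (_ : (normc (f j) + normc (g j)) `^ r <= _).
  by rewrite ge0_ler_powR ?nnegrE ?addr_ge0 ?normc_ge0 ?ler_normcD// (le_trans ler01).
apply: le_trans (powR_convex_comb r1 (normc_ge0 _) (normc_ge0 _) k0 l0) _.
rewrite !powRM ?invr_ge0 ?normc_ge0 ?(ltW k0) ?(ltW l0)// !powRV0 ?(ltW k0) ?(ltW l0)// /c1 /c2.
by rewrite le_eqVlt; apply/orP; left; apply/eqP; field; rewrite !gt_eqF.
Qed.

Lemma enZ (a : R[i]) f r K : en r f K -> en r (fun j => a * f j) (normc a `^ r * K).
Proof.
by move=> H; apply: bsumS (bsumZ (powR_ge0 (normc a) r) H) => j /=; rewrite powRM_normc mulrA.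
Qed.

Lemma en_k (a : R[i]) f r k : 0 <= k -> en r f (k `^ r) ->
  en r (fun j => a * f j) ((normc a * k) `^ r).
Proof. by move=> k0 /(enZ a); rewrite powRM ?normc_ge0. Qed.

Lemma young (p r a b : R) : 1 < p -> p^-1 + r^-1 = 1 -> 0 <= a -> 0 <= b ->
  a * b <= a `^ p + b `^ r.
Proof.
move=> p1 pr a0 b0; have p0 : 0 < p by rewrite (lt_trans ltr01).
have r0' : 0 < r^-1.
  have -> : r^-1 = 1 - p^-1 by rewrite -pr; ring.
  by rewrite subr_gt0 invf_lt1.
have r0 : 0 < r by rewrite -invr_gt0.
apply: le_trans (conjugate_powR a0 b0 p0 r0 pr) _; apply: lerD.
  by rewrite ler_piMr ?powR_ge0// invf_le1// ltW.
rewrite ler_piMr ?powR_ge0//.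
have -> : r^-1 = 1 - p^-1 by rewrite -pr; ring.
by rewrite gerBl invr_ge0 ltW.
Qed.

(* From Young's inequality by homogeneity, hence the factor 2. *)
Lemma en_pairing (p r : R) (u g : J -> R[i]) (A k : R) (s : seq J) : uniq s ->
  1 < p -> p^-1 + r^-1 = 1 -> 0 <= A -> 0 <= k ->
  en p u (A `^ p) -> en r g (k `^ r) ->
  \sum_(j <- s) normc (u j) * normc (g j) * w j <= 2 * (A * k).
Proof.
move=> us p1 pr; have p0 : p != 0 by rewrite gt_eqF// (lt_trans ltr01).
have r0 : r != 0 by apply/eqP => E; move: pr; rewrite E invr0 addr0 => /eqP; rewrite invr_eq1 gt_eqF.
have z (q : R) (h : J -> R[i]) : q != 0 -> en q h (0 `^ q) -> forall j, normc (h j) * w j = 0.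
  move=> q0 H j; have := bsum_pt j H; rewrite powR0// => H0.
  have : normc (h j) `^ q * w j == 0 by rewrite eq_le H0 mulr_ge0 ?powR_ge0.
  rewrite mulf_eq0 => /orP[|/eqP ->]; last by rewrite mulr0.
  by rewrite powR_eq0 normc_eq0E => /andP[/eqP -> _]; rewrite normc0E mul0r.
rewrite !le_eqVlt => /predU1P[<-|A0] /predU1P[<-|k0] ef eg.
- by rewrite big1 ?mul0r ?mulr0 ?eqxx// => j _; rewrite -mulrA (z _ _ r0 eg) ?mulr0.
- by rewrite big1 ?mul0r ?mulr0 ?eqxx// => j _; rewrite mulrAC (z _ _ p0 ef) ?mul0r.
- by rewrite big1 ?mulr0 ?eqxx// => j _; rewrite -mulrA (z _ _ r0 eg) ?mulr0.
rewrite -le_eqVlt -ler_pdivrMr ?mulr_gt0// mulr_suml.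
have AA : 0 < A `^ p by rewrite powR_gt0.
have kk : 0 < k `^ r by rewrite powR_gt0.
have Ai : 0 <= (A `^ p)^-1 by rewrite invr_ge0 ltW.
have ki : 0 <= (k `^ r)^-1 by rewrite invr_ge0 ltW.
have : bsum (fun j => (A `^ p)^-1 * (normc (u j) `^ p * w j) +
    (k `^ r)^-1 * (normc (g j) `^ r * w j)) (1 + 1).
  rewrite -{1}(mulVf (lt0r_neq0 AA)) -(mulVf (lt0r_neq0 kk)).
  by apply: bsumD; apply: bsumZ.
move=> /(_ s us); apply: le_trans; apply: ler_sum => j _.
have -> : normc (u j) * normc (g j) * w j / (A * k) =
    (normc (u j) / A * (normc (g j) / k)) * w j by field; rewrite !gt_eqF.
rewrite ![_ * (_ * w j)]mulrA -mulrDl ler_wpM2r//.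
apply: le_trans (@young p r _ _ p1 pr _ _) _; rewrite ?divr_ge0 ?normc_ge0 ?(ltW A0) ?(ltW k0)//.
rewrite !powRM ?invr_ge0 ?normc_ge0 ?(ltW k0) ?(ltW A0)//.
by rewrite !powRV0 ?(ltW A0) ?(ltW k0)// ![_^-1 * _]mulrC.
Qed.

End WeightedPowerSums.

(** * Hahn-Banach through minimal sublinear functionals *)

Section HahnBanach.
Variables (R : realType) (V : lmodType R[i]) (S : set V).
Hypothesis SD : forall x y, S x -> S y -> S (x + y).
Hypothesis SZ : forall (t : R) x, S x -> S (t%:C *: x).
Implicit Types (p q : V -> R).

(** Homogeneity is over the reals; complex linearity is recovered in [representation]. The
    inequality for t > 0 already gives equality ([sublinearZ]). *)
Definition sublinear q :=
  (forall x y, S x -> S y -> q (x + y) <= q x + q y) /\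
  (forall (t : R) x, S x -> 0 < t -> q (t%:C *: x) <= t * q x).

Let Sne x : S x -> S (- x).
Proof. by move=> /(SZ (-1)); rewrite rmorphN rmorph1 scaleN1r. Qed.

Let S0 x : S x -> S 0.
Proof. by move=> /(SZ 0); rewrite rmorph0 scale0r. Qed.

Lemma sublinear0 q x : S x -> sublinear q -> q 0 = 0.
Proof.
move=> /S0 s0 [_ qZ]; have := qZ 2 0 s0 ltac:(by []); have := qZ 2^-1 0 s0 ltac:(by rewrite invr_gt0).
by rewrite !scaler0; lra.
Qed.

Lemma sublinearZ q (t : R) x : S x -> sublinear q -> 0 <= t -> q (t%:C *: x) = t * q x.
Proof.
move=> Sx qq; rewrite le_eqVlt => /predU1P[<-|t0].
  by rewrite rmorph0 scale0r mul0r (sublinear0 Sx).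
apply: le_anti; rewrite qq.2//= mulrC -ler_pdivlMr// mulrC.
apply: le_trans (qq.2 t^-1 _ (SZ _ Sx) _); last by rewrite invr_gt0.
by rewrite scalerA -rmorphM /= mulVf ?gt_eqF// rmorph1 scale1r.
Qed.

Lemma sublinearN q x : S x -> sublinear q -> - q (- x) <= q x.
Proof.
move=> Sx qq; rewrite lerNl -subr_ge0 opprK -(sublinear0 Sx qq) -(subrr x).
by rewrite addrC qq.1//; exact: Sne.
Qed.

Section Minimal.
Variable p : V -> R.
Hypothesis psub : sublinear p.

Record below := Below { bfun :> V -> R; _ : sublinear bfun; _ : forall x, S x -> bfun x <= p x }.

Let bsub (q : below) : sublinear q. Proof. by case: q. Qed.
Let ble (q : below) x : S x -> q x <= p x. Proof. by case: q => ? ? /= H; exact: H. Qed.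

(** Zorn's lemma produces maximal elements, so the pointwise order is reversed. *)
Let ge_rel (q q' : below) := `[< forall x, S x -> q' x <= q x >].

Let qlow (q : below) x : S x -> - p (- x) <= q x.
Proof.
move=> Sx; apply: le_trans (sublinearN Sx (bsub q)).
by rewrite lerN2 ble//; exact: Sne.
Qed.

(** The pointwise infimum of a chain is finite by the lower bound - p (- x), and subadditive because
    two members nearly optimal at x and at y are comparable: the smaller one serves for both. *)
Lemma exists_minimal_below : exists q : below,
  forall q' : below, (forall x, S x -> q' x <= q x) -> forall x, S x -> q x <= q' x.
Proof.
have [| | |q Hq] := @ZL_preorder below (Below psub (fun x _ => lexx _)) ge_rel.
- by move=> q; apply/asboolP.
- by move=> a b c /asboolP ab /asboolP bc; apply/asboolP => x Sx; exact: le_trans (bc x Sx) (ab x Sx).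
- move=> A Atot; have [[q0 Aq0]|nA] := pselect (exists q : below, A q); last first.
    by exists (Below psub (fun x _ => lexx _)) => q Aq; case: nA; exists q.
  pose m x := inf [set q x | q in A].
  have hi x : S x -> has_inf [set bfun q x | q in A].
    move=> Sx; split; first by exists (q0 x), q0.
    by exists (- p (- x)) => _ [q Aq <-]; exact: qlow.
  have mle (q : below) x : A q -> S x -> m x <= q x.
    by move=> Aq Sx; apply: ge_inf; [exact: (hi x Sx).2|exists q].
  have ms : sublinear m.
    split=> [x y Sx Sy|t x Sx t0].
      apply/ler_addgt0Pl => e e0; have e2 : 0 < e / 2 by rewrite divr_gt0.
      have [_ [q1 Aq1 <-] H1] := inf_adherent e2 (hi x Sx).
      have [_ [q2 Aq2 <-] H2] := inf_adherent e2 (hi y Sy).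
      have [q Aq [qx qy]] : exists2 q : below, A q & q x <= q1 x /\ q y <= q2 y.
        have [/asboolP H|/asboolP H] := Atot _ _ Aq1 Aq2; first by exists q2 => //; split => //; exact: H.
        by exists q1 => //; split => //; exact: H.
      apply: le_trans (mle q _ Aq (SD Sx Sy)) _; apply: le_trans ((bsub q).1 _ _ Sx Sy) _.
      by move: H1 H2; rewrite -/(m x) -/(m y) (splitr e); clear -qx qy; lra.
    rewrite -ler_pdivrMl//; apply: lb_le_inf; first by exists (q0 x), q0.
    move=> _ [q Aq <-]; rewrite ler_pdivrMl//.
    by apply: le_trans (mle q _ Aq (SZ _ Sx)) _; exact: (bsub q).2.
  have mp x : S x -> m x <= p x by move=> Sx; apply: le_trans (mle q0 x Aq0 Sx) (ble _ Sx).
  by exists (Below ms mp) => q Aq; apply/asboolP => x Sx /=; exact: mle.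
- by exists q => q' H; have /asboolP := Hq q' (asboolT H).
Qed.

(* A minimal sublinear functional q is additive: compare it with
   x |-> inf_(t >= 0) (q (x + t x0) - t q x0). *)
Lemma hahn_banach : exists L : V -> R,
  [/\ forall x y, S x -> S y -> L (x + y) = L x + L y,
      forall (t : R) x, S x -> L (t%:C *: x) = t * L x &
      forall x, S x -> L x <= p x].
Proof.
have [q qmin] := exists_minimal_below; exists q.
have qs := bsub q.
have qD x x0 : S x -> S x0 -> q (x + x0) = q x + q x0.
  move=> Sx Sx0; apply/le_anti; rewrite qs.1//=.
  pose X y := [set q (y + t%:C *: x0) - t * q x0 | t in [set t | 0 <= t]].
  have hi y : S y -> has_inf (X y).
    move=> Sy; split; first by exists (q (y + 0%:C *: x0) - 0 * q x0), 0 => //=.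
    exists (- q (- y)) => _ [t t0 <-]; rewrite -(sublinearZ Sx0 qs t0).
    have := qs.1 _ _ (SD Sy (SZ t Sx0)) (Sne Sy); rewrite addrAC subrr add0r.
    by lra.
  pose m y := inf (X y).
  have mle t y : 0 <= t -> S y -> m y <= q (y + t%:C *: x0) - t * q x0.
    by move=> t0 Sy; apply: ge_inf; [exact: (hi y Sy).2|exists t].
  have mq y : S y -> m y <= q y.
    by move=> Sy; apply: le_trans (mle 0 y (lexx _) Sy) _; rewrite rmorph0 scale0r addr0 mul0r subr0.
  have ms : sublinear m.
    split=> [y z Sy Sz|t y Sy t0].
      apply/ler_addgt0Pl => e e0; have e2 : 0 < e / 2 by rewrite divr_gt0.
      have [_ [t1 /= t10 <-] H1] := inf_adherent e2 (hi y Sy).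
      have [_ [t2 /= t20 <-] H2] := inf_adherent e2 (hi z Sz).
      apply: le_trans (mle (t1 + t2) _ (addr_ge0 t10 t20) (SD Sy Sz)) _.
      have := qs.1 _ _ (SD Sy (SZ t1 Sx0)) (SD Sz (SZ t2 Sx0)).
      rewrite addrACA -scalerDl -rmorphD /=; move: H1 H2; rewrite -/(m y) -/(m z) (splitr e).
      by clear; lra.
    rewrite -ler_pdivrMl//; apply: lb_le_inf; first exact: (hi y Sy).1.
    move=> _ [s /= s0 <-]; rewrite ler_pdivrMl//.
    apply: le_trans (mle (t * s) _ (mulr_ge0 (ltW t0) s0) (SZ _ Sy)) _.
    by rewrite rmorphM /= -scalerA -scalerDr (sublinearZ _ qs (ltW t0)) ?mulrBr ?mulrA//; exact: SD (SZ _ _).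
  have mp y : S y -> m y <= p y by move=> Sy; apply: le_trans (mq y Sy) (ble _ Sy).
  (* Minimality gives q <= m, and t = 1 in the infimum gives q x <= q (x + x0) - q x0. *)
  have := qmin (Below ms mp) mq x Sx => /= /le_trans/(_ (mle 1 x ler01 Sx)).
  by rewrite rmorph1 scale1r mul1r; lra.
have qN x : S x -> q (- x) = - q x.
  move=> Sx; have := qD _ _ Sx (Sne Sx); rewrite subrr (sublinear0 Sx qs).
  by move/eqP; rewrite eq_sym addrC addr_eq0 => /eqP.
split => //; last exact: ble.
move=> t x Sx; have [t0|t0] := leP 0 t; first exact: sublinearZ.
rewrite -[t in LHS]opprK rmorphN scaleNr qN; last exact: SZ.
by rewrite sublinearZ// ?mulNr ?opprK// oppr_ge0 ltW.
Qed.

End Minimal.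
End HahnBanach.

(** * The graph and its Sobolev spaces *)

Section GraphBasics.
Variables (R : realType) (Gamma : choiceType) (h mu : Gamma -> Gamma -> R).
Hypothesis G : weighted_graph h mu.

Definition nb (x : Gamma) : seq Gamma := finmap.enum_fset (fset_set (nbr h x)).

Lemma nbr_finite x : finite_set (nbr h x).
Proof.
have [N HN] := wg_degree G.
exact: card_le_finite (HN x) (finite_II N).
Qed.

Lemma mem_nb x y : (y \in nb x) = adj h x y.
Proof.
rewrite -[LHS]/(y \in fset_set (nbr h x)) in_fset_set ?inE//; last exact: nbr_finite.
by rewrite mem_setE.
Qed.

Lemma nb_uniq x : uniq (nb x).
Proof. exact: finmap.fset_uniq. Qed.

Lemma nb_size : exists N : nat, forall x, (size (nb x) <= N)%N.
Proof.
have [N HN] := wg_degree G; exists N => x.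
exact: geq_card_fset_set (HN x).
Qed.

Lemma adj_refl x : adj h x x.
Proof. by rewrite /adj eqxx orbT. Qed.

Lemma adj_sym x y : adj h x y = adj h y x.
Proof. by rewrite /adj (wg_h_sym G) eq_sym. Qed.

Lemma adj_gt0 x y : adj h x y -> y != x -> 0 < h x y.
Proof. by rewrite /adj eq_sym => /orP[//|/eqP ->]; rewrite eqxx. Qed.

Lemma vmassE x : vmass h mu x = \sum_(y <- nb x) mu x y.
Proof. by rewrite /vmass fsbig_finite//; exact: nbr_finite. Qed.

Lemma sum_nbrE (x : Gamma) (F : Gamma -> R) : \sum_(y \in nbr h x) F y = \sum_(y <- nb x) F y.
Proof. by rewrite fsbig_finite//; exact: nbr_finite. Qed.

Lemma hsup_ub x y : adj h x y -> h x y <= hsup h x.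
Proof.
move=> xy; apply: ub_le_sup; last by exists y.
exists (\sum_(z <- nb x) h x z) => _ [z xz <-].
rewrite (big_rem z) ?mem_nb//= lerDl sumr_ge0// => *; exact: (wg_h_ge0 G).
Qed.

Lemma exists_neighbor x : exists2 y, adj h x y & y != x.
Proof.
apply: contrapT => nx.
have H y : adj h x y -> y = x by move=> xy; apply: contrapT => /eqP yx; apply: nx; exists y.
apply: (wg_infinite G); apply: (@sub_finite_set _ _ [set x]); last exact: finite_set1.
move=> y _; have [s [ps <-]] := wg_connected G x y.
elim: s ps => [//|z s IH] /= /andP[/H -> ]; exact: IH.
Qed.

Lemma hsup_gt0 x : 0 < hsup h x.
Proof.
have [y xy yx] := exists_neighbor x.
exact: lt_le_trans (adj_gt0 xy yx) (hsup_ub xy).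
Qed.

Lemma vmass_gt0 x : 0 < vmass h mu x.
Proof.
rewrite vmassE (big_rem x) ?mem_nb ?adj_refl//= ltr_pwDl//; first exact: (wg_mu_gt0 G) (adj_refl x).
rewrite big_seq; apply: sumr_ge0 => y yx; apply/ltW/(wg_mu_gt0 G).
by rewrite -mem_nb; exact: mem_rem yx.
Qed.

(** One constant for the degree, the edge lengths at a vertex and the masses of neighbours, so that
    later bounds involve K alone. *)
Definition graph_const (K : R) : Prop :=
  [/\ 1 <= K, forall x, (size (nb x))%:R <= K,
      forall x y, adj h x y -> y != x -> hsup h x <= K * h x y &
      forall x y, adj h x y -> vmass h mu y <= K * vmass h mu x].

(** For the masses: the weight of the edge xy is at most the mass of x, and controls the mass of y
    up to the degree times the ratio constant. *)
Lemma exists_graph_const : exists K, graph_const K.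
Proof.
have [N HN] := nb_size; have [CW [CW1 HW]] := wg_h_ratio G; have [Cm Hm] := wg_mu_ratio G.
exists (CW + N%:R + N%:R * `|Cm|); split.
- by rewrite -addrA ler_wpDr// addr_ge0// mulr_ge0.
- move=> x; rewrite addrAC ler_wpDl ?ler_nat//; first by rewrite addr_ge0 ?mulr_ge0// (le_trans ler01).
- move=> x y xy yx; have hxy := adj_gt0 xy yx.
  apply: le_trans (_ : CW * h x y <= _); last first.
    by rewrite ler_pM2r// -addrA lerDl addr_ge0// mulr_ge0.
  apply: ge_sup; first by exists (h x y), y.
  move=> _ [z xz <-]; have [->|zx] := eqVneq z x.
    by rewrite (wg_h_diag G) mulr_ge0 ?(ltW hxy)// (le_trans ler01).
  by rewrite -ler_pdivrMr//; case/andP: (HW x z y xz xy zx yx).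
- move=> x y xy; have yx : adj h y x by rewrite adj_sym.
  have m0 := wg_mu_gt0 G xy.
  have mv : mu x y <= vmass h mu x.
    rewrite vmassE (big_rem y) ?mem_nb//= lerDl big_seq; apply: sumr_ge0 => z zx.
    by apply/ltW/(wg_mu_gt0 G); rewrite -mem_nb; exact: mem_rem zx.
  apply: le_trans (_ : N%:R * `|Cm| * mu x y <= _); last first.
    apply: ler_pM => //; rewrite ?mulr_ge0 ?(ltW m0)//.
    by rewrite lerDr addr_ge0// (le_trans ler01).
  rewrite vmassE; apply: le_trans (_ : \sum_(z <- nb y) `|Cm| * mu x y <= _).
    rewrite big_seq [leRHS]big_seq; apply: ler_sum => z; rewrite mem_nb => yz.
    rewrite (wg_mu_sym G xy) -ler_pdivrMr ?(wg_mu_gt0 G yx)//.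
    by apply: le_trans (Hm y z x yz yx) _; exact: ler_norm.
  rewrite big_const_seq count_predT iter_addr_0 -[leLHS]mulr_natl mulrA ler_pM2r//.
  by rewrite ler_wpM2r// ler_nat.
Qed.

Section PathMetric.
Local Notation plen := (path_length h).

Lemma path_length_ge0 x s : 0 <= plen x s.
Proof. by elim: s x => //= y s IH x; rewrite addr_ge0// (wg_h_ge0 G). Qed.

Lemma path_length_cat x s t : plen x (s ++ t) = plen x s + plen (last x s) t.
Proof. by elim: s x => [|y s IH] x /=; rewrite ?add0r// IH addrA. Qed.

Lemma path_reverse x s : path (adj h) x s -> exists t,
  [/\ path (adj h) (last x s) t, last (last x s) t = x & plen (last x s) t = plen x s].
Proof.
elim: s x => [|y s IH] x /=; first by exists [::].
move=> /andP[xy /IH[t [t1 t2 t3]]]; exists (rcons t x).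
rewrite rcons_path t1 t2 last_rcons adj_sym xy -cats1 path_length_cat t3 t2 /=.
by rewrite (wg_h_sym G) addr0 addrC.
Qed.

Local Notation d := (dist h).

Lemma dist_has_inf x y : has_inf [set plen x s | s in [set s | path (adj h) x s /\ last x s = y]].
Proof.
split; last by exists 0 => _ [s _ <-]; exact: path_length_ge0.
by have [s sP] := wg_connected G x y; exists (plen x s), s.
Qed.

Lemma dist_le_path x s : path (adj h) x s -> d x (last x s) <= plen x s.
Proof. by move=> ps; apply: ge_inf; [exact: (dist_has_inf _ _).2|exists s]. Qed.

Lemma dist_approx x y (e : R) : 0 < e ->
  exists s, [/\ path (adj h) x s, last x s = y & plen x s < d x y + e].
Proof. by move=> e0; have [_ [s [ps sl] <-] H] := inf_adherent e0 (dist_has_inf x y); exists s. Qed.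

Lemma dist_ge0 x y : 0 <= d x y.
Proof.
apply: lb_le_inf; first exact: (dist_has_inf x y).1.
by move=> _ [s _ <-]; exact: path_length_ge0.
Qed.

Lemma distxx x : d x x = 0.
Proof. by apply/le_anti; rewrite dist_ge0 andbT; have := @dist_le_path x [::] isT. Qed.

Lemma dist_sym x y : d x y = d y x.
Proof.
suff H a b : d a b <= d b a by apply: le_anti; rewrite !H.
apply/ler_addgt0Pl => e e0; rewrite addrC.
have [s [ps sl sd]] := dist_approx b a e0; have [t [t1 t2 t3]] := path_reverse ps.
rewrite sl in t1 t2 t3; have := dist_le_path t1.
by rewrite t2 t3 => /le_trans; apply; exact: ltW.
Qed.

Lemma dist_triangle y x z : d x z <= d x y + d y z.
Proof.
apply/ler_addgt0Pl => e e0; have e2 : 0 < e / 2 by rewrite divr_gt0.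
have [s [ps sl sd]] := dist_approx x y e2; have [t [pt tl td]] := dist_approx y z e2.
have := @dist_le_path x (s ++ t); rewrite cat_path ps last_cat sl tl pt path_length_cat sl.
move=> /(_ isT)/le_trans; apply; rewrite (splitr e); move: sd td; clear; lra.
Qed.

Lemma dist_le_h x y : adj h x y -> d x y <= h x y.
Proof. by move=> xy; have := @dist_le_path x [:: y]; rewrite /= xy addr0; apply. Qed.

Lemma dist_le_hsup x y : adj h x y -> d x y <= hsup h x.
Proof. by move=> xy; apply: le_trans (dist_le_h xy) (hsup_ub xy). Qed.

(** The first step by which a path leaves x already has length at least hsup h x / K. Hence small
    balls are single vertices, the fact that starts every induction on radii below. *)
Lemma hsup_le_dist K x y : graph_const K -> y != x -> hsup h x <= K * d x y.
Proof.
move=> [K1 _ Kh _] yx; have K0 : 0 < K by exact: lt_le_trans K1.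
rewrite mulrC -ler_pdivrMr//; apply: lb_le_inf; first exact: (dist_has_inf x y).1.
move=> _ [s [ps sl] <-]; elim: s ps sl => [_ /= /eqP|z s IH /=]; first by rewrite eq_sym (negbTE yx).
move=> /andP[xz ps] sl; have [zx|zx] := eqVneq z x.
  by rewrite zx in ps sl *; rewrite (wg_h_diag G) add0r IH.
rewrite ler_wpDr ?path_length_ge0//.
by rewrite ler_pdivrMr// mulrC; exact: Kh.
Qed.

Lemma gball_singleton K x (r : R) : graph_const K -> 0 < r -> K * r <= hsup h x ->
  gball h x r = [set x].
Proof.
move=> gK r0 rh; apply/seteqP; split => y /=; last by move=> ->; rewrite /gball /= distxx.
rewrite /gball /= => xy; apply: contrapT => /eqP yx.
have := le_trans rh (hsup_le_dist gK yx).
rewrite ler_pM2l ?leNgt ?xy//; case: gK => K1 _ _ _; exact: lt_le_trans K1.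
Qed.

End PathMetric.

End GraphBasics.

Section SobolevEnergy.
Variables (R : realType) (Gamma : choiceType) (h mu : Gamma -> Gamma -> R).
Hypothesis G : weighted_graph h mu.
Variable K : R.
Hypothesis gK : graph_const h mu K.
Implicit Types (f g : Gamma -> R[i]) (r k : R).

Local Notation m := (vmass h mu).

(* W^{1,r}-functions as weighted r-summable functions on pairs of vertices:
   f on the diagonal, difference quotients along the edges. *)
Definition grd f (p : Gamma * Gamma) : R[i] :=
  if p.2 == p.1 then f p.1
  else if adj h p.1 p.2 then ((hsup h p.1)^-1)%:C * (f p.2 - f p.1) else 0.

Definition wt (p : Gamma * Gamma) : R := m p.1.

(** k bounds a norm equivalent to [W1norm] ([W1norm_w1], [w1_W1norm]) that is pulled back from a
    weighted l^r space by the linear map [grd]. Duality and Minkowski are applied in that space. *)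
Definition w1 r f k := en wt r (grd f) (k `^ r).

Lemma wt_ge0 p : 0 <= wt p.
Proof. exact/ltW/(vmass_gt0 G). Qed.

Lemma K_ge1 : 1 <= K. Proof. by case: gK. Qed.
Lemma K_gt0 : 0 < K. Proof. exact: lt_le_trans K_ge1. Qed.

Lemma grdD f g p : grd (fun x => f x + g x) p = grd f p + grd g p.
Proof. by rewrite /grd; case: ifP => // _; case: ifP => _; rewrite ?addr0//; ring. Qed.

Lemma grdZ (a : R[i]) f p : grd (fun x => a * f x) p = a * grd f p.
Proof. by rewrite /grd; case: ifP => // _; case: ifP => _; rewrite ?mulr0//; ring. Qed.

Lemma w1D r f g k l : 1 <= r -> 0 <= k -> 0 <= l -> w1 r f k -> w1 r g l ->
  w1 r (fun x => f x + g x) (k + l).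
Proof.
move=> r1 k0 l0 fk gl; apply: bsumS (enD wt_ge0 r1 k0 l0 fk gl) => p /=.
by rewrite grdD.
Qed.

Lemma w1Z r (a : R[i]) f k : 0 <= k -> w1 r f k -> w1 r (fun x => a * f x) (normc a * k).
Proof. by move=> k0 fk; apply: bsumS (en_k a k0 fk) => p /=; rewrite grdZ. Qed.

Lemma w1N r f k : 0 <= k -> w1 r f k -> w1 r (fun x => - f x) k.
Proof.
move=> k0 /(w1Z (-1) k0); rewrite normcN' normc1E mul1r; apply: bsumS => p.
by rewrite (_ : (fun x => - f x) = (fun x => -1 * f x))//; apply/funext => x; rewrite mulN1r.
Qed.

Lemma w1_le r f k l : 0 <= r -> 0 <= k -> k <= l -> w1 r f k -> w1 r f l.
Proof.
by move=> r0 k0 kl; apply: bsum_le; rewrite ge0_ler_powR ?nnegrE// (le_trans k0).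
Qed.

Lemma w1_zero r k : r != 0 -> w1 r (fun=> 0) k.
Proof.
move=> r0 s us; rewrite big1 ?powR_ge0// => p _; rewrite /grd subrr mulr0 !if_same.
by rewrite normc0E powR0// mul0r.
Qed.

Lemma eq_w1 r f g k : f =1 g -> w1 r f k -> w1 r g k.
Proof. by move=> /funext ->. Qed.

Lemma poweR_inv_le (x : \bar R) r k : 0 < r -> 0 <= k -> (0 <= x)%E ->
  (x `^ r^-1 <= k%:E)%E <-> (x <= (k `^ r)%:E)%E.
Proof.
move=> r0 k0; have ri : 0 < r^-1 by rewrite invr_gt0.
case: x => [x| |//]; last by rewrite poweRyr ?gt_eqF// => _; split.
rewrite lee_fin poweR_EFin !lee_fin => x0; split => H.
  have -> : x = (x `^ r^-1) `^ r by rewrite -powRrM mulVf ?gt_eqF// powRr1.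
  by rewrite ge0_ler_powR ?nnegrE ?powR_ge0 ?(ltW r0).
have -> : k = (k `^ r) `^ r^-1 by rewrite -powRrM mulfV ?gt_eqF// powRr1.
by rewrite ge0_ler_powR ?nnegrE ?powR_ge0 ?(ltW ri).
Qed.

Lemma lpnormP r f k : 0 < r -> 0 <= k ->
  (lpnorm h mu r f <= k%:E)%E <-> bsum (fun x => normc (f x) `^ r * m x) (k `^ r).
Proof.
move=> r0 k0; have m0 x : 0 <= normc (f x) `^ r * m x.
  by rewrite mulr_ge0 ?powR_ge0// ltW// (vmass_gt0 G).
rewrite /lpnorm poweR_inv_le//; last by apply: esum_ge0 => x _; rewrite lee_fin.
rewrite esum_bsum//; split; apply: bsumS => x; rewrite in_setT//.
Qed.

Lemma lpnorm_ge0 r f : (0 <= lpnorm h mu r f)%E.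
Proof. by rewrite /lpnorm poweR_ge0. Qed.

Lemma gradE f x : grad h f x = (hsup h x)^-1 * Num.sqrt (\sum_(y <- nb h x) normc (f y - f x) ^+ 2).
Proof. by rewrite /grad (sum_nbrE G). Qed.

Lemma grad_ge0 f x : 0 <= grad h f x.
Proof. by rewrite gradE mulr_ge0 ?sqrtr_ge0// invr_ge0 ltW// (hsup_gt0 G). Qed.

Lemma normc_grd_offdiag f x y : y != x -> adj h x y ->
  normc (grd f (x, y)) = (hsup h x)^-1 * normc (f y - f x).
Proof.
move=> yx xy; rewrite /grd /= (negbTE yx) xy normcME normcR ger0_norm//.
by rewrite invr_ge0 ltW// (hsup_gt0 G).
Qed.

Lemma grd_le_grad f x y : y != x -> adj h x y -> normc (grd f (x, y)) <= grad h f x.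
Proof.
move=> yx xy; rewrite normc_grd_offdiag// gradE ler_pM2l ?invr_gt0 ?(hsup_gt0 G)//.
rewrite -[leLHS]ger0_norm ?normc_ge0// -sqrtr_sqr ler_sqrt ?sumr_ge0//; last by move=> *; exact: sqr_ge0.
rewrite (big_rem y) ?(mem_nb G)//= lerDl sumr_ge0// => *; exact: sqr_ge0.
Qed.

Lemma sum_sqr_le (s : seq Gamma) (a : Gamma -> R) : (forall y, 0 <= a y) ->
  \sum_(y <- s) a y ^+ 2 <= (\sum_(y <- s) a y) ^+ 2.
Proof.
move=> a0; elim: s => [|y s IH]; first by rewrite !big_nil expr0n.
rewrite !big_cons sqrrD -addrA lerD2l (le_trans IH)// lerDr mulrn_wge0// mulr_ge0//.
exact: sumr_ge0.
Qed.

Lemma grad_le_sum f x : grad h f x <= \sum_(y <- nb h x) normc (grd f (x, y)).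
Proof.
rewrite gradE; set S := \sum_(y <- _) normc (grd _ _).
have S0 : 0 <= S by apply: sumr_ge0 => *; exact: normc_ge0.
have hx := hsup_gt0 G x.
rewrite mulrC ler_pdivrMr// -[leRHS]ger0_norm ?mulr_ge0 ?(ltW hx)// -sqrtr_sqr ler_sqrt ?sqr_ge0//.
apply: le_trans (sum_sqr_le _ (fun y => normc_ge0 _)) _.
rewrite lerXn2r ?nnegrE ?mulr_ge0 ?(ltW hx) ?sumr_ge0//; try by move=> *; exact: normc_ge0.
rewrite /S mulr_suml big_seq [leRHS]big_seq; apply: ler_sum => y; rewrite (mem_nb G) => xy.
have [->|yx] := eqVneq y x; first by rewrite subrr normc0E mulr_ge0 ?normc_ge0// ltW.
by rewrite normc_grd_offdiag// mulrAC mulVf ?mul1r// gt_eqF.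
Qed.

Lemma powR_sum_le (I : eqType) (s : seq I) (a : I -> R) r : 0 < r -> (forall y, 0 <= a y) ->
  (\sum_(y <- s) a y) `^ r <= (size s)%:R `^ r * \sum_(y <- s) a y `^ r.
Proof.
move=> r0 a0; set S := \sum_(y <- s) a y `^ r.
have S0 : 0 <= S by apply: sumr_ge0 => *; exact: powR_ge0.
have -> : S = (S `^ r^-1) `^ r by rewrite -powRrM mulVf ?gt_eqF// powRr1.
rewrite -powRM ?powR_ge0// ge0_ler_powR ?nnegrE ?mulr_ge0 ?powR_ge0 ?sumr_ge0 ?(ltW r0)//.
apply: le_trans (_ : \sum_(y <- s) S `^ r^-1 <= _); last first.
  by rewrite big_const_seq count_predT iter_addr_0 -[leLHS]mulr_natl.
rewrite big_seq [leRHS]big_seq; apply: ler_sum => y ys.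
have -> : a y = (a y `^ r) `^ r^-1 by rewrite -powRrM mulfV ?gt_eqF// powRr1.
rewrite ge0_ler_powR ?nnegrE ?powR_ge0 ?invr_ge0 ?(ltW r0)//.
by rewrite /S (big_rem y)//= lerDl sumr_ge0// => *; exact: powR_ge0.
Qed.

(** The diagonal pair carries f x, and each of the at most K edges at x is dominated by the
    gradient. *)
Lemma bsum_w1 r f A B : 1 <= r -> bsum (fun x => normc (f x) `^ r * m x) A ->
  bsum (fun x => grad h f x `^ r * m x) B -> en wt r (grd f) (A + K * B).
Proof.
move=> r1 fA fB; have r0 : 0 < r by exact: lt_le_trans r1.
have F0 (p : Gamma * Gamma) : 0 <= normc (grd f p) `^ r * wt p.
  by rewrite mulr_ge0 ?powR_ge0 ?wt_ge0.
apply: (@bsum_pair _ _ _ _ (fun x => normc (f x) `^ r * m x + K * (grad h f x `^ r * m x))) => //.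
  move=> x; apply: bsum_le; last first.
    apply: (@bsum_supp _ _ _ (nb h x)) => //; first exact: nb_uniq.
    move=> y; rewrite (mem_nb G) /grd /= => xy; have yx : y != x.
      by apply: contra xy => /eqP ->; rewrite adj_refl.
    by rewrite (negbTE yx) (negbTE xy) normc0E powR0 ?gt_eqF// mul0r.
  rewrite (big_rem x) ?(mem_nb G) ?adj_refl//= {1}/grd /= eqxx lerD2l.
  apply: le_trans (_ : \sum_(y <- rem x (nb h x)) grad h f x `^ r * m x <= _).
    rewrite big_seq [leRHS]big_seq; apply: ler_sum => y.
    rewrite (mem_rem_uniq _ (nb_uniq _ _)) inE (mem_nb G) => /andP[yx xy].
    rewrite /wt /= ler_wpM2r ?(ltW (vmass_gt0 G _))// ge0_ler_powR ?nnegrE ?normc_ge0 ?grad_ge0 ?(ltW r0)//.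
    exact: grd_le_grad.
  rewrite big_const_seq count_predT iter_addr_0 -[leLHS]mulr_natl ler_wpM2r//.
    by rewrite mulr_ge0 ?powR_ge0// ltW// (vmass_gt0 G).
  have [_ dK _ _] := gK; apply: le_trans (dK x).
  by rewrite ler_nat size_rem ?(mem_nb G) ?adj_refl// leq_pred.
by apply: bsumD => //; apply: bsumZ => //; exact/ltW/K_gt0.
Qed.

Lemma W1norm_w1 r f k : 1 <= r -> 0 <= k -> (W1norm h mu r f <= k%:E)%E -> w1 r f ((1 + K) * k).
Proof.
move=> r1 k0 H; have r0 : 0 < r by exact: lt_le_trans r1.
have /lpnormP fA : (lpnorm h mu r f <= k%:E)%E.
  by apply: le_trans H; rewrite leeDl// lpnorm_ge0.
have /lpnormP fB : (lpnorm h mu r (fun x => (grad h f x)%:C) <= k%:E)%E.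
  by apply: le_trans H; rewrite leeDr// lpnorm_ge0.
have {}fB : bsum (fun x => grad h f x `^ r * m x) (k `^ r).
  by apply: bsumS (fB r0 k0) => x; rewrite normcR ger0_norm// grad_ge0.
apply: bsum_le (bsum_w1 r1 (fA r0 k0) fB).
have K1 : 0 <= 1 + K by rewrite addr_ge0// ltW// K_gt0.
by rewrite powRM// -[X in X + _]mul1r -mulrDl ler_wpM2r ?powR_ge0// le1r_powR// lerDl ltW// K_gt0.
Qed.

(** The l^2 norm over edges in [grad] is at most the l^1 norm, whose r-th power costs the r-th power
    of the degree. *)
Lemma w1_W1norm r f k : 1 <= r -> 0 <= k -> w1 r f k -> (W1norm h mu r f <= ((1 + K) * k)%:E)%E.
Proof.
move=> r1 k0 H; have r0 : 0 < r by exact: lt_le_trans r1.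
have F0 (p : Gamma * Gamma) : 0 <= normc (grd f p) `^ r * wt p.
  by rewrite mulr_ge0 ?powR_ge0 ?wt_ge0.
rewrite mulrDl mul1r EFinD; apply: leeD.
  apply/lpnormP => //; apply: (bsum_fst F0 _ H) => x; exists [:: x] => //.
  by rewrite big_seq1 /grd /= eqxx.
apply/lpnormP => //; first by rewrite mulr_ge0// ltW// K_gt0.
have := bsumZ (powR_ge0 K r) H; rewrite -powRM ?(ltW K_gt0)//.
move/(bsum_fst _); apply; first by move=> p; rewrite mulr_ge0 ?powR_ge0.
move=> x; exists (nb h x); first exact: nb_uniq.
rewrite normcR ger0_norm ?grad_ge0//.
have -> : \sum_(j <- nb h x) K `^ r * (normc (grd f (x, j)) `^ r * wt (x, j)) =
    K `^ r * (\sum_(j <- nb h x) normc (grd f (x, j)) `^ r) * m x.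
  by rewrite -mulrA mulr_suml mulr_sumr.
rewrite ler_wpM2r ?(ltW (vmass_gt0 G _))//.
apply: le_trans (_ : (\sum_(y <- nb h x) normc (grd f (x, y))) `^ r <= _).
  rewrite ge0_ler_powR ?nnegrE ?grad_ge0 ?(ltW r0) ?grad_le_sum// sumr_ge0// => *; exact: normc_ge0.
apply: le_trans (powR_sum_le _ r0 (fun y => normc_ge0 _)) _.
rewrite ler_wpM2r ?sumr_ge0//; try by move=> *; exact: powR_ge0.
rewrite ge0_ler_powR ?nnegrE ?(ltW r0) ?(ltW K_gt0)//.
by case: gK.
Qed.

End SobolevEnergy.

(** * Negative Sobolev norms tested on finitely supported functions *)

Section NegativeSobolev.
Variables (R : realType) (Gamma : choiceType) (h mu : Gamma -> Gamma -> R).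
Hypothesis G : weighted_graph h mu.
Variable K : R.
Hypothesis gK : graph_const h mu K.
Implicit Types (f g : Gamma -> R[i]) (r k A : R) (phi psi : finsupp_fun R Gamma)
  (T : finsupp_fun R Gamma -> R[i]^o).

Local Notation W1 := (w1 h mu).

Lemma fslin_finite (a : R[i]) phi psi :
  finite_set [set x | a * sval phi x + sval psi x != 0].
Proof.
apply: (@sub_finite_set _ _ ([set x | sval phi x != 0] `|` [set x | sval psi x != 0])).
  move=> x /=; have [->|] := eqVneq (sval phi x) 0; last by left.
  by rewrite mulr0 add0r; right.
by rewrite finite_setU; split; [exact: (svalP phi)|exact: (svalP psi)].
Qed.

Definition fslin (a : R[i]) phi psi : finsupp_fun R Gamma :=
  exist _ (fun x => a * sval phi x + sval psi x) (fslin_finite a phi psi).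

Lemma fsupp_seq_finite f (s : seq Gamma) : (forall x, x \notin s -> f x = 0) ->
  finite_set [set x | f x != 0].
Proof.
move=> fs; apply: (@sub_finite_set _ _ [set` s]); last exact: finite_seq.
by move=> x /=; apply: contraR => /fs ->.
Qed.

Definition fsupp_seq f s (fs : forall x, x \notin s -> f x = 0) : finsupp_fun R Gamma :=
  exist _ f (fsupp_seq_finite fs).

Lemma finsupp_seq phi : exists2 s : seq Gamma, uniq s & forall x, x \notin s -> sval phi x = 0.
Proof.
exists (finmap.enum_fset (fset_set [set x | sval phi x != 0])); first exact: finmap.fset_uniq.
move=> x xs; apply/eqP; apply: contraNT xs => x0.
have : x \in fset_set [set x | sval phi x != 0] by rewrite in_fset_set; [exact/mem_set|exact: (svalP phi)].
by [].
Qed.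

Lemma finsupp_ext phi psi : sval phi = sval psi -> phi = psi.
Proof. by case: phi => f ?; case: psi => g ? /= E; exact: eq_exist. Qed.

Definition tlin T := forall a phi psi, T (fslin a phi psi) = a * T phi + T psi.

(** The working form of the negative Sobolev norm; under density it is equivalent to [Wm1norm] up to
    the factor 1 + K ([Wm1norm_bounded], [bounded_Wm1norm]). *)
Definition tbd r T A := forall phi k, 0 <= k -> W1 r (sval phi) k -> normc (T phi) <= A * k.

Lemma tlin0 T phi : tlin T -> sval phi = (fun=> 0) -> T phi = 0.
Proof.
move=> Tl E; have F : fslin 1 phi phi = phi.
  by apply: finsupp_ext; apply/funext => x /=; rewrite E mulr0 addr0.
by have /eqP := Tl 1 phi phi; rewrite F mul1r eq_sym -subr_eq0 addrK => /eqP.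
Qed.

Lemma tlin_comb T a phi psi chi : tlin T -> sval chi = (fun x => a * sval phi x + sval psi x) ->
  T chi = a * T phi + T psi.
Proof. by move=> Tl E; rewrite -Tl; congr (T _); exact: finsupp_ext. Qed.

Lemma grd_finsupp phi : exists2 t : seq (Gamma * Gamma), uniq t &
  forall p, p \notin t -> grd h (sval phi) p = 0.
Proof.
have [s us s0] := finsupp_seq phi.
pose X := undup (s ++ flatten [seq nb h x | x <- s]).
exists [seq (x, y) | x <- X, y <- X].
  by apply: allpairs_uniq; rewrite ?undup_uniq// => -[a b] [c d] /= _ _ [-> ->].
move=> [x y] xyt; apply/eqP; apply: contraNT xyt => g0; apply/allpairsP; exists (x, y).
rewrite !mem_undup !mem_cat /=; move: g0; rewrite /grd /=; have [->|yx] := eqVneq y x.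
  by move=> fx; have xs : x \in s by [apply: contraNT fx => /s0 ->]; rewrite xs.
case: ifP => [xy|]; rewrite ?eqxx// mulf_eq0 negb_or => /andP[_ fxy].
have inX a b : adj h a b -> sval phi a != 0 -> (a \in s) /\ (b \in flatten [seq nb h x | x <- s]).
  move=> ab fa; have sa : a \in s by apply: contraNT fa => /s0 ->.
  by split => //; apply/flattenP; exists (nb h a); [exact: map_f|rewrite (mem_nb G)].
have [x0|xN] := eqVneq (sval phi x) 0.
  have yN : sval phi y != 0 by move: fxy; rewrite x0 subr0.
  by have [-> ->] := inX y x ltac:(by rewrite (adj_sym G)) yN; rewrite orbT.
by have [-> ->] := inX x y xy xN; rewrite orbT.
Qed.

Lemma finsupp_w1 r phi : 0 < r -> exists2 k, 0 <= k & W1 r (sval phi) k.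
Proof.
move=> r0; have [t ut t0] := grd_finsupp phi.
set S := \sum_(p <- t) normc (grd h (sval phi) p) `^ r * wt h mu p.
have F0 p : 0 <= normc (grd h (sval phi) p) `^ r * wt h mu p.
  by rewrite mulr_ge0 ?powR_ge0 ?wt_ge0.
have S0 : 0 <= S by apply: sumr_ge0 => p _; exact: F0.
exists (S `^ r^-1); first exact: powR_ge0.
rewrite /w1 -powRrM mulVf ?gt_eqF// powRr1//; apply: bsum_supp => // p /t0 ->.
by rewrite normc0E powR0 ?gt_eqF// mul0r.
Qed.

Lemma finsupp_W1_fin r phi : 1 <= r -> (W1norm h mu r (sval phi) < +oo)%E.
Proof.
move=> r1; have [k k0 H] := finsupp_w1 phi (lt_le_trans ltr01 r1).
by apply: le_lt_trans (w1_W1norm G gK r1 k0 H) _; rewrite ltry.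
Qed.

Lemma le_forall_eps (x c k : R) : 0 <= c -> (forall e, 0 < e -> x <= c * (k + e)) -> x <= c * k.
Proof.
move=> c0 H; apply/ler_addgt0Pl => e e0.
have c1 : 0 < c + 1 by rewrite ltr_wpDl.
apply: le_trans (H (e / (c + 1)) _) _; first by rewrite divr_gt0.
rewrite mulrDr addrC lerD2r mulrCA ler_piMr ?(ltW e0)// ler_pdivrMr// mul1r lerDl.
exact: ler01.
Qed.

Lemma Wm1norm_bounded p T B : 1 <= conj_exp p -> (Wm1norm h mu p T < B%:E)%E ->
  [/\ 0 <= B, tlin T & tbd (conj_exp p) T ((1 + K) * B)].
Proof.
set r := conj_exp p => r1 /ereal_inf_lt[_ [L [Llin LT] <-] LB].
have r0 : 0 < r by exact: lt_le_trans r1.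
have fin phi := finsupp_W1_fin phi r1.
have K1 : 0 < 1 + K by rewrite ltr_wpDr// (ltW (K_gt0 gK)).
have W0 : (W1norm h mu r (fun=> 0%R) <= 0)%E.
  have := w1_W1norm G gK r1 (lexx 0) (@w1_zero _ _ h mu r 0 _).
  by rewrite mulr0; apply; rewrite gt_eqF.
have L0 : L (fun=> 0) = 0.
  have W0f : (W1norm h mu r (fun=> 0%R) < +oo)%E by apply: le_lt_trans W0 _; rewrite ltry.
  have := Llin 1 _ _ W0f W0f; rewrite (_ : (fun x => _) = fun=> 0); last by apply/funext => x; rewrite mulr0 addr0.
  by move/eqP; rewrite mul1r eq_sym -subr_eq0 addrK => /eqP.
have LBf f : (W1norm h mu r f <= 1)%E -> normc (L f) <= B.
  move=> f1; rewrite -lee_fin; apply: le_trans (ltW LB); apply: ereal_sup_ubound.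
  by exists f.
have B0 : 0 <= B.
  by apply: le_trans (LBf (fun=> 0) _); rewrite ?normc_ge0// (le_trans W0)// lee_fin.
split => //.
  by move=> a phi psi; rewrite -!LT /= Llin.
move=> phi k k0 Wk; apply: le_forall_eps => [|e e0]; first by rewrite mulr_ge0// ltW.
(* k may be 0, so the test function is normalised by k + e. *)
have ke : 0 < k + e by rewrite ltr_wpDl.
pose c := (1 + K) * (k + e); have c0 : 0 < c by rewrite mulr_gt0.
have H : normc (L (fun x => (c^-1)%:C * sval phi x)) <= B.
  have nc : normc (c^-1)%:C = c^-1 by rewrite normcR ger0_norm// invr_ge0 ltW.
  apply: LBf; apply: le_trans (w1_W1norm G gK r1 _ (w1Z (c^-1)%:C k0 Wk)) _.
    by rewrite mulr_ge0 ?normc_ge0.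
  rewrite nc lee_fin /c mulrCA ler_pdivrMl ?mulr_gt0// mulr1 ler_pM2l// lerDl ltW//.
have E : L (fun x => (c^-1)%:C * sval phi x) = (c^-1)%:C * T phi.
  have W0f : (W1norm h mu r (fun=> 0%R) < +oo)%E by apply: le_lt_trans W0 _; rewrite ltry.
  have := Llin (c^-1)%:C _ _ (fin phi) W0f; rewrite L0 addr0 LT => <-.
  by congr L; apply/funext => x; rewrite addr0.
move: H; rewrite E normcME normcR ger0_norm; last by rewrite invr_ge0 ltW.
by rewrite ler_pdivrMl// /c mulrAC.
Qed.

Section Extension.
Variables (r A : R) (T : finsupp_fun R Gamma -> R[i]^o).
Hypotheses (r1 : 1 <= r) (A0 : 0 <= A) (Tl : tlin T) (Tb : tbd r T A)
  (dense : finsupp_dense h mu r).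

Let r0 : 0 < r. Proof. exact: lt_le_trans r1. Qed.
Let K1 : 0 < 1 + K. Proof. by rewrite ltr_wpDr// (ltW (K_gt0 gK)). Qed.

Definition near_fs f phi d := 0 <= d /\ W1 r (fun x => f x - sval phi x) d.

(** Extension by density without sequences: an approximant phi at distance d predicts at least F (T
    phi) - A d, and [near_fs_dist] makes the predictions compatible. F is the real or the imaginary
    part. *)
Definition ext_part (F : R[i] -> R) f : R :=
  sup [set a | exists phi d, near_fs f phi d /\ a = F (T phi) - A * d].

Definition ext f : R[i] := ext_part (@complex.Re R) f +i* ext_part (@complex.Im R) f.

Lemma near_fs_dense f e : (W1norm h mu r f < +oo)%E -> 0 < e -> exists phi, near_fs f phi e.
Proof.
move=> ff e0; have [phi H] := dense ff (divr_gt0 e0 K1).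
exists phi; split; first exact: ltW.
have := W1norm_w1 G gK r1 _ (ltW H); rewrite divr_ge0 ?(ltW e0) ?(ltW K1)// => /(_ isT).
by rewrite mulrC divfK ?gt_eqF.
Qed.

Lemma near_fs_dist f phi psi d e : near_fs f phi d -> near_fs f psi e ->
  normc (T phi - T psi) <= A * (d + e).
Proof.
move=> [d0 fd] [e0 fe].
suff : normc (T (fslin (-1) psi phi)) <= A * (d + e) by rewrite Tl mulN1r addrC.
apply: Tb; first exact: addr_ge0.
rewrite addrC; apply: eq_w1 (w1D G r1 e0 d0 fe (w1N d0 fd)) => x /=.
by rewrite mulN1r opprB addrC addrA subrK addrC.
Qed.

Lemma ext_part_near (F : R[i] -> R) f phi d :
  (forall x y, `|F x - F y| <= normc (x - y)) -> near_fs f phi d ->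
  `|F (T phi) - ext_part F f| <= A * d.
Proof.
move=> F1 fd; set X := [set a | exists phi d, near_fs f phi d /\ a = F (T phi) - A * d].
have ub psi e : near_fs f psi e -> ubound X (F (T psi) + A * e).
  move=> fe _ [phi' [d' [fd' ->]]].
  have := le_trans (F1 _ _) (near_fs_dist fd' fe); rewrite ler_norml mulrDr; lra.
have X0 : X !=set0 by exists (F (T phi) - A * d), phi, d.
rewrite ler_norml; apply/andP; split.
  have := ge_sup X0 (ub _ _ fd); rewrite /ext_part -/X; lra.
have : F (T phi) - A * d <= sup X.
  by apply: ub_le_sup; [exists (F (T phi) + A * d); exact: ub|exists phi, d].
rewrite /ext_part -/X; lra.
Qed.

Lemma ext_near f phi d : near_fs f phi d -> normc (T phi - ext f) <= 2 * A * d.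
Proof.
move=> fd; apply: le_trans (normc_le_ReIm _) _; rewrite ReB ImB -mulrA mulr2n mulrDl mul1r.
by apply: lerD; apply: ext_part_near fd => x y;
  rewrite -?ReB -?ImB ?normc_ge_absRe ?normc_ge_absIm.
Qed.

Lemma normc_small_eq0 (z : R[i]) (c : R) : 0 <= c ->
  (forall e, 0 < e -> normc z <= c * e) -> z = 0.
Proof.
move=> c0 H; apply/eqP; rewrite -normc_eq0E; apply/eqP/le_anti; rewrite normc_ge0 andbT.
have := @le_forall_eps (normc z) c 0 c0; rewrite mulr0; apply => e e0.
by rewrite add0r H.
Qed.

Lemma ext_finsupp phi : ext (sval phi) = T phi.
Proof.
have : near_fs (sval phi) phi 0.
  split => //; rewrite (_ : (fun x => _) = fun=> 0); first by apply: w1_zero; rewrite gt_eqF.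
  by apply/funext => x; rewrite subrr.
move/ext_near; rewrite mulr0 => H; apply/eqP; rewrite eq_sym -subr_eq0 -normc_eq0E.
by rewrite eq_le H normc_ge0.
Qed.

Lemma ext_linear : linear_on_W1 h mu r ext.
Proof.
move=> a f g ff gf; apply/eqP; rewrite -subr_eq0; apply/eqP.
have na := normc_ge0 a.
apply: (@normc_small_eq0 _ (4 * A * (normc a + 1))) => [|e e0].
  by rewrite !mulr_ge0// addr_ge0.
have [phi fp] := near_fs_dense ff e0; have [psi gp] := near_fs_dense gf e0.
have nn : near_fs (fun x => a * f x + g x) (fslin a phi psi) (normc a * e + e).
  split; first by rewrite addr_ge0 ?mulr_ge0 ?(ltW e0).
  have ae : 0 <= normc a * e by rewrite mulr_ge0 ?(ltW e0).
  apply: eq_w1 (w1D G r1 ae (ltW e0) (w1Z a (ltW e0) fp.2) gp.2) => x /=.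
  by rewrite mulrBr opprD addrACA.
have := ext_near nn; have := ext_near fp; have := ext_near gp; rewrite Tl.
move=> H1 H2 H3.
have alg (u v l1 l2 l3 : R[i]) :
    l3 - (a * l1 + l2) = (a * (u - l1) + (v - l2)) - (a * u + v - l3).
  by clear; ring.
rewrite (alg (T phi) (T psi)).
apply: le_trans (ler_normcB _ _) _; apply: le_trans (lerD (ler_normcD _ _) H3) _.
rewrite normcME; apply: le_trans (lerD (lerD (ler_wpM2l na H2) H1) (lexx _)) _.
by rewrite le_eqVlt; apply/orP; left; apply/eqP; ring.
Qed.

Lemma ext_bounded f : (W1norm h mu r f <= 1)%E -> normc (ext f) <= (1 + K) * A.
Proof.
move=> f1; have ff : (W1norm h mu r f < +oo)%E by apply: le_lt_trans f1 _; rewrite ltry.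
have wf := W1norm_w1 G gK r1 ler01 f1; rewrite mulr1 in wf.
rewrite mulrC; apply: le_forall_eps => // e e0.
(* T phi costs A (1 + K + e/3) and the distance to the extension 2 A e/3. *)
have e3 : 0 < e / 3 by rewrite divr_gt0.
have [phi fp] := near_fs_dense ff e3.
have wp : W1 r (sval phi) (1 + K + e / 3).
  apply: eq_w1 (w1D G r1 (ltW K1) (ltW e3) wf (w1N (ltW e3) fp.2)) => x /=.
  by rewrite opprB addrC subrK.
have H1 := Tb (addr_ge0 (ltW K1) (ltW e3)) wp; have H2 := ext_near fp.
rewrite -[ext f](subKr (T phi)); apply: le_trans (ler_normcB _ _) _.
apply: le_trans (lerD H1 H2) _; rewrite le_eqVlt; apply/orP; left; apply/eqP.
by field.
Qed.

End Extension.

Lemma bounded_Wm1norm p T A : 1 <= conj_exp p -> finsupp_dense h mu (conj_exp p) -> 0 <= A ->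
  tlin T -> tbd (conj_exp p) T A -> (Wm1norm h mu p T <= ((1 + K) * A)%:E)%E.
Proof.
move=> r1 dn A0 Tl Tb; apply: ge_ereal_inf.
exists (dual_norm h mu (conj_exp p) (ext (conj_exp p) A T)); first exists (ext (conj_exp p) A T) => //.
  split; first exact: ext_linear.
  by move=> phi; exact: ext_finsupp.
apply: ge_ereal_sup => _ [f f1 <-]; rewrite lee_fin.
exact: ext_bounded.
Qed.

End NegativeSobolev.

(** * Interpolation of coefficient functionals *)

Section ComplexExponential.
Variable R : realType.
Implicit Types (z w : R[i]) (x y k : R).

Lemma mean_value_bound (f df : R -> R) (M y : R) :
  (forall x, is_derive x 1 f (df x)) -> (forall c, `|c| <= `|y| -> `|df c| <= M) ->
  `|f y - f 0| <= M * `|y|.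
Proof.
move=> fd dM.
have cf a b : {within `[a, b], continuous f}.
  apply: continuous_subspaceT => x; apply: differentiable_continuous.
  by apply/derivable1_diffP; apply: ex_derive.
have [y0|y0] := leP 0 y.
  have [c cy ->] := MVT_segment y0 (fun x _ => fd x) (cf _ _).
  rewrite subr0 normrM ler_wpM2r// dM//; move: cy; rewrite in_itv /= => /andP[c0 cy].
  by rewrite !ger0_norm.
have [c cy E] := MVT_segment (ltW y0) (fun x _ => fd x) (cf _ _).
rewrite distrC E sub0r normrM normrN ler_wpM2r// dM//.
move: cy; rewrite in_itv /= => /andP[c0 cy].
by rewrite !ler0_norm ?lerN2// ltW.
Qed.

Lemma abs_sin_le y : `|sin y| <= `|y|.
Proof.
have := @mean_value_bound sin cos 1 y _ _; rewrite sin0 subr0 mul1r; apply=> c.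
by move=> _; exact: cos_max.
Qed.

Lemma abs_cosB1_le y : `|cos y - 1| <= `|y| ^+ 2.
Proof.
have := @mean_value_bound cos (fun x => - sin x) `|y| y _ _; rewrite cos0 expr2; apply=> c.
by move=> cy; rewrite normrN (le_trans (abs_sin_le _)).
Qed.

Lemma abs_sinB_le y : `|sin y - y| <= `|y| ^+ 2.
Proof.
have D (c : R) : is_derive c 1 (fun x : R => sin x - x) (cos c - 1) by apply: is_deriveB.
have := @mean_value_bound _ _ `|y| y D; rewrite sin0 !subr0 expr2; apply=> c cy.
have := @mean_value_bound cos _ 1 c (fun x => is_derive_cos x); rewrite cos0 mul1r => H.
by apply: le_trans (H _) cy => e _; rewrite normrN sin_max.
Qed.

Lemma abs_expRB1_le x : `|expR x - 1| <= `|x| * expR `|x|.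
Proof.
have H1 := expR_ge1Dx x; have H2 := expR_ge1Dx (- x); rewrite expRN in H2.
have e0 := expR_gt0 x.
have [x0|x0] := leP 0 x.
  rewrite ger0_norm; last by rewrite subr_ge0 -expR0 ler_expR.
  by rewrite ger0_norm//; move: H2; rewrite -[leRHS]mul1r ler_pdivlMr// mulrDl mul1r mulNr; lra.
rewrite ler0_norm; last by rewrite subr_le0 -expR0 ler_expR ltW.
rewrite ler0_norm ?(ltW x0)//; apply: le_trans (_ : - x <= _); first by lra.
by rewrite ler_peMr ?oppr_ge0 ?(ltW x0)// -expR0 ler_expR oppr_ge0 ltW.
Qed.

Lemma abs_expRB1Dx_le x : `|expR x - 1 - x| <= `|x| ^+ 2 * expR `|x|.
Proof.
rewrite ger0_norm; last by have := expR_ge1Dx x; lra.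
have e0 := expR_gt0 x; have H2 := expR_ge1Dx (- x); rewrite expRN in H2.
have {H2} H : expR x - 1 - x <= x * (expR x - 1).
  by move: H2; rewrite -[leRHS]mul1r ler_pdivlMr// mulrDl mul1r mulNr; lra.
apply: le_trans H _; apply: le_trans (ler_norm _) _; rewrite normrM expr2 -mulrA.
by rewrite ler_wpM2l// abs_expRB1_le.
Qed.

(** The exponential exp (k z) with real rate k, that is lam^z for k = ln lam. *)
Definition cexp k z : R[i] :=
  (expR (k * complex.Re z))%:C * (cos (k * complex.Im z) +i* sin (k * complex.Im z)).

Lemma normc_cexp k z : normc (cexp k z) = expR (k * complex.Re z).
Proof.
rewrite /cexp normcME normcR ger0_norm ?expR_ge0//.
by rewrite /ComplexField.Normc.normc cos2Dsin2 sqrtr1 mulr1.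
Qed.

Lemma cexpD k z w : cexp k (z + w) = cexp k z * cexp k w.
Proof.
rewrite /cexp ReD ImD !mulrDr expRD cosD sinD.
by apply: complex_eqP => /=; ring.
Qed.

Lemma cexp_real k x : cexp k x%:C = (expR (k * x))%:C.
Proof. by rewrite /cexp /= mulr0 cos0 sin0 mulr1. Qed.

(** The remainder is explicit in k: in the analytic family the rate varies with the edge and is
    unbounded, so differentiability for each k separately would not suffice. *)
Lemma normc_cexpB1_le k z :
  normc (cexp k z - 1 - k%:C * z) <= 4 * (`|k| * normc z) ^+ 2 * expR (`|k| * normc z).
Proof.
set x := k * complex.Re z; set y := k * complex.Im z; set N := `|k| * normc z.
have xN : `|x| <= N by rewrite normrM ler_wpM2l// normc_ge_absRe.
have yN : `|y| <= N by rewrite normrM ler_wpM2l// normc_ge_absIm.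
have N0 : 0 <= N by rewrite mulr_ge0 ?normc_ge0.
have eN : expR `|x| <= expR N by rewrite ler_expR.
have e1 : 1 <= expR N by rewrite -expR0 ler_expR.
have ex : expR x <= expR N by apply: le_trans eN; rewrite ler_expR ler_norm.
have e0 := expR_ge0 N.
have Q : N ^+ 2 <= N ^+ 2 * expR N by rewrite ler_peMr// sqr_ge0.
have x2 : `|x| ^+ 2 <= N ^+ 2 by rewrite lerXn2r ?nnegrE.
have y2 : `|y| ^+ 2 <= N ^+ 2 by rewrite lerXn2r ?nnegrE.
apply: le_trans (normc_le_ReIm _) _; rewrite !ReB !ImB.
have -> : complex.Re (cexp k z) = expR x * cos y by rewrite ReM /= mul0r subr0.
have -> : complex.Im (cexp k z) = expR x * sin y by rewrite ImM /= mul0r addr0.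
have -> : complex.Re (k%:C * z) = x by rewrite ReM /= mul0r subr0.
have -> : complex.Im (k%:C * z) = y by rewrite ImM /= mul0r addr0.
rewrite /=.
have -> : 4 * N ^+ 2 * expR N = (N ^+ 2 * expR N + N ^+ 2 * expR N) +
  (N ^+ 2 * expR N + N ^+ 2 * expR N) by ring.
apply: lerD.
  rewrite (_ : _ - _ - _ = (expR x - 1 - x) + expR x * (cos y - 1)); last by ring.
  apply: le_trans (ler_normD _ _) _; apply: lerD.
    by apply: le_trans (abs_expRB1Dx_le x) _; rewrite ler_pM ?expR_ge0 ?sqr_ge0.
  rewrite normrM (ger0_norm (expR_ge0 x)) mulrC; apply: ler_pM => //; rewrite ?expR_ge0//.
  exact: le_trans (abs_cosB1_le y) y2.
rewrite (_ : _ - _ - _ = (expR x - 1) * sin y + (sin y - y)); last by ring.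
apply: le_trans (ler_normD _ _) _; apply: lerD; last first.
  by apply: le_trans Q; apply: le_trans (abs_sinB_le y) _.
rewrite normrM expr2 mulrAC; apply: ler_pM => //; last exact: le_trans (abs_sin_le y) yN.
by apply: le_trans (abs_expRB1_le x) _; rewrite ler_pM ?expR_ge0.
Qed.

Lemma cexp_taylor k z w : normc (cexp k w - cexp k z - k%:C * cexp k z * (w - z)) <=
  expR (k * complex.Re z) * (4 * (`|k| * normc (w - z)) ^+ 2 * expR (`|k| * normc (w - z))).
Proof.
have -> : cexp k w - cexp k z - k%:C * cexp k z * (w - z) =
    cexp k z * (cexp k (w - z) - 1 - k%:C * (w - z)).
  have -> : cexp k w = cexp k (w - z) * cexp k z by rewrite -cexpD subrK.
  by ring.
by rewrite normcME normc_cexp ler_wpM2l ?expR_ge0// normc_cexpB1_le.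
Qed.

Lemma cxderiv_cexp k z : cxderiv (cexp k) z (k%:C * cexp k z).
Proof.
move=> e e0; set C := expR (k * complex.Re z) * (4 * `|k| ^+ 2 * expR `|k|).
have C0 : 0 <= C by rewrite !mulr_ge0 ?expR_ge0.
exists (Num.min 1 (e / (C + 1))); first by rewrite lt_min ltr01 divr_gt0// ltr_wpDl.
move=> w; rewrite lt_min => /andP[w1 wC]; apply: le_trans (cexp_taylor k z w) _.
set n := normc (w - z) in w1 wC *; have n0 : 0 <= n by exact: normc_ge0.
apply: le_trans (_ : C * n * n <= _); last first.
  rewrite ler_wpM2r//; move: wC; rewrite ltr_pdivlMr ?ltr_wpDl// => wC.
  by apply: le_trans (ltW wC); rewrite mulrC ler_wpM2l// lerDl.
have -> : C * n * n = expR (k * complex.Re z) * (4 * (`|k| * n) ^+ 2 * expR `|k|).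
  by rewrite /C; ring.
rewrite ler_wpM2l ?expR_ge0// ler_wpM2l ?mulr_ge0 ?sqr_ge0// ler_expR ler_piMr//.
exact: ltW.
Qed.

End ComplexExponential.

Lemma Re_sum (R : realType) (I : Type) (s : seq I) (F : I -> R[i]) :
  complex.Re (\sum_(i <- s) F i) = \sum_(i <- s) complex.Re (F i).
Proof. by apply: (big_morph _ (@ReD R)). Qed.

Lemma Im_sum (R : realType) (I : Type) (s : seq I) (F : I -> R[i]) :
  complex.Im (\sum_(i <- s) F i) = \sum_(i <- s) complex.Im (F i).
Proof. by apply: (big_morph _ (@ImD R)). Qed.

(** * Functionals on W^{1,r} as l^p coefficients *)

Section Representation.
Variables (R : realType) (Gamma : choiceType) (h mu : Gamma -> Gamma -> R).
Hypothesis G : weighted_graph h mu.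
Variable K : R.
Hypothesis gK : graph_const h mu K.
Implicit Types (phi psi : finsupp_fun R Gamma) (T : finsupp_fun R Gamma -> R[i]^o).

Local Notation J := (Gamma * Gamma)%type.
Local Notation w := (wt h mu).
Local Notation V := (J -> R[i]^o).

Let w0 p : 0 <= w p. Proof. exact: wt_ge0. Qed.

Definition fsupp_on (x : V) (t : seq J) := forall j, j \notin t -> x j = 0.

Definition single (j : J) (c : R[i]) : V := fun i => if i == j then c else 0.

Lemma en_finite r (x : V) t : 0 < r -> uniq t -> fsupp_on x t ->
  en w r x (\sum_(j <- t) normc (x j) `^ r * w j).
Proof.
move=> r0 ut xt; apply: bsum_supp => // [j|j /xt ->]; first by rewrite mulr_ge0 ?powR_ge0.
by rewrite normc0E powR0 ?gt_eqF// mul0r.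
Qed.

Lemma en_finite_k r (x : V) t : 0 < r -> uniq t -> fsupp_on x t ->
  exists2 k, 0 <= k & en w r x (k `^ r).
Proof.
move=> r0 ut xt; exists ((\sum_(j <- t) normc (x j) `^ r * w j) `^ r^-1); first exact: powR_ge0.
rewrite -powRrM mulVf ?gt_eqF// powRr1; first exact: en_finite.
by apply: sumr_ge0 => j _; rewrite mulr_ge0 ?powR_ge0.
Qed.

Lemma sum_single (x : V) t : uniq t -> fsupp_on x t -> x = \sum_(j <- t) single j (x j).
Proof.
move=> ut xt; apply/funext => i; rewrite fct_sumE.
have [it|it] := boolP (i \in t).
  rewrite (big_rem i)//= {1}/single eqxx big_seq big1 ?addr0// => j.
  by rewrite (mem_rem_uniq _ ut) inE => /andP[ji _]; rewrite /single eq_sym (negbTE ji).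
rewrite xt// big_seq big1// => j jt; rewrite /single; case: eqP => // ij.
by rewrite ij jt in it.
Qed.

(** Converse Hoelder: on a finite list the extremal test vector |u|^(p - 2) conj u has r-th power
    |u|^p and product |u|^p with u. *)
Lemma en_norming (p r A : R) (u : J -> R[i]) : 1 < p -> p^-1 + r^-1 = 1 -> 0 <= A ->
  (forall t (g : V) k, uniq t -> fsupp_on g t -> 0 <= k -> en w r g (k `^ r) ->
     \sum_(j <- t) complex.Re (g j * u j) * w j <= A * k) -> en w p u (A `^ p).
Proof.
move=> p1 pr A0 H t ut; have p0 : 0 < p by exact: lt_trans p1.
have r0 : 0 < r.
  rewrite -invr_gt0; have -> : r^-1 = 1 - p^-1 by rewrite -pr; ring.
  by rewrite subr_gt0 invf_lt1.
pose g j : R[i] := if j \in t then ((normc (u j) `^ (p - 2)))%:C * (u j)^* else 0.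
set S := \sum_(j <- t) _.
have S0 : 0 <= S by apply: sumr_ge0 => j _; rewrite mulr_ge0 ?powR_ge0.
have gt : fsupp_on g t by move=> j /negbTE jt; rewrite /g jt.
have ngu j : j \in t -> normc (g j) `^ r = normc (u j) `^ p.
  move=> jt; rewrite /g jt normcME normcR ger0_norm ?powR_ge0//.
  have -> : normc (u j)^* = normc (u j).
    by case: (u j) => a b; rewrite /ComplexField.Normc.normc /= sqrrN.
  have [->|uj] := eqVneq (u j) 0.
    by rewrite normc0E mulr0 !powR0 ?gt_eqF.
  have un : 0 < normc (u j) by rewrite normc_gt0.
  rewrite -{2}(powRr1 (ltW un)) -powRD ?(gt_eqF un) ?implybT// -powRrM; congr (_ `^ _).
  have p10 : p - 1 != 0 by rewrite subr_eq0 gt_eqF.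
  have -> : r = p / (p - 1).
    rewrite -[r]invrK; have -> : r^-1 = 1 - p^-1 by rewrite -pr; ring.
    by field; rewrite p10 gt_eqF.
  by field.
have gS : en w r g ((S `^ r^-1) `^ r).
  rewrite -powRrM mulVf ?gt_eqF// powRr1//.
  have := en_finite r0 ut gt; congr (en _ _ _ _).
  by rewrite /S big_seq [RHS]big_seq; apply: eq_bigr => j jt; rewrite ngu.
have E : \sum_(j <- t) complex.Re (g j * u j) * w j = S.
  rewrite /S big_seq [RHS]big_seq; apply: eq_bigr => j jt; congr (_ * _).
  rewrite /g jt; have [->|uj] := eqVneq (u j) 0.
    by rewrite mulr0 normc0E powR0// gt_eqF.
  have un : 0 < normc (u j) by rewrite normc_gt0.
  rewrite -mulrA ReM /= mul0r subr0.
  have -> : complex.Re ((u j)^* * u j) = normc (u j) ^+ 2.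
    rewrite ReM /ComplexField.Normc.normc; case: (u j) => a b /=.
    by rewrite sqr_sqrtr ?addr_ge0 ?sqr_ge0//; ring.
  by rewrite -powR_mulrn ?(ltW un)// -powRD ?(gt_eqF un) ?implybT//; congr (_ `^ _); ring.
have := H t g _ ut gt (powR_ge0 _ _) gS; rewrite E => SA.
have [->|SN] := eqVneq S 0; first exact: powR_ge0.
have SP : 0 < S by rewrite lt_neqAle eq_sym SN.
have Sr : 0 < S `^ r^-1 by rewrite powR_gt0.
have : S `^ p^-1 <= A.
  have -> : p^-1 = 1 - r^-1 by rewrite -pr; ring.
  by rewrite powRB ?SN ?implybT// powRr1// ler_pdivrMr.
move=> H'; have -> : S = (S `^ p^-1) `^ p by rewrite -powRrM mulVf ?gt_eqF// powRr1.
by rewrite ge0_ler_powR ?nnegrE ?powR_ge0 ?(ltW p0).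
Qed.

Section HB.
Variables (p r A : R) (T : finsupp_fun R Gamma -> R[i]^o).
Hypotheses (p1 : 1 < p) (r1 : 1 < r) (pr : p^-1 + r^-1 = 1) (A0 : 0 <= A)
  (Tl : tlin T) (Tb : tbd h mu r T A).

Let r0 : 0 < r. Proof. exact: lt_trans r1. Qed.

Definition hbS : set V := [set x | exists2 t, uniq t & fsupp_on x t].

(** Its infimum is the infimal convolution of A times the l^r norm with Re T on the range of [grd].
    A linear functional below it is bounded by A, and equals Re T on that range since it lies below
    it for phi and - phi. *)
Definition hbX (x : V) : set R := [set a | exists k phi,
  [/\ 0 <= k, en w r (fun j => x j - grd h (sval phi) j) (k `^ r) &
      a = A * k + complex.Re (T phi)]].

Definition hbp (x : V) : R := inf (hbX x).

Let fs0 : finsupp_fun R Gamma := @fsupp_seq _ _ (fun=> 0) [::] (fun x _ => erefl).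

Let T0 : T fs0 = 0. Proof. exact: tlin0. Qed.

Lemma grd_fs0 j : grd h (sval fs0) j = 0.
Proof. by rewrite /grd /= subrr mulr0 !if_same. Qed.

Lemma hbX_inf x : hbS x -> has_inf (hbX x).
Proof.
move=> [t ut xt]; have [kx kx0 ex] := en_finite_k r0 ut xt; split.
  exists (A * kx + complex.Re (T fs0)), kx, fs0; split => //.
  by apply: bsumS ex => j /=; rewrite grd_fs0 subr0.
exists (- (A * kx)) => _ [k [phi [k0 ek ->]]].
have H : w1 h mu r (sval phi) (kx + k).
  have := en_k (-1) k0 ek; rewrite normcN' normc1E mul1r => ek'.
  apply: bsumS (enD w0 (ltW r1) kx0 k0 ex ek') => j /=.
  by rewrite mulN1r opprB addrC subrK.
have := le_trans (normc_ge_absRe _) (Tb (addr_ge0 kx0 k0) H).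
by rewrite ler_norml mulrDr; lra.
Qed.

Lemma hbp_le x k phi : hbS x -> 0 <= k ->
  en w r (fun j => x j - grd h (sval phi) j) (k `^ r) -> hbp x <= A * k + complex.Re (T phi).
Proof. by move=> Sx k0 ek; apply: ge_inf; [exact: (hbX_inf Sx).2|exists k, phi]. Qed.

Lemma hbSD x y : hbS x -> hbS y -> hbS (x + y).
Proof.
move=> [t ut xt] [s us ys]; exists (undup (t ++ s)); first exact: undup_uniq.
move=> j; rewrite mem_undup mem_cat negb_or => /andP[/xt jx /ys jy].
by rewrite -[LHS]/(x j + y j) jx jy addr0.
Qed.

Lemma hbSZ (c : R) x : hbS x -> hbS (c%:C *: x).
Proof.
move=> [t ut xt]; exists t => // j /xt jx.
by rewrite -[LHS]/(c%:C * x j) jx mulr0.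
Qed.

Lemma hbp_sublinear : sublinear hbS hbp.
Proof.
split=> [x y Sx Sy|c x Sx c0].
  apply/ler_addgt0Pl => e e0; have e2 : 0 < e / 2 by rewrite divr_gt0.
  have [_ [k [phi [k0 ek ->]]] H1] := inf_adherent e2 (hbX_inf Sx).
  have [_ [l [psi [l0 el ->]]] H2] := inf_adherent e2 (hbX_inf Sy).
  have := @hbp_le (x + y) (k + l) (fslin 1 phi psi) (hbSD Sx Sy) (addr_ge0 k0 l0).
  rewrite Tl mul1r ReD => H; apply: le_trans (H _) _; last first.
    rewrite mulrDr addrACA (splitr e); apply: le_trans (ltW (ltrD H1 H2)) _.
    by rewrite addrACA addrC.
  apply: bsumS (enD w0 (ltW r1) k0 l0 ek el) => j /=.
  by rewrite grdD grdZ mul1r opprD addrACA.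
rewrite -ler_pdivrMl//; apply: lb_le_inf; first exact: (hbX_inf Sx).1.
move=> _ [k [phi [k0 ek ->]]]; rewrite ler_pdivrMl//.
have := @hbp_le (c%:C *: x) (c * k) (fslin c%:C phi fs0) (hbSZ _ Sx) (mulr_ge0 (ltW c0) k0).
rewrite Tl T0 addr0 ReM /= mul0r subr0 mulrDr [c * (A * k)]mulrCA; apply.
have := en_k c%:C k0 ek; rewrite normcR ger0_norm ?(ltW c0)//.
apply: bsumS => j /=.
by rewrite grdD grdZ grd_fs0 addr0 -[X in normc (X - _)]/(c%:C * x j) -mulrBr.
Qed.

Lemma grd_hbS phi : hbS (grd h (sval phi)).
Proof. by have [t ut t0] := grd_finsupp G phi; exists t. Qed.

Lemma single_hbS j c : hbS (single j c).
Proof. by exists [:: j] => // i; rewrite inE /single => /negbTE ->. Qed.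

Lemma representation : exists2 u : J -> R[i], en w p u (A `^ p) &
  forall phi t, uniq t -> fsupp_on (grd h (sval phi)) t ->
    T phi = \sum_(j <- t) u j * grd h (sval phi) j * (w j)%:C.
Proof.
have [L [LD LZ Lp]] := hahn_banach hbSD hbSZ hbp_sublinear.
have LA x k : hbS x -> 0 <= k -> en w r x (k `^ r) -> L x <= A * k.
  move=> Sx k0 ek; apply: le_trans (Lp _ Sx) _.
  have := @hbp_le x k fs0 Sx k0; rewrite T0 addr0; apply.
  by apply: bsumS ek => j /=; rewrite grd_fs0 subr0.
have LTle phi : L (grd h (sval phi)) <= complex.Re (T phi).
  apply: le_trans (Lp _ (grd_hbS phi)) _.
  have := @hbp_le _ 0 phi (grd_hbS phi) (lexx _); rewrite mulr0 add0r; apply.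
  move=> s us; rewrite big1 ?powR_ge0// => j _.
  by rewrite subrr normc0E powR0 ?gt_eqF// mul0r.
have LT phi : L (grd h (sval phi)) = complex.Re (T phi).
  apply/le_anti; rewrite LTle/=; have := LTle (fslin (-1) phi fs0).
  have -> : grd h (sval (fslin (-1) phi fs0)) = ((-1)%:C *: (grd h (sval phi) : V)).
    apply/funext => j; rewrite -[RHS]/((-1)%:C * grd h (sval phi) j) /= grdD grdZ.
    by rewrite grd_fs0 addr0 rmorphN rmorph1.
  rewrite (LZ _ _ (grd_hbS phi)) mulN1r Tl T0 addr0 mulN1r lerNl.
  by case: (T phi) => a b /=; rewrite opprK.
have L0 : L 0 = 0.
  have S0 : hbS 0 by exists [::].
  by have := LZ 0 _ S0; rewrite rmorph0 scale0r mul0r.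
(* The sign is chosen so that L at c times the unit vector j is Re (c u_j) w_j for every complex
   c. *)
pose u j : R[i] := (L (single j 1) / w j) +i* (- (L (single j 'i) / w j)).
have wj j : w j != 0 by rewrite gt_eqF// (vmass_gt0 G).
have Ls j c : L (single j c) = complex.Re (c * u j) * w j.
  have -> : single j c = (complex.Re c)%:C *: single j 1 + (complex.Im c)%:C *: single j 'i.
    apply/funext => i.
    rewrite -[RHS]/((complex.Re c)%:C * single j 1 i + (complex.Im c)%:C * single j 'i i).
    rewrite /single; case: ifP => _; last by rewrite !mulr0 addr0.
    by case: c => a b; apply: complex_eqP => /=; ring.
  rewrite LD; try by apply: hbSZ; exact: single_hbS.
  rewrite !LZ; try exact: single_hbS.
  by rewrite ReM /u /=; field.
have Lsum x t : uniq t -> fsupp_on x t -> L x = \sum_(j <- t) complex.Re (x j * u j) * w j.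
  move=> ut xt; rewrite {1}(sum_single ut xt); elim: t {ut xt} => [|j t IH].
    by rewrite !big_nil.
  rewrite !big_cons LD ?IH ?Ls//; first exact: single_hbS.
  elim: t {IH} => [|i t IH]; first by rewrite big_nil; exists [::].
  by rewrite big_cons; apply: hbSD => //; exact: single_hbS.
exists u.
  apply: en_norming p1 pr A0 _ => t g k ut gt k0 ek; rewrite -Lsum//.
  by apply: LA => //; exists t.
move=> phi t ut pt; apply: complex_eqP.
  rewrite -LT (Lsum _ t)// Re_sum; apply: eq_bigr => j _.
  by rewrite [_ * u j]mulrC [RHS]ReM /= mulr0 subr0.
(* L represents only Re T; the imaginary part comes from complex linearity of T. *)
have -> : complex.Im (T phi) = - complex.Re (T (fslin 'i phi fs0)).
  by rewrite Tl T0 addr0; case: (T phi) => a b /=; ring.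
have pt' : fsupp_on (grd h (sval (fslin 'i phi fs0))) t.
  by move=> j /pt jt; rewrite /= grdD grdZ jt mulr0 grd_fs0 addr0.
rewrite -LT (Lsum _ t)// Im_sum -sumrN; apply: eq_bigr => j _.
rewrite grdD grdZ grd_fs0 addr0 -mulNr [RHS]ImM /= mulr0 add0r; congr (_ * _).
by case: (grd _ _ _) => a b; case: (u j) => c d /=; ring.
Qed.

End HB.
End Representation.

Section ConjugateExponent.
Variable R : realType.
Implicit Types p : R.

Lemma conj_expE p : 1 < p -> conj_exp p = p / (p - 1).
Proof.
move=> p1; rewrite /conj_exp /hoelder_conjugate /= eqe gt_eqF ?(lt_trans ltr01)//.
by rewrite -EFinD inver subr_eq0 gt_eqF.
Qed.

Lemma conj_exp_gt1 p : 1 < p -> 1 < conj_exp p.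
Proof. by move=> p1; rewrite conj_expE// ltr_pdivlMr ?subr_gt0// mul1r gtrBl. Qed.

Lemma conj_expV p : 1 < p -> p^-1 + (conj_exp p)^-1 = 1.
Proof.
move=> p1; rewrite conj_expE//; have p0 : p != 0 by rewrite gt_eqF ?(lt_trans ltr01).
have p10 : p - 1 != 0 by rewrite subr_eq0 gt_eqF.
by field; rewrite p0 p10.
Qed.

Lemma conj_exp_lt p p' : 1 < p -> p < p' -> conj_exp p' < conj_exp p.
Proof.
move=> p1 pp; have p'1 := lt_trans p1 pp.
rewrite !conj_expE// ltr_pdivlMr ?subr_gt0// mulrAC ltr_pdivrMr ?subr_gt0//.
by rewrite mulrBr mulr1 mulrBr mulr1 [p * p']mulrC ltrD2l ltrN2.
Qed.

End ConjugateExponent.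

Section CoefficientFunctionals.
Variables (R : realType) (Gamma : choiceType) (h mu : Gamma -> Gamma -> R).
Hypothesis G : weighted_graph h mu.
Variable K : R.
Hypothesis gK : graph_const h mu K.
Implicit Types (phi psi : finsupp_fun R Gamma) (T : finsupp_fun R Gamma -> R[i]^o).

Local Notation J := (Gamma * Gamma)%type.
Local Notation w := (wt h mu).
Local Notation FV := (finsupp_fun R Gamma -> R[i]^o).
Implicit Types u v : J -> R[i].

Let w0 p : 0 <= w p. Proof. exact: wt_ge0. Qed.

(** An arbitrary finite list carrying the gradient of phi; [Tu_seq] shows that the choice does not
    affect [Tu]. *)
Definition gsupp phi : seq J := sval (cid2 (grd_finsupp G phi)).

Lemma gsupp_uniq phi : uniq (gsupp phi).
Proof. by rewrite /gsupp; case: cid2. Qed.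

Lemma gsuppP phi j : j \notin gsupp phi -> grd h (sval phi) j = 0.
Proof. by rewrite /gsupp; case: cid2 => /= t _; apply. Qed.

Definition Tu u : FV := fun phi => \sum_(j <- gsupp phi) u j * grd h (sval phi) j * (w j)%:C.

Lemma Tu_seq u phi t : uniq t -> (forall j, j \notin t -> grd h (sval phi) j = 0) ->
  Tu u phi = \sum_(j <- t) u j * grd h (sval phi) j * (w j)%:C.
Proof.
move=> ut t0; have sub (s s' : seq J) : uniq s -> (forall j, j \notin s' -> grd h (sval phi) j = 0) ->
    \sum_(j <- s) u j * grd h (sval phi) j * (w j)%:C =
    \sum_(j <- s | j \in s') u j * grd h (sval phi) j * (w j)%:C.
  move=> us s0; rewrite (bigID (mem s')) /= [X in _ + X]big1 ?addr0// => j /s0 ->.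
  by rewrite mulr0 mul0r.
rewrite /Tu (sub _ t)//; last exact: gsupp_uniq.
rewrite [RHS](sub _ (gsupp phi))//; last exact: gsuppP.
rewrite -big_filter -[RHS]big_filter; apply: perm_big; apply: uniq_perm.
- by rewrite filter_uniq// gsupp_uniq.
- by rewrite filter_uniq.
- by move=> j; rewrite !mem_filter andbC.
Qed.

Lemma TuD u v : Tu (fun j => u j + v j) = Tu u + Tu v.
Proof.
apply/funext => phi; rewrite -[RHS]/(Tu u phi + Tu v phi) /Tu -big_split /=.
by apply: eq_bigr => j _; rewrite !mulrDl.
Qed.

Lemma TuZ (a : R[i]) u : Tu (fun j => a * u j) = a *: Tu u.
Proof.
apply/funext => phi; rewrite -[RHS]/(a * Tu u phi) /Tu mulr_sumr.
by apply: eq_bigr => j _; rewrite !mulrA.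
Qed.

Lemma TuB u v : Tu (fun j => u j - v j) = Tu u - Tu v.
Proof.
rewrite -scaleN1r -TuZ -TuD; congr Tu; apply/funext => j.
by rewrite mulN1r.
Qed.

Lemma Tu_tlin u : tlin (Tu u).
Proof.
move=> a phi psi; pose t := undup (gsupp phi ++ gsupp psi).
have ut : uniq t by exact: undup_uniq.
have tP j : j \notin t -> grd h (sval phi) j = 0 /\ grd h (sval psi) j = 0.
  by rewrite mem_undup mem_cat negb_or => /andP[/gsuppP-> /gsuppP->].
rewrite (Tu_seq _ ut); last by move=> j /tP[A B]; rewrite /= grdD grdZ A B mulr0 addr0.
rewrite (@Tu_seq u phi t)//; last by move=> j /tP[].
rewrite (@Tu_seq u psi t)//; last by move=> j /tP[].
rewrite mulr_sumr -big_split /=; apply: eq_bigr => j _; rewrite grdD grdZ; ring.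
Qed.

Lemma Tu_tbd (p r A : R) u : 1 < p -> p^-1 + r^-1 = 1 -> 0 <= A -> en w p u (A `^ p) ->
  tbd h mu r (Tu u) (2 * A).
Proof.
move=> p1 pr A0 uA phi k k0 wk; rewrite /Tu.
apply: le_trans (_ : \sum_(j <- gsupp phi) normc (u j) * normc (grd h (sval phi) j) * w j <= _).
  elim: (gsupp phi) => [|j s IH]; first by rewrite !big_nil normc0E.
  rewrite !big_cons (le_trans (ler_normcD _ _))// lerD// !normcME normcR ger0_norm//.
by rewrite -mulrA; apply: (en_pairing w0 (gsupp_uniq phi) p1 pr).
Qed.

Lemma Wm1norm_Tu (p A : R) u : 1 < p -> finsupp_dense h mu (conj_exp p) -> 0 <= A ->
  en w p u (A `^ p) -> (Wm1norm h mu p (Tu u) <= ((1 + K) * (2 * A))%:E)%E.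
Proof.
move=> p1 dn A0 uA; apply: (bounded_Wm1norm G gK) => //.
- exact/ltW/conj_exp_gt1.
- by rewrite mulr_ge0.
- exact: Tu_tlin.
- exact: Tu_tbd (conj_expV p1) A0 uA.
Qed.

Lemma en_dominated (p M : R) (V : J -> R) u : 0 <= p -> 0 <= M -> (forall j, 0 <= V j) ->
  bsum (fun j => V j `^ p * w j) 1 -> (forall j, normc (u j) <= M * V j) -> en w p u (M `^ p).
Proof.
move=> p0 M0 V0 VS uV; have := bsumZ (powR_ge0 M p) VS; rewrite mulr1; apply: bsumS => j.
rewrite mulrA ler_wpM2r// -powRM// ge0_ler_powR ?nnegrE ?normc_ge0 ?mulr_ge0//.
Qed.

(** Dominated convergence in l^p: off a finite list the tail of V controls u, on the list a uniform
    bound does. Coordinatewise continuity thus becomes norm continuity. *)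
Lemma en_small (p M e : R) (V : J -> R) : 1 < p -> 0 <= M -> (forall j, 0 <= V j) ->
  bsum (fun j => V j `^ p * w j) 1 -> 0 < e ->
  exists t : seq J, exists2 eta : R, 0 < eta & forall u, (forall j, normc (u j) <= M * V j) ->
    (forall j, j \in t -> normc (u j) <= eta) -> en w p u (e `^ p).
Proof.
move=> p1 M0 V0 VS e0; have p0 : 0 < p by exact: lt_trans p1.
have ep : 0 < e `^ p / 2 by rewrite divr_gt0 ?powR_gt0.
have M1 : 0 < M `^ p + 1 by rewrite ltr_wpDl ?powR_ge0.
have Vw j : 0 <= V j `^ p * w j by rewrite mulr_ge0 ?powR_ge0.
have [t ut tS] := bsum_tail Vw VS (divr_gt0 ep M1).
pose W := \sum_(j <- t) w j; have W0 : 0 <= W by apply: sumr_ge0.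
have W1 : 0 < W + 1 by rewrite ltr_wpDl.
pose eta := (e `^ p / 2 / (W + 1)) `^ p^-1.
exists t, eta; first by apply: powR_gt0; apply: divr_gt0.
move=> u uV ut'; have etap : eta `^ p = e `^ p / 2 / (W + 1).
  by rewrite /eta -powRrM mulVf ?gt_eqF// powRr1// divr_ge0 ?(ltW ep) ?(ltW W1).
have H1 := bsumZ (powR_ge0 M p) tS.
have H2 : bsum (fun j => if j \in t then eta `^ p * w j else 0) (eta `^ p * W).
  have := @bsum_supp R _ (fun j => if j \in t then eta `^ p * w j else 0) t ut _ _.
  rewrite big_seq (eq_bigr (fun j => eta `^ p * w j)); last by move=> j ->.
  rewrite -big_seq -mulr_sumr; apply.
    by move=> j; case: ifP => // _; rewrite mulr_ge0 ?powR_ge0.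
  by move=> j /negbTE ->.
apply: bsumW (bsumD H1 H2).
  move=> j; case: ifP => jt.
    rewrite mulr0 add0r ler_wpM2r// ge0_ler_powR ?nnegrE ?normc_ge0 ?powR_ge0 ?(ltW p0)//.
    exact: ut'.
  rewrite addr0 mulrA ler_wpM2r// -powRM// ge0_ler_powR ?nnegrE ?normc_ge0 ?mulr_ge0 ?(ltW p0)//.
rewrite etap [leRHS](splitr (e `^ p)); apply: lerD.
  by rewrite mulrCA ler_piMr ?(ltW ep)// ler_pdivrMr// mul1r lerDl.
by rewrite -mulrA ler_piMr ?(ltW ep)// mulrC ler_pdivrMr// mul1r lerDl.
Qed.

End CoefficientFunctionals.

(** * The analytic family through a coefficient functional *)

Section AnalyticFamily.
Variables (R : realType) (Gamma : choiceType) (h mu : Gamma -> Gamma -> R).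
Hypothesis G : weighted_graph h mu.
Variable K : R.
Hypothesis gK : graph_const h mu K.

Local Notation J := (Gamma * Gamma)%type.
Local Notation w := (wt h mu).
Local Notation FV := (finsupp_fun R Gamma -> R[i]^o).
Local Notation Tu := (Tu (h := h) (mu := mu) G).
Local Notation N := (Wm1norm h mu).

Variables (p1 p p2 : R).
Hypotheses (p1_gt1 : 1 < p1) (p1p : p1 < p) (pp2 : p < p2).
Hypotheses (dense1 : finsupp_dense h mu (conj_exp p1)) (dense2 : finsupp_dense h mu (conj_exp p2)).

Let p0 : 0 < p. Proof. by rewrite (lt_trans _ p1p)// (lt_trans ltr01). Qed.
Let p1_gt0 : 0 < p1. Proof. by rewrite (lt_trans ltr01). Qed.
Let p2_gt0 : 0 < p2. Proof. exact: lt_trans pp2. Qed.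
Let p2_gt1 : 1 < p2. Proof. exact: lt_trans (lt_trans p1_gt1 p1p) pp2. Qed.
Let K1 : 0 < 1 + K. Proof. by rewrite ltr_wpDr// (ltW (K_gt0 gK)). Qed.
Let w0 j : 0 <= w j. Proof. exact: wt_ge0. Qed.

Variable v : J -> R[i].
Hypothesis vS : en w p v 1.

Local Notation n j := (normc (v j)).

(** V0 and V1 are the moduli of the factor [e_] on the two boundary lines, of norm at most 1 in l^p1
    and l^p2; their sum dominates it throughout the strip. *)
Let V0 j := n j `^ (p / p1).
Let V1 j := n j `^ (p / p2).
Let U j := V0 j + V1 j.

Let V00 j : 0 <= V0 j. Proof. exact: powR_ge0. Qed.
Let V10 j : 0 <= V1 j. Proof. exact: powR_ge0. Qed.
Let U0 j : 0 <= U j. Proof. exact: addr_ge0. Qed.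
Lemma bsum_V0 : bsum (fun j => V0 j `^ p1 * w j) 1.
Proof. by apply: bsumS vS => j; rewrite /V0 -powRrM divfK// gt_eqF. Qed.

Lemma bsum_V1 : bsum (fun j => V1 j `^ p2 * w j) 1.
Proof. by apply: bsumS vS => j; rewrite /V1 -powRrM divfK// gt_eqF. Qed.

(** Since p / p2 < p / p1, V1 <= V0 where |v| >= 1 and V0 <= V1 elsewhere. Cutting there splits a
    vector dominated by U into an l^p1 and an l^p2 part. *)
Let big j := 1 <= n j.
Let part0 (g : J -> R[i]) j := if big j then g j else 0.
Let part1 (g : J -> R[i]) j := if big j then 0 else g j.

Lemma part0_le g M : 0 <= M -> (forall j, normc (g j) <= M * U j) ->
  forall j, normc (part0 g j) <= 2 * M * V0 j.
Proof.
move=> M0 gM j; rewrite /part0; case: ifP => [bj|_]; last by rewrite normc0E !mulr_ge0.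
apply: le_trans (gM j) _; rewrite [2 * M]mulrC -mulrA ler_wpM2l// mulr2n mulrDl mul1r lerD2l.
by apply: ler_powR => //; rewrite ler_wpM2l ?(ltW p0)// lef_pV2 ?posrE// ltW// (lt_trans p1p).
Qed.

Lemma part1_le g M : 0 <= M -> (forall j, normc (g j) <= M * U j) ->
  forall j, normc (part1 g j) <= 2 * M * V1 j.
Proof.
move=> M0 gM j; rewrite /part1; case: ifP => [_|/negbT bj]; first by rewrite normc0E !mulr_ge0.
apply: le_trans (gM j) _; rewrite [2 * M]mulrC -mulrA ler_wpM2l// mulr2n mulrDl mul1r lerD2r.
rewrite /V0 /V1; have [->|nj] := eqVneq (n j) 0.
  by rewrite !powR0// mulf_neq0 ?invr_neq0 ?gt_eqF.
apply: ger_powR; first by rewrite lt_neqAle eq_sym nj normc_ge0 ltW// ltNge.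
by rewrite ler_wpM2l ?(ltW p0)// lef_pV2 ?posrE// ltW// (lt_trans p1p).
Qed.

Lemma sum_norm_parts g : (sum_norm (N p1) (N p2) (Tu g) <= N p1 (Tu (part0 g)) + N p2 (Tu (part1 g)))%E.
Proof.
apply: ge_ereal_inf; exists (N p1 (Tu (part0 g)) + N p2 (Tu g - Tu (part0 g))%R)%E.
  by exists (Tu (part0 g)).
rewrite -TuB (_ : (fun j => _) = part1 g)//; apply/funext => j.
by rewrite /part0 /part1; case: ifP; rewrite ?subrr ?subr0.
Qed.

Lemma sum_norm_dominated g M : 0 <= M -> (forall j, normc (g j) <= M * U j) ->
  (sum_norm (N p1) (N p2) (Tu g) <= (8 * (1 + K) * M)%:E)%E.
Proof.
move=> M0 gM; apply: le_trans (sum_norm_parts g) _.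
have M2 : 0 <= 2 * M by rewrite mulr_ge0.
have H0 := en_dominated G (ltW p1_gt0) M2 V00 bsum_V0 (part0_le M0 gM).
have H1 := en_dominated G (ltW p2_gt0) M2 V10 bsum_V1 (part1_le M0 gM).
have Q0 := Wm1norm_Tu G gK p1_gt1 dense1 M2 H0.
have Q1 := Wm1norm_Tu G gK p2_gt1 dense2 M2 H1.
apply: le_trans (leeD Q0 Q1) _.
by rewrite -EFinD lee_fin le_eqVlt; apply/orP; left; apply/eqP; ring.
Qed.

Lemma sum_norm_small M e : 0 <= M -> 0 < e -> exists t : seq J, exists2 eta : R, 0 < eta &
  forall g, (forall j, normc (g j) <= M * U j) -> (forall j, j \in t -> normc (g j) <= eta) ->
  (sum_norm (N p1) (N p2) (Tu g) < e%:E)%E.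
Proof.
move=> M0 e0; pose e' := e / (5 * (1 + K)); have e'0 : 0 < e' by rewrite divr_gt0// mulr_gt0.
have M2 : 0 <= 2 * M by rewrite mulr_ge0.
have [t0 [eta0 eta00 H0]] := en_small G p1_gt1 M2 V00 bsum_V0 e'0.
have [t1 [eta1 eta10 H1]] := en_small G p2_gt1 M2 V10 bsum_V1 e'0.
exists (t0 ++ t1), (Num.min eta0 eta1); first by rewrite lt_min eta00.
move=> g gM gt; apply: le_lt_trans (sum_norm_parts g) _.
have {}H0 : en w p1 (part0 g) (e' `^ p1).
  apply: H0 => [|j jt]; first exact: part0_le.
  rewrite /part0; case: ifP => _; last by rewrite normc0E ltW.
  by have := gt j; rewrite mem_cat jt le_min => /(_ isT)/andP[].
have {}H1 : en w p2 (part1 g) (e' `^ p2).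
  apply: H1 => [|j jt]; first exact: part1_le.
  rewrite /part1; case: ifP => _; first by rewrite normc0E ltW.
  by have := gt j; rewrite mem_cat jt orbT le_min => /(_ isT)/andP[].
have Q0 := Wm1norm_Tu G gK p1_gt1 dense1 (ltW e'0) H0.
have Q1 := Wm1norm_Tu G gK p2_gt1 dense2 (ltW e'0) H1.
apply: le_lt_trans (leeD Q0 Q1) _.
rewrite -EFinD lte_fin -mulrDr /e'.
rewrite (_ : _ * _ = 4 / 5 * e); last by field; rewrite gt_eqF.
by move: e0; lra.
Qed.

Variable A : R.
Hypothesis A0 : 0 <= A.

(** With these exponents |e_ z j| = |v j|^(p/p1 - b Re z): the power is p/p1 on the left line, p/p2
    on the right line and 1 at alpha. *)
Let a := p / p1 - 1.
Let b := p / p1 - p / p2.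
Definition alpha := (p1^-1 - p^-1) / (p1^-1 - p2^-1).

Let b0 : 0 < b.
Proof. by rewrite subr_gt0 ltr_pM2l// ltf_pV2 ?posrE// (lt_trans p1p). Qed.

Lemma alpha_b : b * alpha = a.
Proof.
rewrite /b /a /alpha; field; rewrite !gt_eqF//=.
by have := lt_trans p1p pp2; lra.
Qed.

Lemma alpha01 : 0 < alpha < 1.
Proof.
have H : 0 < p1^-1 - p2^-1 by rewrite subr_gt0 ltf_pV2 ?posrE// (lt_trans p1p).
rewrite /alpha divr_gt0//=; last by rewrite subr_gt0 ltf_pV2 ?posrE.
by rewrite ltr_pdivrMr// mul1r ltrD2l ltrN2 ltf_pV2 ?posrE.
Qed.

(** The factor 1/(1 + z) in [kap] gives the decay required by [bc_lim]; this numerator restores the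
    value A at alpha. *)
Let B := A * (1 + alpha).

Let B0 : 0 <= B. Proof. by rewrite mulr_ge0// addr_ge0// ltW//; case/andP: alpha01. Qed.
Let BA : B <= 2 * A.
Proof. by rewrite /B mulrC ler_wpM2r// mulr2n lerD2l ltW//; case/andP: alpha01. Qed.
Let kap (z : R[i]) : R[i] := B%:C * (1 + z)^-1.
Let kj j := - (b * ln (n j)).
Let e_ z j : R[i] := if v j == 0 then 0 else v j * (n j `^ a)%:C * cexp (kj j) z.
Let E z j := kap z * e_ z j.
Definition afam (z : R[i]) : FV := Tu (E z).

Lemma normc_e z j : v j != 0 -> normc (e_ z j) = n j `^ (p / p1 - b * complex.Re z).
Proof.
move=> vj; have nj : 0 < n j by rewrite normc_gt0.
rewrite /e_ (negbTE vj) 2!normcME normcR ger0_norm ?powR_ge0// normc_cexp /kj.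
rewrite -{1}(powRr1 (ltW nj)) -powRD ?(gt_eqF nj) ?implybT//.
rewrite (_ : 1 + a = p / p1); last by rewrite /a; ring.
rewrite /powR (gt_eqF nj) -expRD; congr expR; ring.
Qed.

Lemma powR_le_U j x : v j != 0 -> 0 <= x <= 1 -> n j `^ (p / p1 - b * x) <= U j.
Proof.
move=> vj /andP[x0 x1]; have nj : 0 < n j by rewrite normc_gt0.
have bx : 0 <= b * x by rewrite mulr_ge0// ltW.
have bx1 : b * x <= b by rewrite ler_piMr// ltW.
have [n1|n1] := leP 1 (n j).
  apply: le_trans (_ : V0 j <= _); last by rewrite lerDl.
  by apply: ler_powR => //; rewrite gerBl.
apply: le_trans (_ : V1 j <= _); last by rewrite lerDr.
apply: ger_powR; first by rewrite nj ltW.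
by move: bx1; rewrite /b; lra.
Qed.

Lemma e_le_U z j : strip z -> normc (e_ z j) <= U j.
Proof.
move=> zs; have [vj|vj] := eqVneq (v j) 0; first by rewrite /e_ vj eqxx normc0E.
by rewrite normc_e//; exact: powR_le_U.
Qed.

Lemma normc_1D_ge1 (z : R[i]) : 0 <= complex.Re z -> 1 <= normc (1 + z).
Proof.
move=> z0; apply: le_trans (normc_ge_absRe _); rewrite ReD /= ler_normr.
by rewrite lerDl z0.
Qed.

Lemma normc_kap z : 0 <= complex.Re z -> normc (kap z) <= B.
Proof.
move=> /normc_1D_ge1 H; rewrite normcME normcR ger0_norm// normcVE ler_piMr//.
by rewrite invf_le1// (lt_le_trans ltr01).
Qed.

Lemma E_le_U z j : strip z -> normc (E z j) <= B * U j.
Proof.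
move=> zs; rewrite normcME; apply: ler_pM; rewrite ?normc_ge0 ?e_le_U//.
by apply: normc_kap; case/andP: zs.
Qed.

Lemma cxdiff_e z j : cxdiff (e_ ^~ j) z.
Proof.
rewrite /e_; case: eqP => _; first exact: cxdiff_cst.
by apply: cxdiffM; [exact: cxdiff_cst|eexists; exact: cxderiv_cexp].
Qed.

Lemma cxcont_E z j : strip z -> cxcont (E ^~ j) z.
Proof.
move=> /andP[z0 _]; apply: cxdiff_cont; apply: cxdiffM; last exact: cxdiff_e.
apply: cxdiffM; first exact: cxdiff_cst.
apply: (@cxdiffV _ (fun z => 1 + z)); last by apply: cxdiffD; [exact: cxdiff_cst|exact: cxdiff_id].
by rewrite -normc_gt0 (lt_le_trans ltr01)// normc_1D_ge1.
Qed.

Lemma finite_cont (t : seq J) z eta : strip z -> 0 < eta -> exists2 d, 0 < d &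
  forall y, normc (y - z) < d -> forall j, j \in t -> normc (E y j - E z j) <= eta.
Proof.
move=> zs eta0; elim: t => [|i t [d d0 IH]]; first by exists 1.
have [d' d'0 H] := cxcont_E i zs eta0.
exists (Num.min d d') => [|y]; first by rewrite lt_min d0.
rewrite lt_min => /andP[/IH yd /H yd'] j; rewrite inE => /orP[/eqP ->|/yd//].
exact: ltW.
Qed.

Lemma afamB y z : afam y - afam z = Tu (fun j => E y j - E z j).
Proof. by rewrite TuB. Qed.

Lemma afam_bounded z : strip z -> (sum_norm (N p1) (N p2) (afam z) <= (8 * (1 + K) * B)%:E)%E.
Proof. by move=> zs; apply: sum_norm_dominated => // j; exact: E_le_U. Qed.

Lemma E_diff_le y z j : strip y -> strip z -> normc (E y j - E z j) <= 2 * B * U j.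
Proof.
move=> ys zs; apply: le_trans (ler_normcB _ _) _; rewrite -mulrA mulr2n mulrDl mul1r.
by apply: lerD; exact: E_le_U.
Qed.

Lemma afam_cont z : strip z -> forall e : R, 0 < e ->
    exists2 d : R, 0 < d & forall y, strip y -> normc (y - z) < d ->
      (sum_norm (N p1) (N p2) (afam y - afam z)%R < e%:E)%E.
Proof.
move=> zs e e0; have B2 : 0 <= 2 * B by rewrite mulr_ge0.
have [t [eta eta0 H]] := sum_norm_small B2 e0.
have [d d0 Hd] := finite_cont t zs eta0; exists d => // y ys yd.
by rewrite afamB; apply: H => [j|j]; [exact: E_diff_le|exact: Hd].
Qed.

Lemma boundary_afam (q x : R) (V : J -> R) : 1 < q -> finsupp_dense h mu (conj_exp q) ->
  (forall j, 0 <= V j) -> bsum (fun j => V j `^ q * w j) 1 -> 0 <= x <= 1 ->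
  (forall t j, normc (e_ (x +i* t) j) <= V j) ->
  boundary_cond (N q) (fun t => afam (x +i* t)) /\
  forall t, (N q (afam (x +i* t)) <= ((1 + K) * (2 * B))%:E)%E.
Proof.
move=> q1 dn VP VS x01 eV; have q0 : 0 < q by exact: lt_trans q1.
have ks t : strip (x +i* t) by [].
have EV t c j : normc (kap (x +i* t)) <= c -> normc (E (x +i* t) j) <= c * V j.
  by move=> kc; rewrite normcME ler_pM ?normc_ge0.
have kB t : normc (kap (x +i* t)) <= B by apply: normc_kap; case/andP: x01.
have bd t c : normc (kap (x +i* t)) <= c -> (N q (afam (x +i* t)) <= ((1 + K) * (2 * c))%:E)%E.
  move=> kc; have c0 : 0 <= c by apply: le_trans kc; exact: normc_ge0.
  apply: Wm1norm_Tu => //; apply: (en_dominated G (ltW q0) c0 VP VS) => j; exact: EV.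
split; last by move=> t; exact: bd.
split.
- by move=> t; apply: le_lt_trans (bd t _ (kB t)) _; rewrite ltry.
- move=> t e e0; have B2 : 0 <= 2 * B by rewrite mulr_ge0.
  pose e' := e / (3 * (1 + K)); have e'0 : 0 < e' by rewrite divr_gt0// mulr_gt0.
  have [s [eta eta0 H]] := en_small G q1 B2 VP VS e'0.
  have [d d0 Hd] := finite_cont s (ks t) eta0; exists d => // t' td.
  rewrite afamB; apply: le_lt_trans (Wm1norm_Tu G gK q1 dn (ltW e'0) _) _.
    apply: H => [j|j js].
      apply: le_trans (ler_normcB _ _) _; rewrite -mulrA mulr2n mulrDl mul1r.
      by apply: lerD; exact: EV.
    by apply: Hd => //; rewrite normc_vseg.
  rewrite lte_fin /e' (_ : _ * _ = 2 / 3 * e); last by field; rewrite gt_eqF.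
  by move: e0; lra.
- move=> e e0; exists (1 + 2 * (1 + K) * B / e) => t tM.
  have q0' : 0 <= 2 * (1 + K) * B / e 
    by apply: (divr_ge0 _ (ltW e0)); apply: (mulr_ge0 _ B0); apply: (mulr_ge0 _ (ltW K1)); exact: ler0n.
  have t0 : 0 < `|t| by apply: lt_le_trans tM; rewrite ltr_wpDr.
  have kt : normc (kap (x +i* t)) <= B / `|t|.
    rewrite normcME normcR ger0_norm// normcVE ler_wpM2l//.
    have H : `|t| <= normc (1 + x +i* t).
      by apply: le_trans (normc_ge_absIm _); rewrite ImD /= add0r.
    by rewrite lef_pV2 ?posrE// (lt_le_trans t0).
  apply: le_lt_trans (bd t _ kt) _; rewrite lte_fin.
  have -> : (1 + K) * (2 * (B / `|t|)) = 2 * (1 + K) * B / `|t| by ring.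
  have : 2 * (1 + K) * B / e < `|t| by apply: lt_le_trans tM; rewrite ltrDr.
  by rewrite ltr_pdivrMr// => H; rewrite ltr_pdivrMr// [e * _]mulrC.
Qed.

(** Shifting Re z by 2 delta, to the left if |v j| >= 1 and to the right otherwise, produces the
    exponential factor and stays under U. This room pays for the powers of ln |v j| that
    differentiation in z creates. *)
Lemma normc_e_exp z j delta : 0 <= complex.Re z - 2 * delta -> complex.Re z + 2 * delta <= 1 ->
  0 <= delta -> v j != 0 ->
  normc (e_ z j) * expR (2 * (b * delta * `|ln (n j)|)) <= U j.
Proof.
move=> zd1 zd2 d0 vj; have nj : 0 < n j by rewrite normc_gt0.
have H x : 0 <= x <= 1 -> expR ((p / p1 - b * x) * ln (n j)) <= U j.
  by move=> x01; have := powR_le_U vj x01; rewrite /powR (gt_eqF nj).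
rewrite normc_e// /powR (gt_eqF nj) -expRD.
have [l0|l0] := leP 0 (ln (n j)).
  apply: le_trans (H (complex.Re z - 2 * delta) _).
    by rewrite (ger0_norm l0) ler_expR le_eqVlt; apply/orP; left; apply/eqP; ring.
  by rewrite zd1 /=; lra.
apply: le_trans (H (complex.Re z + 2 * delta) _).
  by rewrite (ler0_norm (ltW l0)) ler_expR le_eqVlt; apply/orP; left; apply/eqP; ring.
by rewrite zd2 andbT; lra.
Qed.

Lemma e_taylor z y j delta : 0 <= complex.Re z - 2 * delta -> complex.Re z + 2 * delta <= 1 ->
  0 < delta -> normc (y - z) <= delta ->
  normc (e_ y j - e_ z j - (kj j)%:C * e_ z j * (y - z)) <=
    normc (y - z) ^+ 2 * (16 / delta ^+ 2) * U j /\
  normc ((kj j)%:C * e_ z j) <= delta^-1 * U j.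
Proof.
move=> zd1 zd2 d0 yd.
have [vj|vj] := eqVneq (v j) 0.
  rewrite /e_ vj eqxx !mulr0 mul0r !subr0 normc0E; by split; rewrite !mulr_ge0 ?invr_ge0 ?(ltW d0) ?sqr_ge0 ?normc_ge0.
set rho := normc (y - z); have rho0 : 0 <= rho by exact: normc_ge0.
have XU := normc_e_exp zd1 zd2 (ltW d0) vj.
set X := normc (e_ z j) in XU *; have X0 : 0 <= X by exact: normc_ge0.
(* The rate |kj j| is s / delta, and s and s^2 are absorbed by exp (2 s), which [normc_e_exp]
   provides. *)
set s := b * delta * `|ln (n j)| in XU.
have s0 : 0 <= s by rewrite !mulr_ge0// ltW.
have kjs : `|kj j| = s / delta.
  by rewrite /kj normrN normrM (ger0_norm (ltW b0)) /s; field; rewrite gt_eqF.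
have e2 : expR (2 * s) = expR s * expR s by rewrite -expRD; congr expR; ring.
have es1 : 1 <= expR s by rewrite -expR0 ler_expR.
have ses : s <= expR s by apply: le_trans (expR_ge1Dx s); rewrite lerDr.
have s2 : s ^+ 2 <= 4 * expR s.
  have H := expR_ge1Dx (s / 2).
  have -> : expR s = expR (s / 2) ^+ 2 by rewrite expr2 -expRD -splitr.
  have -> : s ^+ 2 = 4 * (s / 2) ^+ 2 by field.
  rewrite ler_wpM2l// lerXn2r ?nnegrE ?expR_ge0 ?divr_ge0//.
  by apply: le_trans H; rewrite lerDr.
split; last first.
  rewrite normcME normcR kjs mulrAC mulrC ler_wpM2l ?invr_ge0 ?(ltW d0)//.
  rewrite mulrC; apply: le_trans XU; rewrite ler_wpM2l// e2; apply: le_trans ses _.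
  by rewrite ler_peMl ?expR_ge0.
have -> : e_ y j - e_ z j - (kj j)%:C * e_ z j * (y - z) = (v j * (n j `^ a)%:C) *
   (cexp (kj j) y - cexp (kj j) z - (kj j)%:C * cexp (kj j) z * (y - z)).
  rewrite /e_ (negbTE vj); move: (cexp _ _) (cexp _ _) (kj j)%:C (n j `^ a)%:C (v j).
  by clear=> c1 c2 c3 c4 c5; ring.
rewrite normcME; apply: le_trans (ler_wpM2l (normc_ge0 _) (cexp_taylor _ _ _)) _.
rewrite mulrA -normc_cexp -normcME.
have -> : v j * (n j `^ a)%:C * cexp (kj j) z = e_ z j by rewrite /e_ (negbTE vj).
rewrite -/X -/rho kjs.
have E1 : expR (s / delta * rho) <= expR s.
  by rewrite ler_expR -mulrA ler_piMr// mulrC ler_pdivrMr// mul1r.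
have H1 : 4 * (s / delta * rho) ^+ 2 * expR (s / delta * rho) <=
    rho ^+ 2 * (16 / delta ^+ 2) * expR (2 * s).
  apply: le_trans (ler_wpM2l _ E1) _; first by rewrite mulr_ge0 ?sqr_ge0.
  rewrite e2 [leRHS]mulrA ler_wpM2r ?expR_ge0//.
  have -> : 4 * (s / delta * rho) ^+ 2 = (rho ^+ 2 * (4 / delta ^+ 2)) * s ^+ 2.
    by field; rewrite gt_eqF.
  have -> : rho ^+ 2 * (16 / delta ^+ 2) * expR s = (rho ^+ 2 * (4 / delta ^+ 2)) * (4 * expR s).
    by field; rewrite gt_eqF.
  by rewrite ler_wpM2l// mulr_ge0 ?sqr_ge0// divr_ge0 ?sqr_ge0.
apply: le_trans (ler_wpM2l X0 H1) _.
rewrite mulrCA ler_wpM2l// mulr_ge0 ?sqr_ge0// divr_ge0 ?sqr_ge0//.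
Qed.

Lemma kap_taylor z y : 0 <= complex.Re z -> 0 <= complex.Re y ->
  normc (kap y - kap z) <= B * normc (y - z) /\
  normc (kap y - kap z + B%:C * ((1 + z)^-1) ^+ 2 * (y - z)) <= B * normc (y - z) ^+ 2.
Proof.
move=> z0 y0; have zn := normc_1D_ge1 z0; have yn := normc_1D_ge1 y0.
have zN : 1 + z != 0 by rewrite -normc_gt0 (lt_le_trans ltr01).
have yN : 1 + y != 0 by rewrite -normc_gt0 (lt_le_trans ltr01).
have zi : (normc (1 + z))^-1 <= 1 by rewrite invf_le1// (lt_le_trans ltr01).
have yi : (normc (1 + y))^-1 <= 1 by rewrite invf_le1// (lt_le_trans ltr01).
have zi0 : 0 <= (normc (1 + z))^-1 by rewrite invr_ge0 normc_ge0.
have yi0 : 0 <= (normc (1 + y))^-1 by rewrite invr_ge0 normc_ge0.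
have nB : normc B%:C = B by rewrite normcR ger0_norm.
rewrite /kap; move: (B%:C) nB => c nB; split.
  have -> : c * (1 + y)^-1 - c * (1 + z)^-1 = - (c * (y - z) * ((1 + y)^-1 * (1 + z)^-1)).
    by field; rewrite zN yN.
  rewrite normcN' !normcME !normcVE nB -/(normc (y - z)).
  by apply: ler_piMr; [rewrite mulr_ge0 ?normc_ge0|apply: mulr_ile1].
have -> : c * (1 + y)^-1 - c * (1 + z)^-1 + c * ((1 + z)^-1) ^+ 2 * (y - z) =
    c * (y - z) ^+ 2 * ((1 + y)^-1 * ((1 + z)^-1) ^+ 2).
  by field; rewrite zN yN.
rewrite (normcME (c * _)) (normcME c) (normcME (1 + y)^-1) !normcXE !normcVE nB.
apply: ler_piMr; first by rewrite mulr_ge0 ?sqr_ge0.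
by apply: mulr_ile1; rewrite ?exprn_ge0 ?exprn_ile1.
Qed.

Let E' z j := - (B%:C * ((1 + z)^-1) ^+ 2) * e_ z j + kap z * ((kj j)%:C * e_ z j).

Lemma E_taylor z y j delta : 0 <= complex.Re z - 2 * delta -> complex.Re z + 2 * delta <= 1 ->
  0 < delta -> normc (y - z) <= delta ->
  normc (E y j - E z j - (y - z) * E' z j) <=
    normc (y - z) ^+ 2 * (B * (16 / delta ^+ 2 + delta^-1 + 1)) * U j.
Proof.
move=> zd1 zd2 d0 yd; have [H1 H2] := e_taylor j zd1 zd2 d0 yd.
have z0 : 0 <= complex.Re z by lra.
have yz : `|complex.Re y - complex.Re z| <= delta.
  by rewrite -ReB (le_trans (normc_ge_absRe _)).
have y0 : 0 <= complex.Re y by move: yz; rewrite ler_norml; lra.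
have zs : strip z by rewrite /strip /=; lra.
have [k1 k2] := kap_taylor z0 y0.
have eU := e_le_U j zs.
set rho := normc (y - z) in H1 yd k1 k2 *; have rho0 : 0 <= rho by exact: normc_ge0.
have -> : E y j - E z j - (y - z) * E' z j =
  kap y * (e_ y j - e_ z j - (kj j)%:C * e_ z j * (y - z)) +
  (kap y - kap z) * ((kj j)%:C * e_ z j) * (y - z) +
  (kap y - kap z + B%:C * ((1 + z)^-1) ^+ 2 * (y - z)) * e_ z j.
  rewrite /E /E'; move: (kap y) (kap z) (e_ y j) (e_ z j) (kj j)%:C (B%:C * _).
  by clear=> c1 c2 c3 c4 c5 c6; ring.
apply: le_trans (ler_normcD _ _) _; apply: le_trans (lerD (ler_normcD _ _) (lexx _)) _.
rewrite (normcME (kap y)) (normcME ((kap y - kap z) * _)) (normcME (kap y - kap z)).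
rewrite (normcME (kap y - kap z + _)) -/rho.
have Q1 : normc (kap y) * normc (e_ y j - e_ z j - (kj j)%:C * e_ z j * (y - z)) <=
    B * (rho ^+ 2 * (16 / delta ^+ 2) * U j).
  by apply: ler_pM; rewrite ?normc_ge0// normc_kap.
have Q2 : normc (kap y - kap z) * normc ((kj j)%:C * e_ z j) * rho <= B * rho * (delta^-1 * U j) * rho.
  by rewrite ler_wpM2r// ler_pM ?normc_ge0.
have Q3 : normc (kap y - kap z + B%:C * ((1 + z)^-1) ^+ 2 * (y - z)) * normc (e_ z j) <=
   B * rho ^+ 2 * U j.
  by rewrite ler_pM ?normc_ge0.
apply: le_trans (lerD (lerD Q1 Q2) Q3) _.
by rewrite le_eqVlt; apply/orP; left; apply/eqP; ring.
Qed.

Lemma afam_analytic z : 0 < complex.Re z < 1 ->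
  exists2 T : FV, (sum_norm (N p1) (N p2) T < +oo)%E & forall e : R, 0 < e ->
    exists2 d : R, 0 < d & forall y, y != z -> normc (y - z) < d ->
      (sum_norm (N p1) (N p2) ((y - z)^-1 *: (afam y - afam z) - T)%R < e%:E)%E.
Proof.
(* Leaves the margin 2 delta on both sides that [e_taylor] uses. *)
move=> /andP[z0 z1]; pose delta := Num.min (complex.Re z / 2) ((1 - complex.Re z) / 2).
have d0 : 0 < delta by rewrite lt_min !divr_gt0// subr_gt0.
have : delta <= delta by [].
rewrite {2}/delta le_min => /andP[d1 d2].
have zd1 : 0 <= complex.Re z - 2 * delta by lra.
have zd2 : complex.Re z + 2 * delta <= 1 by lra.
have zs : strip z by rewrite /strip /= !ltW.
exists (Tu (E' z)).
  apply: le_lt_trans (@sum_norm_dominated _ (B + B * delta^-1) _ _) _; last by rewrite ltry.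
    by rewrite addr_ge0// mulr_ge0// invr_ge0 ltW.
  move=> j; have yd : normc (z - z) <= delta by rewrite subrr normc0E ltW.
  have [_ H2] := e_taylor j zd1 zd2 d0 yd.
  rewrite /E' mulrDl; apply: le_trans (ler_normcD _ _) _; apply: lerD.
    rewrite normcME normcN'; apply: ler_pM; rewrite ?normc_ge0//; last exact: e_le_U.
    rewrite normcME normcR ger0_norm// normcXE normcVE ler_piMr// exprn_ile1 ?invr_ge0 ?normc_ge0//.
    by rewrite invf_le1 ?normc_1D_ge1 ?(ltW z0)// (lt_le_trans ltr01)// normc_1D_ge1 ?(ltW z0).
  rewrite normcME -mulrA; apply: ler_pM; rewrite ?normc_ge0//.
  by apply: normc_kap; exact: ltW.
move=> e e0; pose C := B * (16 / delta ^+ 2 + delta^-1 + 1).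
have C0 : 0 <= C by rewrite mulr_ge0// !addr_ge0 ?divr_ge0 ?invr_ge0 ?sqr_ge0 ?(ltW d0).
have K8 : 0 < 8 * (1 + K) * C + 1 by rewrite ltr_wpDl// mulr_ge0// mulr_ge0// ltW.
exists (Num.min delta (e / (8 * (1 + K) * C + 1))); first by rewrite lt_min d0 divr_gt0.
move=> y yz; rewrite lt_min => /andP[yd ye].
have yz0 : y - z != 0 by rewrite subr_eq0.
rewrite afamB -TuZ -TuB.
have nyz : 0 < normc (y - z) by rewrite normc_gt0.
apply: le_lt_trans (@sum_norm_dominated _ (normc (y - z) * C) _ _) _.
- by rewrite mulr_ge0 ?normc_ge0.
- move=> j; rewrite (_ : _ - _ = (y - z)^-1 * (E y j - E z j - (y - z) * E' z j)); last first.
    by rewrite [RHS]mulrBr mulKf.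
  rewrite normcME normcVE ler_pdivrMl//; apply: le_trans (E_taylor j zd1 zd2 d0 (ltW yd)) _.
  by rewrite expr2 -/C !mulrA.
rewrite lte_fin; move: ye; rewrite ltr_pdivlMr// => ye; apply: le_lt_trans ye.
by rewrite mulrCA ler_wpM2l ?normc_ge0// mulrC; rewrite lerDl.
Qed.

Lemma afam_alpha : afam alpha%:C = A%:C *: Tu v.
Proof.
have [al0 _] := andP alpha01.
rewrite -TuZ; congr Tu; apply/funext => j; rewrite /E.
have -> : kap alpha%:C = A%:C.
  rewrite /kap /B -(rmorph1 (real_complex R)) -rmorphD -fmorphV -rmorphM /= mulfK//.
  by rewrite gt_eqF// ltr_wpDr// ltW.
congr (_ * _); rewrite /e_; case: eqP => [->//|/eqP vj].
have nj : 0 < n j by rewrite normc_gt0.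
rewrite cexp_real -mulrA -rmorphM /= /kj.
have -> : - (b * ln (n j)) * alpha = - (a * ln (n j)) by rewrite -alpha_b; ring.
by rewrite /powR (gt_eqF nj) -expRD subrr expR0 mulr1.
Qed.

Lemma interp_norm_Tu : (interp_norm (N p1) (N p2) alpha (A%:C *: Tu v) <= (4 * (1 + K) * A)%:E)%E.
Proof.
have e0V t j : normc (e_ (0 +i* t) j) <= V0 j.
  have [vj|vj] := eqVneq (v j) 0; first by rewrite /e_ vj eqxx normc0E.
  by rewrite normc_e//= mulr0 subr0.
have e1V t j : normc (e_ (1 +i* t) j) <= V1 j.
  have [vj|vj] := eqVneq (v j) 0; first by rewrite /e_ vj eqxx normc0E.
  by rewrite normc_e//= mulr1 /b opprB addrC subrK.
have x00 : 0 <= (0 : R) <= 1 by rewrite lexx ler01.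
have x11 : 0 <= (1 : R) <= 1 by rewrite lexx ler01.
have [l1 l2] := boundary_afam p1_gt1 dense1 V00 bsum_V0 x00 e0V.
have [r1 r2] := boundary_afam p2_gt1 dense2 V10 bsum_V1 x11 e1V.
have BB : (1 + K) * (2 * B) <= 4 * (1 + K) * A.
  rewrite mulrCA mulrA -[4](_ : 2 * 2 = _ :> R); last by ring.
  rewrite -!mulrA [2 * (_ * A)]mulrCA !ler_wpM2l ?(ltW K1)//.
apply: ge_ereal_inf; exists (calderon_norm (N p1) (N p2) afam).
  exists afam => //; split; last exact: afam_alpha.
  split => //.
  - by exists (8 * (1 + K) * B) => z; exact: afam_bounded.
  - by move=> z zs e e0; exact: afam_cont.
  - by move=> z; exact: afam_analytic.
rewrite /calderon_norm ge_max; apply/andP; split; apply: ge_ereal_sup => _ [t _ <-].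
  by apply: le_trans (l2 t) _; rewrite lee_fin.
by apply: le_trans (r2 t) _; rewrite lee_fin.
Qed.

End AnalyticFamily.

(** * Maximal functions and the Poincare inequality *)

Section DyadicSums.
Variable R : realType.

Lemma powR2N_lt1 (a : R) : 0 < a -> 2 `^ (- a) < 1 :> R.
Proof.
by move=> a0; rewrite /powR pnatr_eq0 /= expR_lt1 mulNr oppr_lt0 mulr_gt0 ?ln_gt0 ?ltr1n.
Qed.

Lemma dyadic_geometric (a d : R) n : 0 < a -> 0 < d ->
  \sum_(k < n.+1) (d * 2 ^+ k) `^ a <= (1 - 2 `^ (- a))^-1 * (d * 2 ^+ n) `^ a.
Proof.
move=> a0 d0; have q1 := powR2N_lt1 a0.
have c0 : 0 < 1 - 2 `^ (- a) :> R by rewrite subr_gt0.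
have q0 : 0 <= 2 `^ (- a) :> R by exact: powR_ge0.
elim: n => [|n IH].
  rewrite big_ord1 expr0 mulr1 ler_peMl ?powR_ge0// invf_ge1// gerBl.
rewrite big_ord_recr /=; apply: le_trans (lerD IH (lexx _)) _.
have -> : (d * 2 ^+ n) `^ a = 2 `^ (- a) * (d * 2 ^+ n.+1) `^ a.
  have dn : 0 <= d * 2 ^+ n by rewrite mulr_ge0 ?exprn_ge0 ?(ltW d0).
  rewrite (_ : d * 2 ^+ n.+1 = 2 * (d * 2 ^+ n)); last by rewrite exprS; ring.
  move: (d * 2 ^+ n) dn => y y0.
  by rewrite powRM// mulrA -powRD ?addNr ?powRr0 ?mul1r// pnatr_eq0 implybT.
rewrite mulrA -[X in _ + X]mul1r -mulrDl ler_wpM2r ?powR_ge0//.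
by rewrite le_eqVlt; apply/orP; left; apply/eqP; field; rewrite gt_eqF.
Qed.

(** A geometric sum is comparable with its largest term, here less than g^a. The constant is
    independent of d and n. *)
Lemma dyadic_sum_le (a d g : R) n : 0 < a -> 0 < d -> 0 <= g ->
  \sum_(k < n) (if d * 2 ^+ k < g then (d * 2 ^+ k) `^ a else 0) <=
    (1 - 2 `^ (- a))^-1 * g `^ a.
Proof.
move=> a0 d0 g0.
have c0 : 0 < (1 - 2 `^ (- a))^-1 :> R.
  by rewrite invr_gt0 subr_gt0 powR2N_lt1.
elim: n => [|n IH]; first by rewrite big_ord0 mulr_ge0 ?powR_ge0 ?(ltW c0).
have [H|H] := ltP (d * 2 ^+ n) g; last first.
  by rewrite big_ord_recr /= ltNge H addr0.
apply: le_trans (_ : \sum_(k < n.+1) (d * 2 ^+ k) `^ a <= _).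
  by apply: ler_sum => k _; case: ifP => // _; exact: powR_ge0.
apply: le_trans (dyadic_geometric n a0 d0) _; rewrite ler_wpM2l ?(ltW c0)//.
by rewrite ge0_ler_powR ?nnegrE ?mulr_ge0 ?exprn_ge0 ?(ltW a0) ?(ltW d0) ?(ltW H).
Qed.

(** Discrete layer cake: at the last k with 2 d 2^k < M one has M <= 4 d 2^k, so one term of the sum
    suffices. *)
Lemma dyadic_layers (s d M : R) n : 0 <= s -> 0 < d -> 0 <= M -> M <= 2 * (d * 2 ^+ n) ->
  M `^ s <= (2 * d) `^ s +
    \sum_(k < n) (if 2 * (d * 2 ^+ k) < M then (4 * (d * 2 ^+ k)) `^ s else 0).
Proof.
move=> s0 d0 M0; elim: n => [|n IH] Mn.
  rewrite big_ord0 addr0 ge0_ler_powR ?nnegrE ?mulr_ge0 ?(ltW d0)//.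
  by move: Mn; rewrite expr0 mulr1.
rewrite big_ord_recr /=; have [H|H] := ltP (2 * (d * 2 ^+ n)) M; last by rewrite addr0 IH.
rewrite addrA; apply: le_trans (_ : (4 * (d * 2 ^+ n)) `^ s <= _).
  rewrite ge0_ler_powR ?nnegrE ?mulr_ge0 ?exprn_ge0 ?(ltW d0)//.
  by apply: le_trans Mn _; rewrite exprS le_eqVlt; apply/orP; left; apply/eqP; ring.
rewrite lerDr addr_ge0 ?powR_ge0// sumr_ge0// => k _; case: ifP => // _; exact: powR_ge0.
Qed.

End DyadicSums.

(** * The Hardy-Littlewood maximal theorem under doubling *)

Section MaximalFunction.
Variables (R : realType) (Gamma : choiceType) (h mu : Gamma -> Gamma -> R).
Hypothesis G : weighted_graph h mu.
Variable K : R.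
Hypothesis gK : graph_const h mu K.
Hypothesis dbl : doubling h mu.
Implicit Types (x y z : Gamma) (r s : R).

Local Notation m := (vmass h mu).
Local Notation d := (dist h).

Let m0 x : 0 <= m x. Proof. exact/ltW/(vmass_gt0 G). Qed.

Lemma vol_small x r : 0 < r -> K * r <= hsup h x -> vol h mu x r = (m x)%:E.
Proof. by move=> r0 rh; rewrite /vol (gball_singleton G gK)// /mass esum_set1// lee_fin. Qed.

Lemma mass_mono (A B : set Gamma) : A `<=` B -> (mass h mu A <= mass h mu B)%E.
Proof.
move=> AB; rewrite /mass esum_mkcond [leRHS]esum_mkcond; apply: le_esum => x _.
case: ifP => [|_]; first by rewrite !inE => /AB Bx; rewrite mem_set.
by case: ifP => // _; rewrite lee_fin.
Qed.

(** A ball of small radius is a single vertex, and finitely many doublings reach radius r. *)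
Lemma vol_fin x r : 0 < r -> (vol h mu x r < +oo)%E.
Proof.
move=> r0; have [C HC] := dbl; have K0 := K_gt0 gK.
pose rho := hsup h x / K; have rho0 : 0 < rho by rewrite divr_gt0// (hsup_gt0 G).
have H n : (vol h mu x (rho * 2 ^+ n) < +oo)%E.
  elim: n => [|n IH]; first by rewrite expr0 mulr1 vol_small ?ltry// /rho mulrC divfK// gt_eqF.
  rewrite exprS mulrCA; have rn : 0 < rho * 2 ^+ n by rewrite mulr_gt0// exprn_gt0.
  apply: le_lt_trans (HC x _ rn) _.
  have v0 : (0 <= vol h mu x (rho * 2 ^+ n))%E by apply: esum_ge0 => y _; rewrite lee_fin.
  by case: (vol h mu x _) IH v0 => [v| |]//= _ _; rewrite -EFinM ltry.
pose n := Num.bound (r / rho).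
have rn : r <= rho * 2 ^+ n.
  have : r / rho < n%:R by rewrite archi_boundP// divr_ge0// ltW.
  rewrite ltr_pdivrMr// mulrC => /ltW/le_trans; apply; rewrite ler_pM2l//.
  by rewrite -natrX ler_nat ltnW// ltn_expl.
apply: le_lt_trans (H n); apply: mass_mono => y /=.
by rewrite /gball /= => /lt_le_trans; apply.
Qed.

Definition ballvol x r : R := fine (vol h mu x r).
Local Notation V := ballvol.

Lemma volE x r : 0 < r -> vol h mu x r = (V x r)%:E.
Proof.
move=> r0; have v0 : (0 <= vol h mu x r)%E by apply: esum_ge0 => y _; rewrite lee_fin.
by rewrite /ballvol fineK// ge0_fin_numE// vol_fin.
Qed.

Lemma V_bsum x r : 0 < r -> bsum (fun y => if d x y < r then m y else 0) (V x r).
Proof.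
move=> r0; have := volE x r0; rewrite /vol /mass => E.
have /esum_bsum : (\esum_(y in gball h x r) (m y)%:E <= (V x r)%:E)%E by rewrite E.
move=> /(_ m0); apply: bsumS => y; case: ifP => yr.
  by rewrite mem_set.
by case: ifP.
Qed.

Lemma V_gt0 x r : 0 < r -> 0 < V x r.
Proof.
move=> r0; apply: lt_le_trans (vmass_gt0 G x) _.
by have := bsum_pt x (V_bsum x r0); rewrite (distxx G) r0.
Qed.

Lemma V_mono x y r s : 0 < r -> 0 < s -> (forall z, d x z < r -> d y z < s) -> V x r <= V y s.
Proof.
move=> r0 s0 H; rewrite -lee_fin -!volE//; apply: mass_mono => z; exact: H.
Qed.

Lemma V_doubling : exists2 C : R, 1 <= C & forall x r, 0 < r -> V x (2 * r) <= C * V x r.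
Proof.
have [C HC] := dbl; exists (1 + `|C|); first by rewrite lerDl.
move=> x r r0; have := HC x r r0; rewrite !volE//; last by rewrite mulr_gt0.
rewrite -EFinM lee_fin => /le_trans; apply; rewrite ler_wpM2r ?(ltW (V_gt0 _ _))//.
by apply: le_trans (ler_norm _) _; rewrite lerDr.
Qed.

Variable CD : R.
Hypothesis CD1 : 1 <= CD.
Hypothesis CDP : forall x r, 0 < r -> V x (2 * r) <= CD * V x r.

Variables (S : seq Gamma).
Hypothesis uS : uniq S.

(** The numerator runs over the finite list S, so [maxfun] is the centred maximal function of g
    restricted to S. *)
Definition bavg (g : Gamma -> R) x r := (\sum_(y <- S | d x y < r) g y * m y) / V x r.

Definition maxfun (g : Gamma -> R) x := sup [set bavg g x r | r in [set r | 0 < r]].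

Implicit Types g : Gamma -> R.

Lemma bavg_le g b x r : 0 <= b -> 0 < r -> (forall y, g y <= b) -> bavg g x r <= b.
Proof.
move=> b0 r0 gb; rewrite ler_pdivrMr ?V_gt0//.
apply: le_trans (_ : \sum_(y <- S | d x y < r) b * m y <= _).
  by apply: ler_sum => y _; rewrite ler_wpM2r.
rewrite -mulr_sumr ler_wpM2l// big_mkcond; exact: V_bsum.
Qed.

Lemma maxfun_has_sup g b x : 0 <= b -> (forall y, g y <= b) ->
  has_sup [set bavg g x r | r in [set r | 0 < r]].
Proof.
move=> b0 gb; split; first by exists (bavg g x 1), 1 => /=.
by exists b => _ [r r0 <-]; exact: bavg_le.
Qed.

Lemma maxfun_le g b x : 0 <= b -> (forall y, g y <= b) -> maxfun g x <= b.
Proof.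
move=> b0 gb; apply: ge_sup; first exact: (maxfun_has_sup x b0 gb).1.
by move=> _ [r r0 <-]; exact: bavg_le.
Qed.

Lemma bavg_le_maxfun g b x r : 0 <= b -> (forall y, g y <= b) -> 0 < r -> bavg g x r <= maxfun g x.
Proof. by move=> b0 gb r0; apply: ub_le_sup; [exact: (maxfun_has_sup x b0 gb).2|exists r]. Qed.

Lemma maxfun_gt g b x l : 0 <= b -> (forall y, g y <= b) -> l < maxfun g x ->
  exists2 r, 0 < r & l < bavg g x r.
Proof.
move=> b0 gb lM; have e0 : 0 < maxfun g x - l by rewrite subr_gt0.
have [_ [r r0 <-] H] := sup_adherent e0 (maxfun_has_sup x b0 gb).
by exists r => //; move: H; rewrite subKr.
Qed.

Lemma maxfun_ge0 g b x : 0 <= b -> (forall y, 0 <= g y <= b) -> 0 <= maxfun g x.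
Proof.
move=> b0 gb; apply: le_trans (bavg_le_maxfun x b0 _ ltr01); last by move=> y; case/andP: (gb y).
rewrite divr_ge0 ?(ltW (V_gt0 _ _))// sumr_ge0// => y _; rewrite mulr_ge0//.
by case/andP: (gb y).
Qed.

(** The ball of radius hsup h x / K is {x}, where the average is g x. *)
Lemma le_maxfun g b x : 0 <= b -> (forall y, 0 <= g y <= b) -> x \in S -> g x <= maxfun g x.
Proof.
move=> b0 gb xS; have r0 : 0 < hsup h x / K by rewrite divr_gt0 ?(hsup_gt0 G)// (K_gt0 gK).
have gb' y : g y <= b by case/andP: (gb y).
apply: le_trans (bavg_le_maxfun x b0 gb' r0).
have Vx : V x (hsup h x / K) = m x.
  by rewrite /ballvol vol_small// mulrC divfK// gt_eqF// (K_gt0 gK).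
rewrite /bavg Vx ler_pdivlMr ?(vmass_gt0 G)// big_mkcond (big_rem x)//= (distxx G) r0 lerDl.
apply: sumr_ge0 => y _; case: ifP => // _; rewrite mulr_ge0//.
by case/andP: (gb y).
Qed.

(* Vitali covering: keep a ball of largest radius and discard the centres of
   the balls that meet it; these centres lie in its double. *)
Lemma weak_type_covering g (l : R) (rad : Gamma -> R) (s : seq Gamma) :
  (forall y, 0 <= g y) -> 0 < l -> uniq s -> (forall x, x \in s -> 0 < rad x) ->
  (forall x, x \in s -> l < bavg g x (rad x)) ->
  \sum_(x <- s) m x <= CD / l * \sum_(y <- S | has (fun x => d x y < rad x) s) g y * m y.
Proof.
move=> g0 l0; have [n] := ubnP (size s); elim: n s => // n IH s sn us rs ls.
have [->|sN] := eqVneq s [::]; first by rewrite big_nil big1 ?mulr0// => i; rewrite has_nil.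
have [x xs xmax] : exists2 x, x \in s & forall y, y \in s -> rad y <= rad x.
  elim: s sN {sn us rs ls} => // y s IHs _; have [->|s_n0] := eqVneq s [::].
    by exists y; rewrite ?mem_head// => z; rewrite mem_seq1 => /eqP ->.
  have [x xs xm] := IHs s_n0; have [xy|/ltW xy] := leP (rad x) (rad y).
    exists y; rewrite ?mem_head// => z; rewrite inE => /orP[/eqP ->//|/xm zx].
    exact: le_trans xy.
  exists x; rewrite ?inE ?xs ?orbT// => z; rewrite inE => /orP[/eqP ->//|]; exact: xm.
pose meets y := `[< exists2 z, d x z < rad x & d y z < rad y >].
have rx := rs _ xs.
have xm : meets x by apply/asboolP; exists x; rewrite (distxx G).
pose s' := [seq y <- s | ~~ meets y].
have s's : {subset s' <= s} by move=> y; rewrite mem_filter => /andP[].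
have IHs' : \sum_(y <- s') m y <= CD / l * \sum_(y <- S | has (fun x => d x y < rad x) s') g y * m y.
  apply: IH => [||y /s's|y /s's]; [|exact: filter_uniq|exact: rs|exact: ls].
  have ss : (size s' < size s)%N.
    rewrite size_filter -(count_predC meets s) -[X in (X < _)%N]add0n ltn_add2r.
    by rewrite -has_count; apply/hasP; exists x.
  by rewrite ltnS in sn; exact: leq_trans ss sn.
have near : \sum_(y <- s | meets y) m y <= CD / l * \sum_(y <- S | d x y < rad x) g y * m y.
  have H1 : \sum_(y <- s | meets y) m y <= V x (2 * rad x).
    have r2 : 0 < 2 * rad x by rewrite mulr_gt0.
    apply: le_trans (V_bsum x r2 us); rewrite big_mkcond /=.
    rewrite big_seq [leRHS]big_seq; apply: ler_sum => y ys; case: ifP => [/asboolP[z xz yz]|_].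
      rewrite ifT//; apply: le_lt_trans (dist_triangle G z _ _) _.
      by rewrite [d z y](dist_sym G); have := xmax y ys; lra.
    by case: ifP.
  apply: le_trans H1 _; apply: le_trans (CDP x rx) _; rewrite -mulrA ler_wpM2l//.
    exact: le_trans ler01 CD1.
  have := ls _ xs; rewrite /bavg ltr_pdivlMr ?V_gt0// => /ltW H.
  by rewrite mulrC ler_pdivlMr// mulrC.
rewrite (bigID meets) /= -[X in _ + X <= _]big_filter -/s'.
apply: le_trans (lerD near IHs') _; rewrite -mulrDr ler_wpM2l//.
  by rewrite divr_ge0 ?(ltW l0)// (le_trans ler01 CD1).
(* The balls kept in s' do not meet the ball of x, so each y of S is counted at most once on the
   left. *)
rewrite big_mkcond [X in _ + X]big_mkcond [leRHS]big_mkcond -big_split /=.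
apply: ler_sum => y _; have gm : 0 <= g y * m y by rewrite mulr_ge0.
have [xy|xy] := ltP (d x y) (rad x).
  have -> : has (fun x => d x y < rad x) s' = false.
    apply/negbTE/hasPn => z; rewrite mem_filter => /andP[nm _]; apply: contra nm => zy.
    by apply/asboolP; exists y.
  by rewrite addr0 ifT//; apply/hasP; exists x.
rewrite add0r; case: ifP => [/hasP[z /s's zs zy]|_]; last by case: ifP.
by rewrite ifT//; apply/hasP; exists z.
Qed.

Lemma weak_type g b l (s : seq Gamma) : 0 <= b -> (forall y, 0 <= g y <= b) -> 0 < l -> uniq s ->
  (forall x, x \in s -> l < maxfun g x) ->
  \sum_(x <- s) m x <= CD / l * \sum_(y <- S) g y * m y.
Proof.
move=> b0 gb l0 us sM.
have g0 y : 0 <= g y by case/andP: (gb y).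
have gb' y : g y <= b by case/andP: (gb y).
have ex x : exists r, x \in s -> 0 < r /\ l < bavg g x r.
  have [xs|xs] := boolP (x \in s); last by exists 0.
  by have [r r0 H] := maxfun_gt b0 gb' (sM x xs); exists r.
pose rad x := sval (cid (ex x)).
have radP x : x \in s -> 0 < rad x /\ l < bavg g x (rad x) by exact: svalP (cid (ex x)).
apply: le_trans (@weak_type_covering g l rad s g0 l0 us _ _) _.
- by move=> x /radP[].
- by move=> x /radP[].
rewrite ler_wpM2l//; first by rewrite divr_ge0 ?(ltW l0)// (le_trans ler01 CD1).
by rewrite [leLHS]big_mkcond; apply: ler_sum => y _; case: ifP => // _; rewrite mulr_ge0.
Qed.

(** Marcinkiewicz truncation: discarding the values of g up to l lowers every average by at most l,
    so a maximal function above 2 l stays above l. *)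
Lemma weak_type_truncated g b l (s : seq Gamma) : 0 <= b -> (forall y, 0 <= g y <= b) -> 0 < l -> uniq s ->
  (forall x, x \in s -> 2 * l < maxfun g x) ->
  \sum_(x <- s) m x <= CD / l * \sum_(y <- S | l < g y) g y * m y.
Proof.
move=> b0 gb l0 us sM; pose g' y := if l < g y then g y else 0.
have g'b y : 0 <= g' y <= b by rewrite /g'; case: ifP; rewrite ?lexx ?b0.
have gb' y : g y <= b by case/andP: (gb y).
rewrite (_ : \sum_(y <- S | _) _ = \sum_(y <- S) g' y * m y); last first.
  by rewrite big_mkcond; apply: eq_bigr => y _; rewrite /g'; case: ifP => //; rewrite mul0r.
apply: (weak_type b0 g'b l0 us) => x /sM lM.
have [r r0 H] := maxfun_gt b0 gb' lM.
have g'b' y : g' y <= b by case/andP: (g'b y).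
apply: lt_le_trans (bavg_le_maxfun x b0 g'b' r0).
have Vr := V_gt0 x r0.
move: H; rewrite !ltr_pdivlMr// => H.
have : \sum_(y <- S | d x y < r) g y * m y <=
    \sum_(y <- S | d x y < r) g' y * m y + l * V x r.
  apply: le_trans (_ : \sum_(y <- S | d x y < r) (g' y * m y + l * m y) <= _).
    apply: ler_sum => y _; rewrite -mulrDl ler_wpM2r// /g'; case: ifP => [_|/negbT].
      by rewrite lerDl ltW.
    by rewrite add0r -leNgt.
  rewrite big_split /= lerD2l -mulr_sumr ler_wpM2l ?(ltW l0)// big_mkcond; exact: V_bsum.
by move: H; lra.
Qed.

(** CD is the weak-type constant and 4^s comes from [dyadic_layers]. The weak type spends one power
    of the height, so the geometric series has exponent s - 1. *)
Definition strong_const (s : R) := CD * 4 `^ s / (1 - 2 `^ (- (s - 1))).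

Lemma strong_const_ge0 s : 1 < s -> 0 <= strong_const s.
Proof.
move=> s1; rewrite divr_ge0 ?mulr_ge0 ?powR_ge0 ?(le_trans ler01 CD1)//.
by rewrite subr_ge0 ltW// powR2N_lt1// subr_gt0.
Qed.

Lemma strong_type g b (s : R) : 1 < s -> 0 <= b -> (forall y, 0 <= g y <= b) ->
  bsum (fun x => maxfun g x `^ s * m x) (strong_const s * \sum_(y <- S) g y `^ s * m y).
Proof.
move=> s1 b0 gb t ut; have s0 : 0 < s by exact: lt_trans s1.
set X := strong_const s * _; pose W := \sum_(x <- t) m x.
have W0 : 0 <= W by apply: sumr_ge0.
have g0 y : 0 <= g y by case/andP: (gb y).
have gb' y : g y <= b by case/andP: (gb y).
have CD0 : 0 <= CD by exact: le_trans ler01 CD1.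
apply/ler_addgt0Pl => e e0.
(* The lowest height dl is small enough that the base term (2 dl)^s costs at most e over the finite
   list t. *)
pose q := e / (W + 1); have W1 : 0 < W + 1 by rewrite ltr_wpDl.
have q0 : 0 < q by rewrite divr_gt0.
pose dl := q `^ s^-1 / 2; have dl0 : 0 < dl by rewrite divr_gt0 ?powR_gt0.
have dlW : (2 * dl) `^ s * W <= e.
  have -> : 2 * dl = q `^ s^-1 by rewrite /dl mulrC divfK.
  rewrite -powRrM mulVf ?gt_eqF// powRr1 ?(ltW q0)//.
  by rewrite /q mulrAC ler_pdivrMr// ler_wpM2l ?(ltW e0)// lerDl.
clearbody dl.
have [n nP] : exists n, b <= 2 * (dl * 2 ^+ n).
  exists (Num.bound (b / dl)).
  have : b / dl < (Num.bound (b / dl))%:R by rewrite archi_boundP// divr_ge0// ltW.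
  move: (Num.bound _) => N; rewrite ltr_pdivrMr// => /ltW/le_trans; apply.
  have H : N%:R <= 2 ^+ N.+1 :> R.
    by rewrite -natrX ler_nat (leq_trans (ltnW (ltn_expl _ (ltnSn 1))))// leq_exp2l.
  by rewrite mulrCA -exprS mulrC; exact: ler_wpM2l (ltW dl0) _ _ H.
have layer x : maxfun g x `^ s <= (2 * dl) `^ s +
    \sum_(k < n) (if 2 * (dl * 2 ^+ k) < maxfun g x then (4 * (dl * 2 ^+ k)) `^ s else 0).
  apply: dyadic_layers => //; [exact: ltW|exact: maxfun_ge0 gb|].
  exact: le_trans (maxfun_le x b0 gb') nP.
apply: le_trans (_ : \sum_(x <- t) ((2 * dl) `^ s +
    \sum_(k < n) (if 2 * (dl * 2 ^+ k) < maxfun g x then (4 * (dl * 2 ^+ k)) `^ s else 0)) * m x <= _).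
  by apply: ler_sum => x _; rewrite ler_wpM2r.
under eq_bigr do rewrite mulrDl.
rewrite big_split /= -mulr_sumr; apply: lerD => //.
under eq_bigr do rewrite mulr_suml.
rewrite exchange_big /=.
apply: le_trans (_ : \sum_(k < n) \sum_(y <- S)
    CD * 4 `^ s * (g y * m y) * (if dl * 2 ^+ k < g y then (dl * 2 ^+ k) `^ (s - 1) else 0) <= _).
  apply: ler_sum => k _; set l := dl * 2 ^+ k.
  have l0 : 0 < l by rewrite mulr_gt0// exprn_gt0.
  rewrite (eq_bigr (fun x => if 2 * l < maxfun g x then (4 * l) `^ s * m x else 0)); last first.
    by move=> x _; case: ifP => //; rewrite mul0r.
  rewrite -big_mkcond -mulr_sumr -big_filter.
  apply: le_trans (ler_wpM2l (powR_ge0 _ _) (weak_type_truncated b0 gb l0 _ _)) _.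
  - exact: filter_uniq.
  - by move=> x; rewrite mem_filter => /andP[].
  rewrite [X in _ * (_ * X)]big_mkcond !mulr_sumr; apply: ler_sum => y _; rewrite -/l.
  case: ifP => _; last by rewrite !mulr0.
  rewrite powRM ?(ltW l0)// -(mulr_powRB1 (ltW l0) s0).
  by rewrite le_eqVlt; apply/orP; left; apply/eqP; field; rewrite gt_eqF.
rewrite exchange_big /= /X mulr_sumr; apply: ler_sum => y _.
rewrite -mulr_sumr; have gm : 0 <= g y * m y by rewrite mulr_ge0.
apply: le_trans (ler_wpM2l _ (dyadic_sum_le n _ dl0 (g0 y))) _.
- by rewrite mulr_ge0// mulr_ge0// powR_ge0.
- by rewrite subr_gt0.
rewrite -(mulr_powRB1 (g0 y) s0) /strong_const.
by rewrite le_eqVlt; apply/orP; left; apply/eqP; ring.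
Qed.

End MaximalFunction.

(** * Pointwise Lipschitz estimates from Poincare *)

Section PoincareLipschitz.
Variables (R : realType) (Gamma : choiceType) (h mu : Gamma -> Gamma -> R).
Hypothesis G : weighted_graph h mu.
Variable K : R.
Hypothesis gK : graph_const h mu K.
Hypothesis dbl : doubling h mu.
Implicit Types (x y z : Gamma) (r s : R).

Local Notation m := (vmass h mu).
Local Notation d := (dist h).
Local Notation V := (ballvol h mu).

Let m0 x : 0 <= m x. Proof. exact/ltW/(vmass_gt0 G). Qed.

Variable CD : R.
Hypothesis CD1 : 1 <= CD.
Hypothesis CDP : forall x r, 0 < r -> V x (2 * r) <= CD * V x r.

Let CD0 : 0 < CD. Proof. exact: lt_le_trans CD1. Qed.
Let Vg x r : 0 < r -> 0 < V x r. Proof. exact: (V_gt0 G gK dbl). Qed.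

Lemma mulr_V_le (a B : R) y s : 0 < s -> 0 <= a ->
  bsum (fun z => if d y z < s then a * m z else 0) B -> a * V y s <= B.
Proof.
move=> s0; rewrite le_eqVlt => /predU1P[<-|a0] H; first by rewrite mul0r (bsum_ge0 H).
rewrite -ler_pdivlMl// -lee_fin -(volE G gK dbl)//.
rewrite /vol /mass; apply/esum_bsum => //.
have ai : 0 <= a^-1 by rewrite invr_ge0 ltW.
apply: bsumS (bsumZ ai H) => z; case: ifP => [|_].
  by rewrite inE /gball /= => ->; rewrite mulKf// gt_eqF.
by case: ifP => _; rewrite ?mulr0// mulrA mulVf ?mul1r// gt_eqF.
Qed.

Lemma powR_le_root (a X q : R) : 0 < q -> 0 <= a -> a `^ q <= X -> a <= X `^ q^-1.
Proof.
move=> q0 a0 H; have -> : a = (a `^ q) `^ q^-1 by rewrite -powRrM mulfV ?gt_eqF// powRr1.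
by rewrite ge0_ler_powR ?nnegrE ?powR_ge0 ?invr_ge0 ?(ltW q0)// (le_trans (powR_ge0 _ _) H).
Qed.

Lemma powR_add_le (a b q : R) : 0 <= q -> 0 <= a -> 0 <= b ->
  (a + b) `^ q <= 2 `^ q * (a `^ q + b `^ q).
Proof.
move=> q0 a0 b0; wlog ab : a b a0 b0 / a <= b.
  by move=> H; have [/H|/ltW/H] := leP a b; [exact|rewrite addrC [_ + b `^ _]addrC; exact].
apply: le_trans (_ : (2 * b) `^ q <= _).
  by rewrite ge0_ler_powR ?nnegrE ?addr_ge0 ?mulr_ge0// mulr2n mulrDl mul1r lerD2r.
by rewrite powRM// ler_wpM2l ?powR_ge0// lerDr powR_ge0.
Qed.

Variables (q C : R).
Hypotheses (q1 : 1 <= q) (C0 : 0 <= C).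
Hypothesis Pq : forall (x : Gamma) (r : R) (f : Gamma -> R[i]), 0 < r ->
    let B := gball h x r in
    (\esum_(y in B) (normc (f y - avg h mu B f) `^ q * m y)%:E <=
     C%:E * (r `^ q)%:E * \esum_(y in B) (grad h f y `^ q * m y)%:E)%E.

Let q0 : 0 < q. Proof. exact: lt_le_trans q1. Qed.

Variables (f : Gamma -> R[i]) (S : seq Gamma).
Hypothesis uS : uniq S.
Hypothesis gS : forall y, y \notin S -> grad h f y = 0.

Let g y := grad h f y `^ q.
Let b := \sum_(y <- S) g y.

Lemma grad_bounded y : 0 <= g y <= b.
Proof.
rewrite powR_ge0 /=; have [yS|/gS E] := boolP (y \in S).
  by rewrite /b (big_rem y)//= lerDl sumr_ge0// => *; exact: powR_ge0.
by rewrite /g E powR0 ?gt_eqF// sumr_ge0// => *; exact: powR_ge0.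
Qed.

Let b0 : 0 <= b. Proof. by apply: sumr_ge0 => *; exact: powR_ge0. Qed.

Let M := maxfun h mu S g.

Lemma maxgrad_ge0 x : 0 <= M x.
Proof. exact: (maxfun_ge0 G gK dbl uS x b0 grad_bounded). Qed.

(** The sum of |grad f|^q over the ball is at most its volume times the maximal function at the
    centre. Only the existence of c is kept, which hides the average. *)
Lemma poincare_ball x r : 0 < r -> exists c : R[i],
  bsum (fun y => if d x y < r then normc (f y - c) `^ q * m y else 0) (C * r `^ q * (V x r * M x)).
Proof.
move=> r0; exists (avg h mu (gball h x r) f).
have := Pq x f r0; set c := avg _ _ _ _ => H.
pose A := \sum_(y <- S | d x y < r) g y * m y.
have HA : (\esum_(y in gball h x r) (grad h f y `^ q * m y)%:E <= A%:E)%E.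
  apply/esum_bsum => [y|]; first by rewrite mulr_ge0 ?powR_ge0.
  rewrite /A big_mkcond.
  have := @bsum_supp R _ (fun y => if d x y < r then g y * m y else 0) S uS _ _.
  move=> /(_ (fun y => _))/(_ (fun y => _)) HH; apply: bsumS (HH _ _).
  - move=> y; case: ifP => [|_]; first by rewrite inE /gball /= => ->.
    by case: ifP => // _; rewrite mulr_ge0 ?powR_ge0.
  - by move=> y; case: ifP => // _; rewrite mulr_ge0 ?powR_ge0.
  - by move=> y /gS E; case: ifP => // _; rewrite /g E powR0 ?gt_eqF// mul0r.
have {H} H : (\esum_(y in gball h x r) (normc (f y - c) `^ q * m y)%:E <= (C * r `^ q * A)%:E)%E.
  apply: le_trans H _; rewrite EFinM [(C * _)%:E]EFinM; apply: lee_wpmul2l HA.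
  by rewrite -EFinM lee_fin mulr_ge0// powR_ge0.
have {}H : bsum (fun y => if y \in gball h x r then normc (f y - c) `^ q * m y else 0) (C * r `^ q * A).
  by apply/esum_bsum => // y; rewrite mulr_ge0 ?powR_ge0.
apply: bsumW H => [y|].
  case: ifP => xy; first by rewrite mem_set.
  by case: ifP => // _; rewrite mulr_ge0 ?powR_ge0.
rewrite ler_wpM2l ?mulr_ge0 ?powR_ge0//.
have gb' y : g y <= b by case/andP: (grad_bounded y).
have := bavg_le_maxfun G gK dbl uS x b0 gb' r0.
by rewrite /bavg ler_pdivrMr ?Vg// mulrC.
Qed.

Definition pconst x r : R[i] := if pselect (0 < r) is left r0 then sval (cid (poincare_ball x r0)) else 0.

Lemma pconstP x r : 0 < r ->
  bsum (fun y => if d x y < r then normc (f y - pconst x r) `^ q * m y else 0) (C * r `^ q * (V x r * M x)).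
Proof. by move=> r0; rewrite /pconst; case: pselect => // r0'; exact: svalP (cid (poincare_ball x r0')). Qed.

Definition lip1 := 2 * (C * (CD ^+ 2 + 1)) `^ q^-1.

Lemma lip1_ge0 : 0 <= lip1. Proof. by rewrite mulr_ge0 ?powR_ge0. Qed.

(** On the smaller ball both constants are close to f in q-mean, and the volumes are comparable.
    Averaging the q-th power of their difference there and taking roots gives [lip1]. *)
Lemma pconst_dist x y r s (Mm : R) : 0 < s -> s <= r -> (forall z, d y z < s -> d x z < r) ->
  V x r <= CD ^+ 2 * V y s -> M x <= Mm -> M y <= Mm ->
  normc (pconst x r - pconst y s) <= lip1 * r * Mm `^ q^-1.
Proof.
move=> s0 sr sub VV Mx My; have r0 : 0 < r by exact: lt_le_trans sr.
have Mm0 : 0 <= Mm by exact: le_trans (maxgrad_ge0 x) Mx.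
set a := normc _; have a0 : 0 <= a by exact: normc_ge0.
have Vy := Vg y s0; have Vx := Vg x r0.
have rq : 0 <= r `^ q by exact: powR_ge0.
have H : a `^ q * V y s <= 2 `^ q * (C * s `^ q * (V y s * M y) + C * r `^ q * (V x r * M x)).
  apply: mulr_V_le => //; first exact: powR_ge0.
  apply: bsumS (bsumZ (powR_ge0 2 q) (bsumD (pconstP y s0) (pconstP x r0))) => z.
  case: ifP => [yz|_]; last first.
    by rewrite add0r; case: ifP => _; rewrite ?mulr0// mulr_ge0 ?mulr_ge0 ?powR_ge0.
  rewrite (sub _ yz) -mulrDl mulrA ler_wpM2r//.
  apply: le_trans (powR_add_le (ltW q0) (normc_ge0 _) (normc_ge0 _)).
  rewrite ge0_ler_powR ?nnegrE ?addr_ge0 ?normc_ge0 ?(ltW q0)//.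
  rewrite /a (_ : _ - _ = (f z - pconst y s) - (f z - pconst x r)) ?ler_normcB//; ring.
have {}H : a `^ q <= 2 `^ q * (C * (CD ^+ 2 + 1)) * r `^ q * Mm.
  rewrite -(ler_pM2r Vy); apply: le_trans H _.
  rewrite -!mulrA ler_wpM2l ?powR_ge0// -mulrDr ler_wpM2l//.
  have A1 : s `^ q * (V y s * M y) <= r `^ q * (V y s * Mm).
    apply: ler_pM; rewrite ?powR_ge0 ?mulr_ge0 ?(ltW Vy) ?maxgrad_ge0//.
      by rewrite ge0_ler_powR ?nnegrE ?(ltW q0) ?(ltW s0) ?(ltW r0).
    by rewrite ler_wpM2l ?(ltW Vy).
  have A2 : r `^ q * (V x r * M x) <= r `^ q * (CD ^+ 2 * V y s * Mm).
    by rewrite ler_wpM2l// ler_pM ?(ltW Vx) ?maxgrad_ge0.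
  by apply: le_trans (lerD A1 A2) _; rewrite le_eqVlt; apply/orP; left; apply/eqP; ring.
apply: le_trans (powR_le_root q0 a0 H) _; rewrite /lip1.
have c0 : 0 <= C * (CD ^+ 2 + 1) by rewrite mulr_ge0// addr_ge0// sqr_ge0.
move: (C * (CD ^+ 2 + 1)) c0 => c c0.
rewrite !powRM ?mulr_ge0 ?powR_ge0//.
by rewrite -!powRrM mulfV ?gt_eqF// !powRr1 ?(ltW r0).
Qed.

(** n counts the halvings that reach the ball {x}; the errors lip1 r, lip1 r/2, ... sum to at most 2
    lip1 r. *)
Lemma pconst_center n x r : 0 < r -> K * r <= hsup h x * 2 ^+ n ->
  normc (f x - pconst x r) <= 2 * lip1 * r * M x `^ q^-1.
Proof.
have M0 := maxgrad_ge0 x; have l0 := lip1_ge0.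
have Mq : 0 <= M x `^ q^-1 by exact: powR_ge0.
elim: n r => [|n IH] r r0.
  rewrite expr0 mulr1 => rh; have := bsum_pt x (pconstP x r0).
  have -> : V x r = m x by rewrite /ballvol (vol_small G gK).
  rewrite (distxx G) r0 mulrA mulrAC ler_pM2r ?(vmass_gt0 G)// => H.
  apply: le_trans (powR_le_root q0 (normc_ge0 _) H) _.
  rewrite !powRM ?mulr_ge0 ?powR_ge0// -powRrM mulfV ?gt_eqF// powRr1 ?(ltW r0)//.
  rewrite ler_wpM2r// ler_wpM2r ?(ltW r0)// /lip1 mulrA.
  apply: le_trans (_ : (C * (CD ^+ 2 + 1)) `^ q^-1 <= _).
    rewrite ge0_ler_powR ?nnegrE ?mulr_ge0 ?addr_ge0 ?sqr_ge0 ?invr_ge0 ?(ltW q0)//.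
    by rewrite ler_peMr// lerDr sqr_ge0.
  by rewrite ler_peMl ?powR_ge0// -natrM ler1n.
move=> rh; have r2 : 0 < r / 2 by rewrite divr_gt0.
have rr : r / 2 <= r by rewrite ler_pdivrMr// ler_peMr ?(ltW r0)// ler1n.
have rh2 : K * (r / 2) <= hsup h x * 2 ^+ n by rewrite mulrA ler_pdivrMr// -mulrA -exprSr.
have H1 := IH (r / 2) r2 rh2.
have VV : V x r <= CD ^+ 2 * V x (r / 2).
  have := CDP x r2; rewrite mulrC divfK ?pnatr_eq0// => /le_trans; apply.
  by rewrite ler_wpM2r ?(ltW (Vg x r2))// expr2 ler_peMr// ltW.
have H2 := @pconst_dist x x r (r / 2) (M x) r2 rr (fun z zr => lt_le_trans zr rr) VV (lexx _) (lexx _).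
rewrite (_ : f x - _ = (f x - pconst x (r / 2)) - (pconst x r - pconst x (r / 2))); last by ring.
apply: le_trans (ler_normcB _ _) _; apply: le_trans (lerD H1 H2) _.
by rewrite le_eqVlt; apply/orP; left; apply/eqP; field.
Qed.

(* Telescoping over the balls B(x, 2^-i d(x,y)), which shrink to the point x. *)
Lemma pointwise_lipschitz x y (Mm : R) : M x <= Mm -> M y <= Mm ->
  normc (f x - f y) <= 8 * lip1 * d x y * Mm `^ q^-1.
Proof.
move=> Mx My; have Mm0 : 0 <= Mm by exact: le_trans (maxgrad_ge0 x) Mx.
have l0 := lip1_ge0; have Mq : 0 <= Mm `^ q^-1 by exact: powR_ge0.
have [->|yx] := eqVneq y x; first by rewrite subrr normc0E (distxx G) mulr0 mul0r.
set D := d x y; have D0 : 0 < D.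
  have := hsup_le_dist G gK yx; have := hsup_gt0 G x; rewrite -/D => h0 hD.
  by rewrite -(pmulr_rgt0 _ (K_gt0 gK)) (lt_le_trans h0).
have D2 : 0 < 2 * D by rewrite mulr_gt0.
have cen z r : 0 < r -> M z <= Mm -> normc (f z - pconst z r) <= 2 * lip1 * r * Mm `^ q^-1.
  move=> r0 Mz; have [n nP] : exists n, K * r <= hsup h z * 2 ^+ n.
    exists (Num.bound (K * r / hsup h z)).
    have : K * r / hsup h z < (Num.bound (K * r / hsup h z))%:R.
      by rewrite archi_boundP// divr_ge0 ?mulr_ge0 ?(ltW (K_gt0 gK)) ?(ltW r0) ?(ltW (hsup_gt0 G _)).
    move: (Num.bound _) => N.
    rewrite ltr_pdivrMr ?(hsup_gt0 G)// => /ltW/le_trans; apply; rewrite [leLHS]mulrC.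
    by rewrite ler_wpM2l ?(ltW (hsup_gt0 G _))// -natrX ler_nat ltnW// ltn_expl.
  apply: le_trans (pconst_center r0 nP) _.
  have c0 : 0 <= 2 * lip1 * r by rewrite mulr_ge0 ?(ltW r0)// mulr_ge0.
  apply: ler_wpM2l => //.
  by rewrite ge0_ler_powR ?nnegrE ?maxgrad_ge0 ?invr_ge0 ?(ltW q0).
(* The ball of radius D about y lies in that of radius 2 D about x, itself inside radius 4 D about
   y. The three errors are 4, 2 and 2 times lip1 D, hence the 8. *)
have H1 := cen x (2 * D) D2 Mx; have H3 := cen y D D0 My.
have H2 : normc (pconst x (2 * D) - pconst y D) <= lip1 * (2 * D) * Mm `^ q^-1.
  apply: pconst_dist => //.
  - by rewrite ler_peMl ?(ltW D0)// ler1n.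
  - move=> z yz; apply: le_lt_trans (dist_triangle G y _ _) _.
    by rewrite mulr2n mulrDl mul1r ltrD2l.
  apply: le_trans (_ : V y (2 * (2 * D)) <= _).
    apply: (V_mono G gK dbl) => //; first by rewrite mulr_gt0.
    move=> z xz; apply: le_lt_trans (dist_triangle G x _ _) _.
    by rewrite (dist_sym G) -/D; move: xz D0; lra.
  apply: le_trans (CDP y D2) _; rewrite expr2 -mulrA ler_wpM2l ?(ltW CD0)//.
  exact: CDP.
rewrite (_ : f x - f y = (f x - pconst x (2 * D)) + (pconst x (2 * D) - pconst y D) - (f y - pconst y D)); last by ring.
apply: le_trans (ler_normcB _ _) _; apply: le_trans (lerD (ler_normcD _ _) H3) _.
apply: le_trans (lerD (lerD H1 H2) (lexx _)) _.
by rewrite le_eqVlt; apply/orP; left; apply/eqP; ring.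
Qed.

End PoincareLipschitz.

(** * Decomposition into Lipschitz layers *)

Section McShane.
Variables (R : realType) (Gamma : choiceType) (h mu : Gamma -> Gamma -> R).
Hypothesis G : weighted_graph h mu.
Variable K : R.
Hypothesis gK : graph_const h mu K.
Implicit Types (x y z : Gamma) (l : R).
Local Notation d := (dist h).
Local Notation m := (vmass h mu).

Variables (f N : Gamma -> R) (L : R).
Hypothesis L1 : 1 <= L.
Hypothesis fN : forall x, `|f x| <= N x.
Hypothesis fL : forall x y, `|f x - f y| <= L * d x y * Num.max (N x) (N y).

Let L0 : 0 <= L. Proof. exact: le_trans L1. Qed.
Let N0 x : 0 <= N x. Proof. exact: le_trans (fN x). Qed.
Let d0 x y : 0 <= d x y. Proof. exact: (dist_ge0 G). Qed.

(* McShane extension of f from {N <= l}; the value l itself makes the infimum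
   bounded by l and meaningful when {N <= l} is empty. *)
Definition mcshane_set l x :=
  [set a | a = l \/ exists2 y, N y <= l & a = f y + L * l * d x y].
Definition mcshane l x := inf (mcshane_set l x).

Lemma mcshane_set_lb l x : 0 <= l -> lbound (mcshane_set l x) (- l).
Proof.
move=> l0 a [->|[y yl ->]]; first by rewrite ge0_cp.
have := le_trans (fN y) yl; rewrite ler_norml => /andP[ly _].
by rewrite (le_trans ly)// lerDl !mulr_ge0.
Qed.

Lemma mcshane_has_inf l x : 0 <= l -> has_inf (mcshane_set l x).
Proof.
by move=> l0; split; [exists l; left|exists (- l); exact: mcshane_set_lb].
Qed.

Lemma mcshane_le l x a : 0 <= l -> mcshane_set l x a -> mcshane l x <= a.
Proof. by move=> l0 xa; apply: ge_inf => //; case: (mcshane_has_inf x l0). Qed.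

Lemma le_mcshane l x a : lbound (mcshane_set l x) a -> a <= mcshane l x.
Proof. by move=> H; apply: lb_le_inf => //; exists l; left. Qed.

Lemma mcshane_abs l x : 0 <= l -> `|mcshane l x| <= l.
Proof.
move=> l0; rewrite ler_norml (le_mcshane (mcshane_set_lb l0))/=.
by apply: mcshane_le => //; left.
Qed.

Lemma mcshane_eq l x : N x <= l -> mcshane l x = f x.
Proof.
move=> xl; have l0 : 0 <= l by exact: le_trans xl.
apply/le_anti/andP; split.
  by apply: mcshane_le => //; right; exists x => //; rewrite (distxx G) mulr0 addr0.
apply: le_mcshane => a [->|[y yl ->]].
  by rewrite (le_trans (ler_norm _))// (le_trans (fN x)).
rewrite -lerBlDl (le_trans (ler_norm _))// (le_trans (fL x y))// mulrAC.
by rewrite ler_wpM2r// ler_wpM2l// ge_max xl.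
Qed.

Lemma mcshane_lip1 l x y : 0 <= l -> mcshane l x <= mcshane l y + L * l * d x y.
Proof.
move=> l0; have c0 : 0 <= L * l * d x y by rewrite !mulr_ge0.
rewrite -lerBlDr; apply: le_mcshane => a [->|[z zl ->]]; rewrite lerBlDr.
  by apply: (@le_trans _ _ l); [apply: mcshane_le => //; left|rewrite lerDl].
apply: (@le_trans _ _ (f z + L * l * d x z)); first by apply: mcshane_le => //; right; exists z.
rewrite -addrA lerD2l -mulrDr ler_wpM2l ?mulr_ge0// addrC; exact: (dist_triangle G).
Qed.

Lemma mcshane_lip l x y : 0 <= l -> `|mcshane l x - mcshane l y| <= L * l * d x y.
Proof.
move=> l0; have H1 := mcshane_lip1 x y l0; have := mcshane_lip1 y x l0.
rewrite (dist_sym G) ler_norml lerBlDl H1 andbT -/(mcshane _ _) => H2.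
by rewrite lerBrDl lerBlDr.
Qed.

(** The majorant N transported to pairs: along an edge the difference quotient of f is at most L
    times the larger end value. *)
Definition edgemax (p : Gamma * Gamma) : R :=
  if adj h p.1 p.2 then Num.max (N p.1) (N p.2) else 0.

Lemma edgemax_ge0 p : 0 <= edgemax p.
Proof. by rewrite /edgemax; case: ifP => // _; rewrite le_max N0. Qed.

Lemma grd_lip (u : Gamma -> R) (B : R) p : 0 <= B -> (forall x, `|u x| <= B) ->
  (forall x y, `|u x - u y| <= B * d x y) -> normc (grd h (fun x => (u x)%:C) p) <= B.
Proof.
case: p => x y B0 uB uL; rewrite /grd/=; case: ifP => _; first by rewrite normcR.
case: ifP => xy; last by rewrite normc0E.
rewrite -rmorphB normcME !normcR ger0_norm ?invr_ge0 ?(ltW (hsup_gt0 G x))//.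
rewrite ler_pdivrMl ?(hsup_gt0 G)// (le_trans (uL _ _))// mulrC ler_wpM2r//.
by rewrite (dist_sym G); exact: (dist_le_hsup G).
Qed.

Lemma grd_majorant p : normc (grd h (fun x => (f x)%:C) p) <= L * edgemax p.
Proof.
case: p => x y; rewrite /grd /edgemax/=; case: ifP => [/eqP->|_].
  by rewrite adj_refl maxxx normcR (le_trans (fN x))// ler_peMl.
case: ifP => xy; last by rewrite normc0E mulr0.
rewrite -rmorphB normcME !normcR ger0_norm ?invr_ge0 ?(ltW (hsup_gt0 G x))//.
rewrite ler_pdivrMl ?(hsup_gt0 G)// distrC (le_trans (fL _ _))//.
rewrite -mulrA [leRHS]mulrCA ler_wpM2l// ler_wpM2r ?le_max ?N0//.
exact: (dist_le_hsup G).
Qed.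

Lemma grd_eq (u v : Gamma -> R[i]) p : (adj h p.1 p.2 -> u p.1 = v p.1 /\ u p.2 = v p.2) ->
  grd h u p = grd h v p.
Proof.
case: p => x y /= H; rewrite /grd/=; case: ifP => [/eqP yx|_].
  by case: H => //; rewrite yx adj_refl.
by case: ifP => // /H[-> ->].
Qed.

Lemma edgemax_adj p l : edgemax p <= l -> adj h p.1 p.2 -> N p.1 <= l /\ N p.2 <= l.
Proof. by rewrite /edgemax => + ap; rewrite ap ge_max => /andP[]. Qed.

Lemma grd_mcshane_le l p : 0 <= l ->
  normc (grd h (fun x => (mcshane l x)%:C) p) <= L * Num.min l (edgemax p).
Proof.
move=> l0; case: (leP (edgemax p) l) => pl.
  rewrite (@grd_eq _ (fun x => (f x)%:C)) ?grd_majorant// => /(edgemax_adj pl)[H1 H2].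
  by rewrite !mcshane_eq.
apply: grd_lip => [|x|x y]; first exact: mulr_ge0.
  by apply: le_trans (mcshane_abs x l0) _; rewrite ler_peMl.
exact: mcshane_lip.
Qed.

Definition layer l x := mcshane (2 * l) x - mcshane l x.

Lemma layerE l x : layer l x = mcshane (2 * l) x - mcshane l x. Proof. by []. Qed.

(** Where N <= l at both ends the two extensions equal f and the layer vanishes; elsewhere the
    slopes 2 L l and L l add up. *)
Lemma grd_layer_le l p : 0 <= l ->
  normc (grd h (fun x => (layer l x)%:C) p) <= if l < edgemax p then 3 * L * l else 0.
Proof.
move=> l0; have l2 : 0 <= 2 * l by rewrite mulr_ge0.
case: ifPn => [_|]; last first.
  rewrite -leNgt => pl; rewrite (@grd_eq _ (fun=> 0)) => [|/(edgemax_adj pl)[H1 H2]].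
    by rewrite /grd subrr mulr0 !if_same normc0E.
  have ll : l <= 2 * l by rewrite ler_peMl// ler1n.
  by rewrite /layer !mcshane_eq ?subrr// ?(le_trans H1) ?(le_trans H2).
apply: grd_lip => [|x|x y]; first by rewrite !mulr_ge0.
  apply: le_trans (ler_normB _ _) _; apply: le_trans (lerD (mcshane_abs x l2) (mcshane_abs x l0)) _.
  rewrite -[X in _ + X]mul1r -mulrDl ler_wpM2r// -[leLHS]mulr1 (_ : 2 + 1 = 3)//; last by ring.
  by rewrite ler_wpM2l.
rewrite (_ : layer l x - layer l y = mcshane (2 * l) x - mcshane (2 * l) y - (mcshane l x - mcshane l y)); last by rewrite /layer; ring.
apply: le_trans (ler_normB _ _) _; apply: le_trans (lerD (mcshane_lip x y l2) (mcshane_lip x y l0)) _.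
by rewrite le_eqVlt; apply/orP; left; apply/eqP; ring.
Qed.

(** The maximum is bounded by the sum over both ends: the degree costs K, and for the far end the
    comparison of masses costs another K. *)
Lemma bsum_edgemax s E : 0 < s -> bsum (fun x => N x `^ s * m x) E ->
  bsum (fun p => edgemax p `^ s * wt h mu p) ((1 + K) ^+ 2 * E).
Proof.
move=> s0 HE; have K0 := ltW (K_gt0 gK).
have m0 x : 0 <= m x by exact/ltW/(vmass_gt0 G).
have sz x : (size (nb h x))%:R <= K by case: gK.
have mm x y : adj h x y -> m y <= K * m x by case: gK => _ _ _; apply.
have Nm x : 0 <= N x `^ s * m x by rewrite mulr_ge0 ?powR_ge0.
pose F1 (p : Gamma * Gamma) := if adj h p.1 p.2 then N p.1 `^ s * m p.1 else 0.
have H1 : bsum F1 (K * E).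
  apply: (@bsum_pair _ _ _ _ (fun x => K * (N x `^ s * m x))); last exact: bsumZ.
    by move=> [x y]; rewrite /F1; case: ifP.
  move=> x; have := @bsum_supp R _ (fun y => F1 (x, y)) (nb h x) (nb_uniq h x).
  move=> /(_ _ _)/bsum_le; apply.
  - rewrite (eq_big_seq (fun=> N x `^ s * m x)) => [|y]; last by rewrite (mem_nb G) /F1/= => ->.
    by rewrite big_const_seq count_predT iter_addr_0 -mulr_natl ler_wpM2r.
  - by move=> y; rewrite /F1; case: ifP.
  - by move=> y; rewrite (mem_nb G) /F1/= => /negbTE->.
have H2 : bsum (fun p : Gamma * Gamma => K * F1 (p.2, p.1)) (K * (K * E)).
  by apply: bsumZ => //; apply: (@bsum_swap _ _ _ (fun x y => F1 (x, y))); apply: bsumS H1 => -[].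
have := bsumD H1 H2; apply: bsumW => [[x y]|]; last first.
  have E0 : 0 <= K * E by rewrite mulr_ge0// (bsum_ge0 HE).
  by rewrite expr2 -mulrA -subr_ge0 (_ : _ - _ = E + K * E) ?addr_ge0 ?(bsum_ge0 HE)//; ring.
rewrite /edgemax /wt /F1/= (adj_sym G y x); case: ifP => xy; last first.
  by rewrite powR0 ?gt_eqF// mul0r mulr0 addr0.
apply: le_trans (_ : N x `^ s * m x + N y `^ s * m x <= _).
  by rewrite /Order.max; case: ifP => _; rewrite ?lerDl ?lerDr mulr_ge0 ?powR_ge0.
by rewrite lerD2l mulrCA ler_wpM2l ?powR_ge0// mm// (adj_sym G).
Qed.
End McShane.

Section SobolevMajorant.
Variables (R : realType) (Gamma : choiceType) (h mu : Gamma -> Gamma -> R).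
Hypothesis G : weighted_graph h mu.
Variable K : R.
Hypothesis gK : graph_const h mu K.
Hypothesis dbl : doubling h mu.
Local Notation m := (vmass h mu).
Local Notation d := (dist h).

Lemma finsupp_grad_seq (phi : finsupp_fun R Gamma) : exists2 S : seq Gamma, uniq S &
  forall y, y \notin S -> sval phi y = 0 /\ grad h (sval phi) y = 0.
Proof.
have [s0 us0 s0P] := finsupp_seq phi.
exists (undup (s0 ++ flatten (map (nb h) s0))); first exact: undup_uniq.
move=> y; rewrite mem_undup mem_cat negb_or => /andP[ys0 /negP yS].
have fy := s0P y ys0; split=> //.
rewrite (gradE G) big_seq big1 ?sqrtr0 ?mulr0// => z; rewrite (mem_nb G) => yz.
rewrite fy subr0 s0P ?normc0E ?expr0n//; apply/negP => zs0; apply: yS.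
by apply/flattenP; exists (nb h z); [exact: map_f|rewrite (mem_nb G) (adj_sym G)].
Qed.

Lemma poincare_nonneg_const q : poincare h mu q -> exists2 C : R, 0 <= C &
  forall (x : Gamma) (r : R) (f : Gamma -> R[i]), 0 < r ->
    let B := gball h x r in
    (\esum_(y in B) (normc (f y - avg h mu B f) `^ q * m y)%:E <=
     C%:E * (r `^ q)%:E * \esum_(y in B) (grad h f y `^ q * m y)%:E)%E.
Proof.
move=> [C HC]; exists (Num.max C 0); first by rewrite le_max lexx orbT.
move=> x r f r0 /=; apply: le_trans (HC x r f r0) _; apply: lee_wpmul2r.
  by apply: esum_ge0 => y _; rewrite lee_fin mulr_ge0 ?powR_ge0// ltW// (vmass_gt0 G).
by rewrite -!EFinM lee_fin ler_wpM2r ?powR_ge0// le_max lexx.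
Qed.

Lemma weighted_sum_le (c c' A B X Y Z : R) : 0 <= c -> 0 <= c' -> A <= Z -> B <= Z -> Z = X * Y ->
  c' * (c * A + c * B) <= c' * (2 * (c * X)) * Y.
Proof.
move=> c0 c'0 AZ BZ ZE; rewrite -!mulrA; apply: ler_wpM2l => //.
rewrite -mulrDr mulrCA -ZE; apply: ler_wpM2l => //; apply: le_trans (lerD AZ BZ) _.
by rewrite mulrDl mul1r.
Qed.

(** N^q is the sum of two maximal functions: that of |f|^q gives |f| <= N, that of |grad f|^q the
    Lipschitz bound. The strong type at exponent s / q > 1 puts N in L^s. L and Cs are independent
    of phi; only the crude bound b depends on it. *)
Lemma sobolev_majorant q : 1 <= q -> poincare h mu q ->
  exists (L : R) (Cs : R -> R), [/\ 1 <= L, forall s, q < s -> 0 <= Cs s &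
  forall (phi : finsupp_fun R Gamma) (f : Gamma -> R), sval phi = (fun x => (f x)%:C) ->
    exists (N : Gamma -> R) (b : R), [/\ forall x, N x <= b, forall x, `|f x| <= N x,
      forall x y, `|f x - f y| <= L * d x y * Num.max (N x) (N y) &
      forall s k, q < s -> 0 <= k -> w1 h mu s (sval phi) k ->
        bsum (fun x => N x `^ s * m x) (Cs s * k `^ s)]].
Proof.
move=> q1 /poincare_nonneg_const[C C0 PC]; have q0 : 0 < q by exact: lt_le_trans q1.
have qi0 : 0 <= q^-1 by rewrite invr_ge0 ltW.
have [CD CD1 CDP] := V_doubling G gK dbl.
have K0 := K_gt0 gK.
have maxl (a b : R) : a <= Num.max a b by rewrite le_max lexx.
have maxr (a b : R) : b <= Num.max a b by rewrite le_max lexx orbT.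
pose SC s := strong_const CD (s / q).
have sq s : q < s -> 1 < s / q by move=> qs; rewrite ltr_pdivlMr// mul1r.
have SC0 s : q < s -> 0 <= SC s by move=> /sq qs; exact: strong_const_ge0.
exists (Num.max 1 (8 * lip1 CD q C)), (fun s => 2 `^ (s / q) * (2 * (SC s * (1 + K) `^ s))).
split=> [|s qs|phi f fE]; first by rewrite le_max lexx.
  by have := SC0 s qs; move: (SC s) => c c0; rewrite !mulr_ge0 ?powR_ge0.
have [S uS SP] := finsupp_grad_seq phi.
have gS y : y \notin S -> grad h (sval phi) y = 0 by move=> /SP[].
have f0 y : y \notin S -> normc (sval phi y) = 0 by move=> /SP[-> _]; rewrite normc0E.
pose g1 y := normc (sval phi y) `^ q; pose g2 y := grad h (sval phi) y `^ q.
have g1b y : 0 <= g1 y <= \sum_(z <- S) g1 z.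
  rewrite powR_ge0/=; have [yS|/f0 E] := boolP (y \in S).
    by rewrite (big_rem y)//= lerDl sumr_ge0// => *; exact: powR_ge0.
  by rewrite /g1 E powR0 ?gt_eqF// sumr_ge0// => *; exact: powR_ge0.
have g2b y : 0 <= g2 y <= \sum_(z <- S) g2 z by exact: grad_bounded.
have s1 : 0 <= \sum_(z <- S) g1 z by apply: sumr_ge0 => *; exact: powR_ge0.
have s2 : 0 <= \sum_(z <- S) g2 z by apply: sumr_ge0 => *; exact: powR_ge0.
move: (\sum_(z <- S) g1 z) (\sum_(z <- S) g2 z) g1b g2b s1 s2 => b1 b2 g1b g2b b10 b20.
pose M1 x := maxfun h mu S g1 x; pose M2 x := maxfun h mu S g2 x.
have M10 x : 0 <= M1 x by exact: (maxfun_ge0 G gK dbl uS x b10 g1b).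
have M20 x : 0 <= M2 x by exact: (maxfun_ge0 G gK dbl uS x b20 g2b).
pose N x := (M1 x + M2 x) `^ q^-1.
have NM x : N x `^ q = M1 x + M2 x.
  by rewrite /N -powRrM mulVf ?gt_eqF// powRr1// addr_ge0.
exists N, ((b1 + b2) `^ q^-1); split.
- move=> x; rewrite ge0_ler_powR ?nnegrE ?addr_ge0//.
  have [H1 H2] : (forall y, g1 y <= b1) /\ (forall y, g2 y <= b2).
    by split=> y; [case/andP: (g1b y)|case/andP: (g2b y)].
  by rewrite lerD ?(maxfun_le G gK dbl uS).
- move=> x; rewrite -normcR -[_%:C]/((fun x => (f x)%:C) x) -fE.
  apply: (powR_le_root q0 (normc_ge0 _)); apply: le_trans (_ : M1 x <= _); last by rewrite lerDl.
  have [xS|/f0 ->] := boolP (x \in S); last by rewrite powR0 ?gt_eqF.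
  exact: (le_maxfun G gK dbl uS b10 g1b xS).
- move=> x y; have N0 z : 0 <= N z by exact: powR_ge0.
  have Xx : N x <= Num.max (N x) (N y) by exact: maxl.
  have Xy : N y <= Num.max (N x) (N y) by exact: maxr.
  move: (Num.max (N x) (N y)) Xx Xy => X Xx Xy; have X0 := le_trans (N0 x) Xx.
  have MX z : N z <= X -> M2 z <= X `^ q.
    move=> zX; apply: le_trans (_ : N z `^ q <= _); first by rewrite NM lerDr.
    by rewrite ge0_ler_powR ?nnegrE// ltW.
  have := @pointwise_lipschitz _ _ _ _ G _ gK dbl _ CD1 CDP _ _ q1 C0 PC (sval phi) S uS gS x y (X `^ q).
  move=> /(_ (MX x Xx) (MX y Xy)).
  rewrite -powRrM mulfV ?gt_eqF// powRr1// fE -rmorphB normcR => /le_trans; apply.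
  by rewrite ler_wpM2r// ler_wpM2r ?(dist_ge0 G)// le_max lexx orbT.
move=> s k qs k0 wk; have s0 : 0 < s by exact: lt_trans q0 qs.
have s1 : 1 <= s by exact: le_trans q1 (ltW qs).
have K1 : 0 <= 1 + K by rewrite addr_ge0// ltW.
have Kk : 0 <= (1 + K) * k by rewrite mulr_ge0.
have Wk := w1_W1norm G gK s1 k0 wk.
have E1 : \sum_(y <- S) g1 y `^ (s / q) * m y <= ((1 + K) * k) `^ s.
  have : (lpnorm h mu s (sval phi) <= ((1 + K) * k)%:E)%E.
    by apply: le_trans Wk; rewrite /W1norm leeDl// lpnorm_ge0.
  move=> /(lpnormP G _ s0 Kk)/(_ S uS); apply: le_trans; apply: ler_sum => y _.
  by rewrite /g1 -powRrM mulrC mulrCA mulfV ?gt_eqF// mulr1 mulrC.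
have E2 : \sum_(y <- S) g2 y `^ (s / q) * m y <= ((1 + K) * k) `^ s.
  have : (lpnorm h mu s (fun x => (grad h (sval phi) x)%:C) <= ((1 + K) * k)%:E)%E.
    by apply: le_trans Wk; rewrite /W1norm leeDr// lpnorm_ge0.
  move=> /(lpnormP G _ s0 Kk)/(_ S uS); apply: le_trans; apply: ler_sum => y _.
  rewrite normcR ger0_norm ?(grad_ge0 G)//.
  by rewrite /g2 -powRrM mulrC mulrCA mulfV ?gt_eqF// mulr1 mulrC.
have T1 := strong_type G gK dbl CD1 CDP uS (sq s qs) b10 g1b.
have T2 := strong_type G gK dbl CD1 CDP uS (sq s qs) b20 g2b.
have := bsumZ (powR_ge0 2 (s / q)) (bsumD T1 T2); apply: bsumW => [x|].
  rewrite /N -powRrM [q^-1 * s]mulrC -mulrDl mulrA ler_wpM2r ?(ltW (vmass_gt0 G _))//.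
  by apply: powR_add_le; [exact: ltW (divr_gt0 s0 q0)|exact: M10|exact: M20].
exact: (weighted_sum_le (SC0 s qs) (powR_ge0 2 (s / q)) E1 E2 (powRM s K1 k0)).
Qed.

End SobolevMajorant.

(** * Finitely supported approximation in two Sobolev spaces at once *)

Section SimultaneousDensity.
Variables (R : realType) (Gamma : choiceType) (h mu : Gamma -> Gamma -> R).
Hypothesis G : weighted_graph h mu.
Variable K : R.
Hypothesis gK : graph_const h mu K.
Hypothesis dbl : doubling h mu.
Implicit Types (f g : Gamma -> R[i]) (r k e : R).
Local Notation m := (vmass h mu).
Local Notation d := (dist h).
Local Notation w := (wt h mu).
Local Notation W1 := (w1 h mu).

Let w0 p : 0 <= w p. Proof. exact: (wt_ge0 G). Qed.
Let K0 : 0 <= K. Proof. exact/ltW/(K_gt0 gK). Qed.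

Lemma en_le (F F' : Gamma * Gamma -> R[i]) r E : 0 <= r ->
  (forall p, normc (F p) <= normc (F' p)) -> en w r F' E -> en w r F E.
Proof.
move=> r0 FF; apply: bsumS => p; rewrite ler_wpM2r//.
by rewrite ge0_ler_powR ?nnegrE ?normc_ge0.
Qed.

Lemma en_add_le (F F1 F2 : Gamma * Gamma -> R[i]) r k l : 1 <= r -> 0 <= k -> 0 <= l ->
  (forall p, normc (F p) <= normc (F1 p) + normc (F2 p)) ->
  en w r F1 (k `^ r) -> en w r F2 (l `^ r) -> en w r F ((k + l) `^ r).
Proof.
move=> r1 k0 l0 FF H1 H2; have r0 : 0 <= r by exact: le_trans r1.
apply: (@en_le _ (fun p => (normc (F1 p))%:C + (normc (F2 p))%:C)) => // [p|].
  by rewrite -rmorphD normcR ger0_norm ?addr_ge0 ?normc_ge0.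
apply: (enD w0) => //.
  by apply: en_le H1 => // p; rewrite normcR ger0_norm ?normc_ge0.
by apply: en_le H2 => // p; rewrite normcR ger0_norm ?normc_ge0.
Qed.

Definition edge_value f (p : Gamma * Gamma) : R[i] := if adj h p.1 p.2 then f p.1 else 0.

Lemma en_edge_value r f k : 1 <= r -> 0 <= k -> W1 r f k -> en w r (edge_value f) ((K * k) `^ r).
Proof.
move=> r1 k0 wk; have r0 : 0 < r by exact: lt_le_trans r1.
have K1 : 1 <= K by case: gK.
have H : bsum (fun x => normc (f x) `^ r * m x) (k `^ r).
  apply: bsumS (bsum_inj (f := fun x : Gamma => (x, x)) _ wk) => [x|x y [//]].
  by rewrite /grd eqxx.
have Fx x : 0 <= normc (f x) `^ r * m x by rewrite mulr_ge0 ?powR_ge0// ltW// (vmass_gt0 G).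
have KK : K * k `^ r <= (K * k) `^ r.
  rewrite powRM// ler_wpM2r ?powR_ge0// -[leLHS](powRr1 K0).
  by rewrite ler_powR.
apply: (bsum_le KK).
apply: (@bsum_pair _ _ _ _ (fun x => K * (normc (f x) `^ r * m x))); last exact: bsumZ.
  by move=> p; rewrite mulr_ge0 ?powR_ge0.
move=> x; have := @bsum_supp R _ (fun y => normc (edge_value f (x, y)) `^ r * w (x, y)) (nb h x) (nb_uniq h x).
move=> /(_ _ _)/bsum_le; apply.
- rewrite (eq_big_seq (fun=> normc (f x) `^ r * m x)) => [|y]; last first.
    by rewrite (mem_nb G) /edge_value /wt/= => ->.
  rewrite big_const_seq count_predT iter_addr_0 -mulr_natl ler_wpM2r//.
  by case: gK.
- by move=> y; rewrite mulr_ge0 ?powR_ge0.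
- move=> y; rewrite (mem_nb G) /edge_value/= => /negbTE->.
  by rewrite normc0E powR0 ?gt_eqF// mul0r.
Qed.

(** Product rule along an edge, with u taken at the far end p.2; this is why [cutoff_close] measures
    distances to p.2. *)
Lemma grd_mul_le (u : Gamma -> R) (c : R) g p : 0 <= c -> (forall x y, `|u x - u y| <= c * d x y) ->
  normc (grd h (fun x => (u x)%:C * g x) p) <=
    normc ((u p.2)%:C * grd h g p) + normc (c%:C * edge_value g p).
Proof.
case: p => x y c0 uc; rewrite /grd /edge_value/=; case: ifP => [/eqP->|_].
  by rewrite lerDl normc_ge0.
case: ifP => xy; last by rewrite !mulr0 normc0E addr0.
set H := ((hsup h x)^-1)%:C.
rewrite (_ : H * _ = (u y)%:C * (H * (g y - g x)) + (H * ((u y)%:C - (u x)%:C)) * g x); last by ring.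
apply: le_trans (ler_normcD _ _) _; rewrite lerD2l normcME [leRHS]normcME ler_wpM2r ?normc_ge0//.
rewrite -rmorphB /H normcME !normcR ger0_norm ?invr_ge0 ?(ltW (hsup_gt0 G x))//.
rewrite ler_pdivrMl ?(hsup_gt0 G)// (le_trans (uc _ _))// (ger0_norm c0) mulrC ler_wpM2r//.
by rewrite (dist_sym G) (dist_le_hsup G).
Qed.

Lemma w1_mul (u : Gamma -> R) (c : R) r g k : 1 <= r -> 0 <= k -> 0 <= c -> (forall x, `|u x| <= 1) ->
  (forall x y, `|u x - u y| <= c * d x y) -> W1 r g k -> W1 r (fun x => (u x)%:C * g x) (k + c * (K * k)).
Proof.
move=> r1 k0 c0 u1 uc wk; have r0 : 0 <= r by exact: le_trans r1.
apply: en_add_le (fun p => grd_mul_le g p c0 uc) _ _ => //; rewrite ?mulr_ge0//.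
  apply: en_le wk => // p; rewrite normcME normcR -[leRHS]mul1r ler_wpM2r ?normc_ge0//.
have := @en_k _ _ w c%:C _ r (K * k); rewrite normcR (ger0_norm c0); apply; first exact: mulr_ge0.
exact: en_edge_value.
Qed.

Variable o : Gamma.

Definition cutoff (r : R) x : R := Num.min 1 (Num.max 0 (2 - d o x / r)).

Lemma cutoff_01 r x : 0 <= cutoff r x <= 1.
Proof. by rewrite /cutoff le_min ge_min lexx ler01 le_max lexx. Qed.

Lemma clip_lip (a b : R) : `|Num.min 1 (Num.max 0 a) - Num.min 1 (Num.max 0 b)| <= `|a - b|.
Proof.
wlog ab : a b / a <= b.
  by move=> H; have [/H|/ltW/H] := leP a b => //; rewrite distrC [X in _ <= X]distrC.
rewrite distrC [leRHS]distrC [leRHS]ger0_norm ?subr_ge0// ger0_norm; last first.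
  by rewrite subr_ge0 /Order.min /Order.max; do ! case: ifP; move=> *; lra.
rewrite /Order.min /Order.max; do ! case: ifP; move=> *; lra.
Qed.

Lemma cutoff_lip r x y : 0 < r -> `|cutoff r x - cutoff r y| <= r^-1 * d x y.
Proof.
move=> r0; apply: le_trans (clip_lip _ _) _.
rewrite (_ : _ - _ = r^-1 * (d o y - d o x)); last by ring.
rewrite normrM ger0_norm ?invr_ge0 ?(ltW r0)// ler_wpM2l ?invr_ge0 ?(ltW r0)//.
have H1 := dist_triangle G x o y; have H2 := dist_triangle G y o x.
rewrite (dist_sym G y x) in H2; rewrite ler_norml; apply/andP; split; lra.
Qed.

Lemma cutoff_in r x : 0 < r -> d o x <= r -> cutoff r x = 1.
Proof.
move=> r0 xr; have H : d o x / r <= 1 by rewrite ler_pdivrMr// mul1r.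
by rewrite /cutoff /Order.min /Order.max; do ! case: ifP; move=> *; lra.
Qed.

Lemma cutoff_out r x : 0 < r -> 2 * r <= d o x -> cutoff r x = 0.
Proof.
move=> r0 xr; have H : 2 <= d o x / r by rewrite ler_pdivlMr.
by rewrite /cutoff /Order.min /Order.max; do ! case: ifP; move=> *; lra.
Qed.

Lemma cutoff_close r f k e : 1 <= r -> 0 <= k -> 0 < e -> W1 r f k -> exists2 R0, 0 < R0 &
  forall s, R0 <= s -> W1 r (fun x => f x - (cutoff s x)%:C * f x) e.
Proof.
move=> r1 k0 e0 wk; have r0 : 0 <= r by exact: le_trans r1.
have e2 : 0 < e / 2 by rewrite divr_gt0.
have [p|t ut tP] := bsum_tail _ wk (powR_gt0 r e2); first by rewrite mulr_ge0 ?powR_ge0.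
have d0 x y : 0 <= d x y by exact: (dist_ge0 G).
have S0 : 0 <= \sum_(p <- t) d o p.2 by exact: sumr_ge0.
have C0 : 0 <= K * k / (e / 2) by apply: divr_ge0; [exact: mulr_ge0|exact: ltW].
(* The sum of distances is a crude maximum over t, beyond which the cutoff equals 1 on t; the second
   term makes the contribution of the slope 1/s at most e/2. *)
exists (\sum_(p <- t) d o p.2 + K * k / (e / 2) + 1); first by rewrite ltr_wpDl// addr_ge0.
move=> s sP; have s0 : 0 < s by apply: lt_le_trans sP; rewrite ltr_wpDl ?addr_ge0.
have HH x : f x - (cutoff s x)%:C * f x = (1 - cutoff s x)%:C * f x.
  by rewrite rmorphB mulrBl mul1r.
apply: (eq_w1 (f := fun x => (1 - cutoff s x)%:C * f x)) => [x|]; first by rewrite HH.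
have uc x y : `|(1 - cutoff s x) - (1 - cutoff s y)| <= s^-1 * d x y.
  by rewrite opprB addrC addrA subrK distrC cutoff_lip.
have si : 0 <= s^-1 by rewrite invr_ge0 ltW.
rewrite /w1 [e]splitr.
apply: en_add_le (fun p => grd_mul_le f p si uc) _ _ => //; rewrite ?(ltW e2)//.
  apply: bsumS tP => p; rewrite normcME normcR.
  have /andP[c0 c1] := cutoff_01 s p.2.
  case: ifPn => pt.
    rewrite cutoff_in ?subrr ?normr0 ?mul0r ?powR0 ?mul0r//; first by rewrite gt_eqF// (lt_le_trans ltr01).
    apply: le_trans sP; rewrite -addrA (big_rem p)//= -addrA lerDl !addr_ge0//.
    by apply: sumr_ge0.
  rewrite ler_wpM2r// ge0_ler_powR ?nnegrE ?normc_ge0 ?mulr_ge0 ?normc_ge0//.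
  by rewrite ger0_norm ?subr_ge0// -[leRHS]mul1r ler_wpM2r ?normc_ge0// gerBl.
have := @en_k _ _ w (s^-1)%:C _ r (K * k); rewrite normcR (ger0_norm si).
move=> /(_ _ (mulr_ge0 K0 k0) (en_edge_value r1 k0 wk)); apply: bsum_le.
rewrite ge0_ler_powR ?nnegrE ?(ltW e2) ?mulr_ge0//.
rewrite ler_pdivrMl// -ler_pdivrMr//; apply: le_trans sP.
by rewrite -addrA addrCA lerDl addr_ge0.
Qed.

(** Pointwise form of the inclusion of L^r1 in L^r2 on a set of finite measure: the measure
    multiplies t^r2, and t is free. *)
Lemma powR_interp_le (a t r1 r2 : R) : 0 <= a -> 0 < t -> 0 < r2 -> r2 <= r1 ->
  a `^ r2 <= t `^ r2 + t `^ (r2 - r1) * a `^ r1.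
Proof.
move=> a0 t0 r20 r21; have [at_|ta] := leP a t.
  apply: le_trans (_ : t `^ r2 <= _); last by rewrite lerDl mulr_ge0 ?powR_ge0.
  by rewrite ge0_ler_powR ?nnegrE ?(ltW r20) ?(ltW t0).
have a1 : 0 < a by exact: lt_trans ta.
apply: le_trans (_ : t `^ (r2 - r1) * a `^ r1 <= _); last by rewrite lerDr powR_ge0.
have -> : a `^ r2 = a `^ (r2 - r1) * a `^ r1 by rewrite -powRD ?subrK// (gt_eqF a1) implybT.
rewrite ler_wpM2r ?powR_ge0// -[r2 - r1]opprB !powRN lef_pV2 ?posrE ?powR_gt0//.
by rewrite ge0_ler_powR ?nnegrE ?subr_ge0 ?(ltW t0) ?(ltW ta).
Qed.

(* Truncated functions live on a set of finite measure, where the L^r1 norm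
   controls the L^r2 norm. *)
Lemma cutoff_small r1 r2 s e : 1 <= r2 -> r2 <= r1 -> 0 < s -> 0 < e -> exists2 k, 0 < k &
  forall g, W1 r1 g k -> W1 r1 (fun x => (cutoff s x)%:C * g x) e /\
                         W1 r2 (fun x => (cutoff s x)%:C * g x) e.
Proof.
move=> r21 r2r1 s0 e0; have r11 := le_trans r21 r2r1.
have r20 : 0 < r2 by exact: lt_le_trans r21.
have r10 : 0 < r1 by exact: lt_le_trans r11.
pose N x : R := if d o x < 2 * s then 1 else 0.
have HN : bsum (fun x => N x `^ 1 * m x) (ballvol h mu o (2 * s)).
  apply: bsumS (V_bsum G gK dbl o _) => [x|]; last by rewrite mulr_gt0.
  by rewrite /N; case: ifP; rewrite ?powR1 ?mul1r// powR0 ?oner_eq0// mul0r.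
have := bsum_edgemax G gK ltr01 HN; set B := _ * _ => HB.
have B0 : 0 <= B by exact: bsum_ge0 HB.
pose Y := e `^ r2; have Y0 : 0 < Y by exact: powR_gt0.
(* First t makes t^r2 times the measure B at most Y / 2, then l does the same for the r1-energy;
   together they give Y = e^r2. *)
pose t := (Y / (2 * (B + 1))) `^ r2^-1.
have B1 : 0 < B + 1 by rewrite ltr_wpDl.
have YB : 0 < Y / (2 * (B + 1)) by rewrite divr_gt0 ?mulr_gt0.
have t0 : 0 < t by exact: powR_gt0.
have tE : t `^ r2 * B <= Y / 2.
  rewrite /t -powRrM mulVf ?gt_eqF// powRr1 ?(ltW YB)//.
  rewrite (_ : _ * B = Y / 2 * (B / (B + 1))); last by field; rewrite gt_eqF.
  by rewrite ler_piMr ?divr_ge0 ?(ltW Y0)// ler_pdivrMr// mul1r lerDl.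
pose l := Num.min e ((Y / 2 * t `^ (r1 - r2)) `^ r1^-1).
have l0 : 0 < l by rewrite lt_min e0; apply: powR_gt0; apply: mulr_gt0; rewrite ?powR_gt0// divr_gt0.
have lE : t `^ (r2 - r1) * l `^ r1 <= Y / 2.
  apply: le_trans (_ : t `^ (r2 - r1) * (Y / 2 * t `^ (r1 - r2)) <= _).
    rewrite ler_wpM2l ?powR_ge0//.
    apply: le_trans (_ : ((Y / 2 * t `^ (r1 - r2)) `^ r1^-1) `^ r1 <= _).
      rewrite ge0_ler_powR ?nnegrE ?(ltW r10) ?(ltW l0) ?powR_ge0//.
      by rewrite ge_min lexx orbT.
    by rewrite -powRrM mulVf ?gt_eqF// powRr1// mulr_ge0 ?powR_ge0// divr_ge0 ?(ltW Y0).
  by rewrite mulrCA -[r1 - r2]opprB powRN mulfV ?mulr1// gt_eqF// powR_gt0.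
have c0 : 0 < 1 + s^-1 * K by rewrite ltr_pwDl// mulr_ge0// invr_ge0 ltW.
exists (l / (1 + s^-1 * K)) => [|g wg]; first by rewrite divr_gt0.
set k := l / _ in wg; have k0 : 0 <= k by rewrite divr_ge0 ?(ltW c0) ?(ltW l0).
have u1 x : `|cutoff s x| <= 1 by case/andP: (cutoff_01 s x) => ? ?; rewrite ger0_norm.
have si : 0 <= s^-1 by rewrite invr_ge0 ltW.
have := w1_mul r11 k0 si u1 (fun x y => cutoff_lip x y s0) wg.
have -> : k + s^-1 * (K * k) = l by rewrite /k mulrA -[X in X + _]mul1r -mulrDl mulrC divfK ?gt_eqF.
set ug := fun x => _ => wl; split.
  by apply: w1_le wl; rewrite ?(ltW r10) ?(ltW l0)// /l ge_min lexx.
have := bsumD (bsumZ (powR_ge0 t r2) HB) (bsumZ (powR_ge0 t (r2 - r1)) wl).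
apply: bsumW => [[x y]|]; last by rewrite -/Y [Y in leRHS]splitr lerD.
rewrite mulrA mulrA -mulrDl ler_wpM2r//.
have Nn z : 0 <= N z by rewrite /N; case: ifP.
rewrite powRr1; last by rewrite /edgemax; case: ifP => // _; rewrite le_max Nn.
set E := edgemax _ _ _.
(* An edge has an end in the ball of radius 2 s, or the truncated function vanishes at both ends. *)
have [E1|H] : E = 1 \/ normc (grd h ug (x, y)) = 0.
  rewrite /E /edgemax /= /N.
  have out z : 2 * s <= d o z -> ug z = 0 by move=> H; rewrite /ug cutoff_out ?mul0r.
  have [xy|xy] := boolP (adj h x y); last first.
    right; rewrite /grd/=; case: eqP => [yx|_]; last by rewrite (negbTE xy) normc0E.
    by move: xy; rewrite yx adj_refl.
  have [dx|/out ux] := ltP (d o x) (2 * s); have [dy|/out uy] := ltP (d o y) (2 * s).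
  - by left; rewrite maxxx.
  - by left; apply/max_idPl.
  - by left; apply/max_idPr.
  - by right; rewrite /grd/= ux uy subrr mulr0 !if_same normc0E.
- by rewrite E1 mulr1 powR_interp_le ?normc_ge0.
- rewrite H !powR0 ?gt_eqF// mulr0 addr0 mulr_ge0 ?powR_ge0// /E /edgemax.
  by case: ifP => // _; rewrite le_max Nn.
Qed.

(** Density for each exponent separately might give different approximants. Here one approximates in
    W^{1,r1} and cuts off; by [cutoff_small] the error is then small for the smaller exponent
    too. *)
Lemma simultaneous_density r1 r2 f k1 k2 e : 1 <= r2 -> r2 <= r1 -> finsupp_dense h mu r1 ->
  0 <= k1 -> 0 <= k2 -> W1 r1 f k1 -> W1 r2 f k2 -> 0 < e ->
  exists phi : finsupp_fun R Gamma, W1 r1 (fun x => f x - sval phi x) e /\ W1 r2 (fun x => f x - sval phi x) e.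
Proof.
move=> r21 r2r1 dense k10 k20 wk1 wk2 e0; have r11 := le_trans r21 r2r1.
have e2 : 0 < e / 2 by rewrite divr_gt0.
have [R1 R10 H1] := cutoff_close r11 k10 e2 wk1.
have [R2 R20 H2] := cutoff_close r21 k20 e2 wk2.
pose s := R1 + R2; have s0 : 0 < s by exact: addr_gt0.
have [k k0 Hk] := cutoff_small r21 r2r1 s0 e2.
have Wf : (W1norm h mu r1 f < +oo)%E by apply: le_lt_trans (w1_W1norm G gK r11 k10 wk1) _; rewrite ltry.
have [phi [_ wphi]] := near_fs_dense G gK r11 dense Wf k0.
have [S uS SP] := finsupp_seq phi.
have fs x : x \notin S -> (cutoff s x)%:C * sval phi x = 0 by move=> /SP->; rewrite mulr0.
exists (fsupp_seq fs) => /=; have [K1 K2] := Hk _ wphi.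
have E x : f x - (cutoff s x)%:C * f x + (cutoff s x)%:C * (f x - sval phi x) =
  f x - (cutoff s x)%:C * sval phi x by ring.
have close r : 1 <= r -> W1 r (fun x => f x - (cutoff s x)%:C * f x) (e / 2) ->
    W1 r (fun x => (cutoff s x)%:C * (f x - sval phi x)) (e / 2) ->
    W1 r (fun x => f x - (cutoff s x)%:C * sval phi x) e.
  move=> rr A B; apply: (eq_w1 E); rewrite [e]splitr.
  by apply: (w1D G) A B => //; exact: ltW.
split; apply: close => //; [apply: H1|apply: H2].
  by rewrite lerDl ltW.
by rewrite lerDr ltW.
Qed.

End SimultaneousDensity.

(** * Sobolev energies of the layers *)

Section LayerEnergies.
Variables (R : realType) (Gamma : choiceType) (h mu : Gamma -> Gamma -> R).
Hypothesis G : weighted_graph h mu.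
Variable K : R.
Hypothesis gK : graph_const h mu K.
Implicit Types (x y : Gamma) (r s t : R).
Local Notation m := (vmass h mu).
Local Notation W1 := (w1 h mu).

Lemma ler_normc_sum (n : nat) (a : nat -> R[i]) :
  normc (\sum_(k < n) a k) <= \sum_(k < n) normc (a k).
Proof.
elim: n => [|n IH]; first by rewrite !big_ord0 normc0E.
by rewrite !big_ord_recr/= (le_trans (ler_normcD _ _))// lerD2r.
Qed.

Lemma grd_sum (n : nat) (g : nat -> Gamma -> R[i]) p :
  grd h (fun x => \sum_(k < n) g k x) p = \sum_(k < n) grd h (g k) p.
Proof.
rewrite /grd; case: ifP => // _; case: ifP => _; last by rewrite big1.
by rewrite -sumrB mulr_sumr.
Qed.

Lemma w1_sum r (n : nat) (g : nat -> Gamma -> R[i]) (l : nat -> R) : 1 <= r ->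
  (forall k, 0 <= l k) -> (forall k, W1 r (g k) (l k)) ->
  W1 r (fun x => \sum_(k < n) g k x) (\sum_(k < n) l k).
Proof.
move=> r1 l0 gl; elim: n => [|n IH].
  apply: (eq_w1 (f := fun=> 0)) => [x|]; rewrite big_ord0//.
  by apply: w1_zero; rewrite gt_eqF// (lt_le_trans ltr01).
apply: (eq_w1 (f := fun x => \sum_(k < n) g k x + g n x)) => [x|]; rewrite big_ord_recr//=.
by apply: (w1D G) => //; exact: sumr_ge0.
Qed.

Variables (f N : Gamma -> R) (L : R).
Hypothesis L1 : 1 <= L.
Hypothesis fN : forall x, `|f x| <= N x.
Hypothesis fL : forall x y, `|f x - f y| <= L * dist h x y * Num.max (N x) (N y).

Let L0 : 0 <= L. Proof. exact: le_trans L1. Qed.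
Let W0 p : 0 <= edgemax h N p. Proof. exact: edgemax_ge0 fN p. Qed.

Lemma w1_edgemax s t (a E : R) (g : Gamma -> R[i]) : 0 <= a -> 0 < s -> 0 < t ->
  bsum (fun x => N x `^ t * m x) E ->
  (forall p, normc (grd h g p) <= a * edgemax h N p `^ (t / s)) ->
  W1 s g (a * ((1 + K) ^+ 2 * E) `^ s^-1).
Proof.
move=> a0 s0 t0 HE gW; have HW := bsum_edgemax G gK t0 HE.
have X0 := bsum_ge0 HW.
rewrite /w1 powRM ?powR_ge0// -powRrM mulVf ?gt_eqF// powRr1//.
apply: bsumS (bsumZ (powR_ge0 a s) HW) => p.
rewrite mulrA ler_wpM2r ?(wt_ge0 G)//.
have -> : a `^ s * edgemax h N p `^ t = (a * edgemax h N p `^ (t / s)) `^ s.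
  by rewrite powRM ?powR_ge0// -powRrM divfK ?gt_eqF.
by rewrite ge0_ler_powR ?nnegrE ?normc_ge0 ?(ltW s0) ?mulr_ge0 ?powR_ge0.
Qed.

Local Notation layer := (layer h f N L).
Local Notation mcshane := (mcshane h f N L).

(** min (l, W) <= l^(1 - t/s) W^(t/s): summability of N at some t < s yields a positive power of l,
    so the bottom extension tends to 0 with its height. *)
Lemma w1_mcshane s t (l E : R) : 0 <= l -> 0 < t -> t < s -> bsum (fun x => N x `^ t * m x) E ->
  W1 s (fun x => (mcshane l x)%:C) (L * l `^ (1 - t / s) * ((1 + K) ^+ 2 * E) `^ s^-1).
Proof.
move=> l0 t0 ts HE; have s0 : 0 < s by exact: lt_trans ts.
have ts0 : 0 < t / s by rewrite divr_gt0.
have ts1 : 0 < 1 - t / s by rewrite subr_gt0 ltr_pdivrMr// mul1r.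
apply: w1_edgemax HE _ => // [|p]; first by rewrite mulr_ge0 ?powR_ge0.
apply: le_trans (grd_mcshane_le G L1 fN fL p l0) _.
rewrite -mulrA ler_wpM2l//.
move: (edgemax h N p) (W0 p) => w w0.
have m0 : 0 <= Num.min l w by rewrite le_min l0.
have [ml mw] : Num.min l w <= l /\ Num.min l w <= w by rewrite !ge_min !lexx orbT.
move: (Num.min l w) m0 ml mw => z z0 zl zw.
rewrite -[z in leLHS]powRr1// -[1 in leLHS](subrK (t / s)) powRD; last first.
  by rewrite subrK oner_eq0.
by rewrite ler_pM ?powR_ge0// ge0_ler_powR ?nnegrE ?(ltW ts1) ?(ltW ts0).
Qed.

(** The coefficients turn the slope 3 L lam into 3 L lam^(r/s). Over the heights below the majorant
    W these sum to a multiple of W^(r/s), whose s-th power is W^r. *)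
Lemma w1_layers s r (delta E : R) n (c : nat -> R[i]) : 0 < s -> 0 < r -> 0 < delta ->
  bsum (fun x => N x `^ r * m x) E ->
  (forall k, normc (c k) <= (delta * 2 ^+ k) `^ (r / s - 1)) ->
  W1 s (fun x => \sum_(k < n) c k * (layer (delta * 2 ^+ k) x)%:C)
    (3 * L * (1 - 2 `^ (- (r / s)))^-1 * ((1 + K) ^+ 2 * E) `^ s^-1).
Proof.
move=> s0 r0 d0 HE Hc; have rs0 : 0 < r / s by rewrite divr_gt0.
have c0 : 0 <= (1 - 2 `^ (- (r / s)))^-1 :> R by rewrite invr_ge0 subr_ge0 ltW// powR2N_lt1.
apply: w1_edgemax HE _ => // [|p]; first by rewrite !mulr_ge0.
rewrite (grd_sum n (fun k x => c k * (layer (delta * 2 ^+ k) x)%:C)).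
apply: le_trans (ler_normc_sum _ (fun k => grd h (fun x => c k * (layer (delta * 2 ^+ k) x)%:C) p)) _.
rewrite -[leRHS]mulrA; apply: le_trans (ler_wpM2l _ (dyadic_sum_le n rs0 d0 (W0 p))); last by rewrite mulr_ge0.
rewrite mulr_sumr; apply: ler_sum => k _.
have l0 : 0 < delta * 2 ^+ k by rewrite mulr_gt0 ?exprn_gt0.
have := grd_layer_le G L1 fN fL p (ltW l0).
rewrite grdZ normcME; case: ifP => _ H; last first.
  by have /le_anti -> : normc (grd h (fun x => (layer (delta * 2 ^+ k) x)%:C) p) <= 0 <= normc (grd h (fun x => (layer (delta * 2 ^+ k) x)%:C) p); rewrite ?mulr0 ?H ?normc_ge0.
apply: le_trans (ler_pM (normc_ge0 _) (normc_ge0 _) (Hc k) H) _.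
have -> : (delta * 2 ^+ k) `^ (r / s) = (delta * 2 ^+ k) `^ (r / s - 1) * (delta * 2 ^+ k).
  rewrite -[X in _ = _ * X](powRr1 (ltW l0)) -powRD ?subrK//.
  by rewrite (gt_eqF l0) implybT.
by rewrite le_eqVlt; apply/orP; left; apply/eqP; ring.
Qed.

Lemma w1_layer s (l E : R) : 0 <= l -> 0 < s -> bsum (fun x => N x `^ s * m x) E ->
  W1 s (fun x => (layer l x)%:C) (3 * L * ((1 + K) ^+ 2 * E) `^ s^-1).
Proof.
move=> l0 s0 HE; apply: w1_edgemax HE _ => // [|p]; first by rewrite mulr_ge0.
apply: le_trans (grd_layer_le G L1 fN fL p l0) _.
rewrite mulfV ?gt_eqF// powRr1//; case: ifP => [/ltW lw|_]; last by rewrite !mulr_ge0.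
by rewrite ler_wpM2l// mulr_ge0.
Qed.

Lemma layer_sum (delta b : R) n : 0 < delta -> (forall x, N x <= b) -> b <= delta * 2 ^+ n ->
  forall x, f x = mcshane delta x + \sum_(k < n) layer (delta * 2 ^+ k) x.
Proof.
move=> d0 Nb bn x; rewrite -(mcshane_eq G L1 fN fL (le_trans (Nb x) bn)).
elim: n {bn} => [|n IH]; first by rewrite big_ord0 addr0 expr0 mulr1.
by rewrite big_ord_recr/= addrA -IH layerE exprS mulrCA addrC subrK.
Qed.

End LayerEnergies.

Section Decomposition.
Variables (R : realType) (Gamma : choiceType) (h mu : Gamma -> Gamma -> R).
Hypothesis G : weighted_graph h mu.
Hypothesis dbl : doubling h mu.
Local Notation W1 := (w1 h mu).

Lemma powR_small (a X Y : R) : 0 < a -> 0 <= X -> 0 < Y -> exists2 d0, 0 < d0 &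
  forall d, 0 <= d -> d <= d0 -> d `^ a * X <= Y.
Proof.
move=> a0 X0 Y0; have X1 : 0 < X + 1 by rewrite ltr_wpDl.
exists ((Y / (X + 1)) `^ a^-1) => [|d d0 dd]; first by rewrite powR_gt0 ?divr_gt0.
apply: le_trans (_ : Y / (X + 1) * X <= _).
  rewrite ler_wpM2r//.
  have -> : Y / (X + 1) = ((Y / (X + 1)) `^ a^-1) `^ a.
    by rewrite -powRrM mulVf ?gt_eqF// powRr1// divr_ge0// ltW.
  by rewrite ge0_ler_powR ?nnegrE ?powR_ge0// ltW.
by rewrite mulrAC ler_pdivrMr// ler_wpM2l ?lerDl// ltW.
Qed.

(* Calderon-Zygmund type decomposition at the dyadic heights of a maximal
   function: the k-th layer has size and slope at most a multiple of its height
   lam k, so that multiplying the layers by lam k `^ (r / s - 1) turns a bound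
   in W^{1,r} into a bound in W^{1,s}. *)
Lemma layer_decomposition q r2 r r1 : 1 <= q -> poincare h mu q -> q < r2 -> r2 < r -> r < r1 ->
  finsupp_dense h mu r1 -> exists2 D, 0 <= D &
  forall (phi : finsupp_fun R Gamma) (f : Gamma -> R), sval phi = (fun x => (f x)%:C) ->
    W1 r (sval phi) 1 -> forall e, 0 < e ->
  exists n (lam : nat -> R) (psi : nat -> finsupp_fun R Gamma), [/\ forall k, 0 < lam k,
    forall s, s \in [:: r1; r2] -> forall c : nat -> R[i],
      (forall k, normc (c k) <= lam k `^ (r / s - 1)) ->
      W1 s (fun x => \sum_(k < n) c k * sval (psi k) x) D &
    forall s, s \in [:: r1; r2] ->
      W1 s (fun x => sval phi x - \sum_(k < n) sval (psi k) x) e].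
Proof.
move=> q1 Pq qr2 r2r rr1 dense; have [K gK] := exists_graph_const G.
have [L [Cs [L1 Cs0 HN]]] := sobolev_majorant G gK dbl q1 Pq.
have L0 : 0 <= L by exact: le_trans L1.
have K1 : 0 <= (1 + K) ^+ 2 by exact: sqr_ge0.
have q0 : 0 < q by exact: lt_le_trans q1.
have r20 : 0 < r2 by exact: lt_trans qr2.
have r21 : 1 <= r2 by exact/ltW/(le_lt_trans q1).
have r0 : 0 < r by exact: lt_trans r2r.
have r10 : 0 < r1 by exact: lt_trans rr1.
have qr : q < r by exact: lt_trans r2r.
pose D0 s := 3 * L * (1 - 2 `^ (- (r / s)))^-1 * ((1 + K) ^+ 2 * (Cs r * 1 `^ r)) `^ s^-1.
have D00 s : 0 < s -> 0 <= D0 s.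
  move=> s0; rewrite /D0 !mulr_ge0 ?powR_ge0// invr_ge0 subr_ge0 ltW// powR2N_lt1//.
  by rewrite divr_gt0.
have in12 s : s \in [:: r1; r2] -> [/\ q < s, 1 <= s, 0 < s & (s = r1 \/ s = r2)].
  rewrite !inE => /orP[] /eqP ->; split; [|exact: le_trans r21 (ltW (lt_trans r2r rr1))|exact: r10|by left| | | |by right] => //.
  exact: lt_trans qr rr1.
(* The final 1 allows for replacing the layers by finitely supported functions. *)
exists (D0 r1 + D0 r2 + 1); first by rewrite !addr_ge0 ?D00.
move=> phi f fE wphi e e0.
have [N [b [Nb fN fL NE]]] := HN phi f fE.
have [x0 _] := infinite_setN0 (wg_infinite G).
have e2 : 0 < e / 2 by rewrite divr_gt0.
(* Above q, so that N is in L^t, and below both r1 and r2, so that the bottom extension is small in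
   both spaces. The bound depends on phi through kt, as delta may. *)
pose t := (q + r2) / 2.
have qt : q < t by rewrite /t ltr_pdivlMr// mulrDr mulr1 ltrD2l.
have tr2 : t < r2 by rewrite /t ltr_pdivrMr// mulrDr mulr1 ltrD2r.
have t0 : 0 < t by exact: lt_trans qt.
have t1 : 1 <= t by exact: le_trans (ltW qt).
have [kt kt0 wkt] := finsupp_w1 G phi t0.
have HEt := NE t kt qt kt0 wkt.
have HEr := NE r 1 qr ler01 wphi.
pose X s := L * ((1 + K) ^+ 2 * (Cs t * kt `^ t)) `^ s^-1.
have base s : s \in [:: r1; r2] -> exists2 d0, 0 < d0 & forall d, 0 <= d -> d <= d0 ->
    W1 s (fun x => (mcshane h f N L d x)%:C) (e / 2).
  move=> /in12[qs s1 s0 ss]; have ts : t < s.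
    by case: ss => ->//; exact: lt_trans tr2 (lt_trans r2r rr1).
  have ts1 : 0 < 1 - t / s by rewrite subr_gt0 ltr_pdivrMr// mul1r.
  have X0 : 0 <= X s by rewrite mulr_ge0 ?powR_ge0.
  have [d0 d00 Hd] := powR_small ts1 X0 e2; exists d0 => // d dge dle.
  have le := Hd d dge dle; apply: w1_le le _; rewrite ?(ltW s0)//.
    by rewrite mulr_ge0 ?powR_ge0.
  rewrite /X mulrCA mulrA; exact: (w1_mcshane G gK L1 fN fL dge t0 ts HEt).
have [d1 d10 B1] := base r1 (mem_head _ _).
have [d2 d20 B2] : exists2 d0, 0 < d0 & forall d, 0 <= d -> d <= d0 ->
    W1 r2 (fun x => (mcshane h f N L d x)%:C) (e / 2) by apply: base; rewrite !inE eqxx orbT.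
have [delta [del0 del1 del2]] : exists delta, [/\ 0 < delta, delta <= d1 & delta <= d2].
  exists (Num.min d1 d2); split; rewrite ?lt_min ?d10 ?ge_min ?lexx ?orbT//.
have {B1 B2 base} base s : s \in [:: r1; r2] -> W1 s (fun x => (mcshane h f N L delta x)%:C) (e / 2).
  by rewrite !inE => /orP[] /eqP->; [apply: B1|apply: B2] => //; exact: ltW.
have [n bn] : exists n, b <= delta * 2 ^+ n.
  have b0 : 0 <= b / delta by rewrite divr_ge0 ?(ltW del0)// (le_trans _ (Nb x0))// (le_trans _ (fN x0)).
  exists (Num.bound (b / delta)); have := archi_boundP b0; move: (Num.bound _) => k.
  rewrite ltr_pdivrMr// => /ltW/le_trans; apply; rewrite mulrC ler_wpM2l ?(ltW del0)//.
  by rewrite -natrX ler_nat ltnW// ltn_expl.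
pose lam k := delta * 2 ^+ k.
have lam0 k : 0 < lam k by rewrite mulr_gt0 ?exprn_gt0.
(* Dominates the total of the admissible coefficients for either exponent, and also n; so errors e'
   per layer cost at most 1 in the weighted sums and e / 2 in the plain one. *)
pose S := \sum_(k < n) (lam k `^ (r / r1 - 1) + lam k `^ (r / r2 - 1) + 1).
have S0 : 0 <= S by apply: sumr_ge0 => k _; rewrite !addr_ge0 ?powR_ge0.
have S1 : 0 < S + 1 by rewrite ltr_wpDl.
have [e' [e'0 e'1 e'e]] : exists e', [/\ 0 < e', S * e' <= 1 & S * e' <= e / 2].
  have m0 : 0 < Num.min 1 (e / 2) by rewrite lt_min ltr01.
  have [ml mr] : Num.min 1 (e / 2) <= 1 /\ Num.min 1 (e / 2) <= e / 2 by rewrite !ge_min !lexx orbT.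
  exists (Num.min 1 (e / 2) / (S + 1)); move: (Num.min _ _) m0 ml mr => z z0 z1 ze.
  have Sz : S * (z / (S + 1)) <= z.
    by rewrite mulrA ler_pdivrMr// mulrC ler_wpM2l ?(ltW z0)// lerDl.
  by split; [exact: divr_gt0|exact: le_trans z1|exact: le_trans ze].
have /choice[psi psiP] : forall k, exists psi : finsupp_fun R Gamma,
    W1 r1 (fun x => (layer h f N L (lam k) x)%:C - sval psi x) e' /\
    W1 r2 (fun x => (layer h f N L (lam k) x)%:C - sval psi x) e'.
  move=> k; have lay s : q < s -> 0 < s -> exists2 k', 0 <= k' & W1 s (fun x => (layer h f N L (lam k) x)%:C) k'.
    move=> qs s0; have [ks ks0 wks] := finsupp_w1 G phi s0.
    have HEs := NE s ks qs ks0 wks.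
    exists (3 * L * ((1 + K) ^+ 2 * (Cs s * ks `^ s)) `^ s^-1); last first.
      exact: (w1_layer G gK L1 fN fL (ltW (lam0 k)) s0 HEs).
    by rewrite !mulr_ge0 ?powR_ge0.
  have [k1 k10 w1k] := lay r1 (lt_trans qr rr1) r10.
  have [k2 k20 w2k] := lay r2 qr2 r20.
  exact: (simultaneous_density G gK dbl x0 r21 (ltW (lt_trans r2r rr1)) dense k10 k20 w1k w2k e'0).
have psiW s k : s \in [:: r1; r2] -> W1 s (fun x => (layer h f N L (lam k) x)%:C - sval (psi k) x) e'.
  by rewrite !inE => /orP[] /eqP->; case: (psiP k).
exists n, lam, psi; split=> // s s12.
  have [qs s1 s0 ss] := in12 s s12 => c Hc.
  have A1 := w1_layers G gK L1 fN fL n s0 r0 del0 HEr Hc.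
  have A2 := w1_sum G n s1 (fun k => mulr_ge0 (normc_ge0 (- c k)) (ltW e'0))
    (fun k => w1Z (- c k) (ltW e'0) (psiW s k s12)).
  have nc k : normc (c k) * e' <= (lam k `^ (r / r1 - 1) + lam k `^ (r / r2 - 1) + 1) * e'.
    rewrite ler_wpM2r ?(ltW e'0)//; apply: le_trans (Hc k) _.
    by case: ss => ->; rewrite -?addrA ?lerDl ?addr_ge0 ?powR_ge0//; rewrite addrCA lerDl addr_ge0 ?powR_ge0.
  have A3 : \sum_(k < n) normc (- c k) * e' <= 1.
    apply: le_trans e'1; rewrite /S mulr_suml; apply: ler_sum => k _.
    by rewrite normcN'; exact: nc.
  have D0s : 0 <= D0 s by exact: D00.
  have A30 : 0 <= \sum_(k < n) normc (- c k) * e'.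
    by apply: sumr_ge0 => k _; rewrite mulr_ge0 ?normc_ge0// ltW.
  apply: (w1_le (ltW s0) _ _ _ (k := D0 s + \sum_(k < n) normc (- c k) * e')).
  - exact: addr_ge0.
  - apply: lerD => //; case: ss => ->; rewrite ?lerDl ?lerDr; exact: D00.
  apply: eq_w1 (w1D G s1 D0s A30 A1 A2) => x.
  by rewrite -big_split; apply: eq_bigr => k _ /=; rewrite mulrBr !mulNr opprK addrA subrr add0r.
have [qs s1 s0 ss] := in12 s s12.
have A2 := w1_sum G n s1 (fun k => ltW e'0) (fun k => psiW s k s12).
have A3 : \sum_(k < n) e' <= e / 2.
  apply: le_trans e'e; rewrite /S mulr_suml; apply: ler_sum => k _.
  by rewrite -[leLHS]mul1r ler_wpM2r ?(ltW e'0)// lerDr addr_ge0 ?powR_ge0.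
have A30 : 0 <= \sum_(k < n) e' by apply: sumr_ge0 => k _; exact: ltW.
apply: (w1_le (ltW s0) _ _ _ (k := e / 2 + \sum_(k < n) e')).
- by rewrite addr_ge0 ?(ltW e2).
- by rewrite [leRHS]splitr lerD2l.
apply: eq_w1 (w1D G s1 (ltW e2) A30 (base s s12) A2) => x.
rewrite fE (layer_sum G L1 fN fL del0 Nb bn x) sumrB addrA; congr (_ - _).
by rewrite rmorphD rmorph_sum.
Qed.

End Decomposition.

(** * The converse bound *)

Section StripFunctions.
Variable R : realType.
Implicit Types (f g : R[i] -> R[i]) (z w : R[i]).

(** What [maximum_modulus_strip] asks of a function, apart from the bounds on the two lines. *)
Record strip_regular f : Prop := StripRegular {
  sr_bounded : exists M : R, forall z, strip z -> normc (f z) <= M;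
  sr_cont : forall z, strip z -> forall e : R, 0 < e -> exists2 d : R, 0 < d &
    forall w, strip w -> normc (w - z) < d -> normc (f w - f z) < e;
  sr_diff : forall z, 0 < complex.Re z < 1 -> cxdiff f z }.

Lemma strip_regular_cst (c : R[i]) : strip_regular (fun=> c).
Proof.
split=> [|z _ e e0|z _]; [by exists (normc c)| |exact: cxdiff_cst].
by exists 1 => // w _ _; rewrite subrr normc0E.
Qed.

Lemma strip_regularD f g : strip_regular f -> strip_regular g -> strip_regular (fun z => f z + g z).
Proof.
move=> [[M fM] fc fd] [[N gN] gc gd]; split=> [|z sz e e0|z iz].
- by exists (M + N) => z sz; rewrite (le_trans (ler_normcD _ _))// lerD ?fM ?gN.
- have e2 : 0 < e / 2 by rewrite divr_gt0.
  have [d1 d10 H1] := fc z sz _ e2; have [d2 d20 H2] := gc z sz _ e2.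
  exists (Num.min d1 d2); first by rewrite lt_min d10.
  move=> w sw; rewrite lt_min => /andP[/(H1 w sw) w1 /(H2 w sw) w2].
  rewrite (_ : _ - _ = (f w - f z) + (g w - g z)); last by ring.
  by rewrite (le_lt_trans (ler_normcD _ _))// [e]splitr ltrD.
- by apply: cxdiffD; [exact: fd|exact: gd].
Qed.

Lemma strip_regularM f g : strip_regular f -> strip_regular g -> strip_regular (fun z => f z * g z).
Proof.
move=> [[M fM] fc fd] [[N gN] gc gd]; split=> [|z sz e e0|z iz].
- by exists (M * N) => z sz; rewrite normcME ler_pM ?normc_ge0 ?fM ?gN.
- have M0 : 0 <= M by exact: le_trans (normc_ge0 _) (fM z sz).
  have N0 : 0 <= N by exact: le_trans (normc_ge0 _) (gN z sz).
  have M1 : 0 < 2 * (M + 1) by rewrite mulr_gt0// ltr_wpDl.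
  have N1 : 0 < 2 * (N + 1) by rewrite mulr_gt0// ltr_wpDl.
  have [d1 d10 H1] := fc z sz _ (divr_gt0 e0 N1); have [d2 d20 H2] := gc z sz _ (divr_gt0 e0 M1).
  exists (Num.min d1 d2); first by rewrite lt_min d10.
  move=> w sw; rewrite lt_min => /andP[/(H1 w sw) w1 /(H2 w sw) w2].
  rewrite (_ : _ - _ = f w * (g w - g z) + (f w - f z) * g z); last by ring.
  apply: le_lt_trans (ler_normcD _ _) _; rewrite [e]splitr !normcME ltr_leD//.
    apply: le_lt_trans (ler_wpM2r (normc_ge0 _) (fM w sw)) _.
    apply: le_lt_trans (ler_wpM2l M0 (ltW w2)) _.
    rewrite (_ : M * _ = e / 2 * (M / (M + 1))); last by field; rewrite gt_eqF// ltr_wpDl.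
    by rewrite gtr_pMr ?divr_gt0// ltr_pdivrMr ?mul1r ?ltrDl// ltr_wpDl.
  apply: le_trans (ler_wpM2l (normc_ge0 _) (gN z sz)) _.
  apply: le_trans (ler_wpM2r N0 (ltW w1)) _.
  rewrite (_ : _ * N = e / 2 * (N / (N + 1))); last by field; rewrite gt_eqF// ltr_wpDl.
  have NN : N / (N + 1) <= 1 by rewrite ler_pdivrMr ?mul1r ?lerDl// ltr_wpDl.
  by rewrite ler_piMr// divr_ge0// ltW.
- by apply: cxdiffM; [exact: fd|exact: gd].
Qed.

Lemma strip_regular_cexp (a : R) : strip_regular (cexp a).
Proof.
have cd z : cxdiff (cexp a) z by exists (a%:C * cexp a z); exact: cxderiv_cexp.
split=> [|z _ e e0|z _//].
  exists (expR `|a|) => z /andP[z0 z1]; rewrite normc_cexp ler_expR.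
  apply: le_trans (ler_norm _) _; rewrite normrM (ger0_norm z0) -[leRHS]mulr1.
  exact: ler_wpM2l.
by have [d d0 H] := cxdiff_cont (cd z) e0; exists d => // w _; exact: H.
Qed.

Lemma strip_regular_sum n (f : nat -> R[i] -> R[i]) : (forall k, strip_regular (f k)) ->
  strip_regular (fun z => \sum_(k < n) f k z).
Proof.
move=> fk; elim: n => [|n IH].
  have -> : (fun z => \sum_(k < 0) f k z) = (fun=> 0) by apply/funext => z; rewrite big_ord0.
  exact: strip_regular_cst.
have -> : (fun z => \sum_(k < n.+1) f k z) = (fun z => \sum_(k < n) f k z + f n z).
  by apply/funext => z; rewrite big_ord_recr.
exact: strip_regularD.
Qed.

End StripFunctions.

Section CalderonBounds.
Variables (R : realType) (Gamma : choiceType) (h mu : Gamma -> Gamma -> R).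
Hypothesis G : weighted_graph h mu.
Variable K : R.
Hypothesis gK : graph_const h mu K.
Local Notation FV := (finsupp_fun R Gamma -> R[i]^o).
Local Notation W1 := (w1 h mu).
Implicit Types (T : FV) (phi : finsupp_fun R Gamma).

Let K1 : 0 < 1 + K. Proof. by rewrite ltr_wpDr// ltW// (K_gt0 gK). Qed.

Lemma Wm1norm_ge0 p T : 1 < p -> (0 <= Wm1norm h mu p T)%E.
Proof.
move=> p1; rewrite leNgt; apply/negP => H.
have [B [B0 HB]] : exists B : R, B < 0 /\ (Wm1norm h mu p T < B%:E)%E.
  case: (Wm1norm _ _ _ _) H => [s s0| |] //.
    by exists (s / 2); rewrite !lte_fin in s0 *; split; lra.
  by move=> _; exists (-1); rewrite ltrN10 ltNyr.
have [+ _ _] := Wm1norm_bounded G gK (ltW (conj_exp_gt1 p1)) HB.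
by rewrite leNgt B0.
Qed.

Lemma tlin_sum n (c : nat -> R[i]) (psi : nat -> finsupp_fun R Gamma) :
  exists chi, sval chi = (fun x => \sum_(k < n) c k * sval (psi k) x) /\
    forall T, tlin T -> T chi = \sum_(k < n) c k * T (psi k).
Proof.
elim: n => [|n [chi [chiE chiT]]].
  have z0 (x : Gamma) : x \notin [::] -> (fun=> 0 : R[i]) x = 0 by [].
  exists (fsupp_seq z0); split=> [|T Tl] /=; first by apply/funext => x; rewrite big_ord0.
  by rewrite big_ord0; exact: tlin0.
exists (fslin (c n) (psi n) chi); split=> [|T Tl].
  by apply/funext => x /=; rewrite chiE big_ord_recr addrC.
by rewrite Tl chiT// big_ord_recr addrC.
Qed.

Variables p1 p2 : R.
Hypotheses (p1_gt1 : 1 < p1) (p2_gt1 : 1 < p2).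
Local Notation N1 := (Wm1norm h mu p1).
Local Notation N2 := (Wm1norm h mu p2).
Local Notation r1 := (conj_exp p1).
Local Notation r2 := (conj_exp p2).

Let r11 : 1 <= r1. Proof. exact/ltW/conj_exp_gt1. Qed.
Let r21 : 1 <= r2. Proof. exact/ltW/conj_exp_gt1. Qed.

Lemma sum_norm_bounded T B : (sum_norm N1 N2 T < B%:E)%E -> [/\ 0 <= B, tlin T &
  forall phi k1 k2, 0 <= k1 -> 0 <= k2 -> W1 r1 (sval phi) k1 -> W1 r2 (sval phi) k2 ->
    normc (T phi) <= (1 + K) * B * (k1 + k2)].
Proof.
move=> /ereal_inf_lt[_ [a _ <-]] H.
have Ha : (N1 a < B%:E)%E by apply: le_lt_trans H; rewrite leeDl// Wm1norm_ge0.
have Hb : (N2 (T - a)%R < B%:E)%E by apply: le_lt_trans H; rewrite leeDr// Wm1norm_ge0.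
have [B0 al ab] := Wm1norm_bounded G gK r11 Ha.
have [_ bl bb] := Wm1norm_bounded G gK r21 Hb.
have TE phi : T phi = a phi + (T - a) phi.
  by rewrite -[(T - a) phi]/(T phi - a phi) addrC subrK.
split=> // [c phi psi|phi k1 k2 k10 k20 w1 w2].
  by rewrite TE al bl (TE phi) (TE psi); ring.
rewrite TE mulrDr; apply: le_trans (ler_normcD _ _) _.
by rewrite lerD ?ab ?bb.
Qed.

Variable F : R[i] -> FV.
Hypothesis cF : calderon N1 N2 F.

Lemma calderon_finite : exists M : R, forall z, strip z -> (sum_norm N1 N2 (F z) < M%:E)%E.
Proof.
have [M HM] := cal_bounded cF; exists (M + 1) => z sz.
by apply: le_lt_trans (HM z sz) _; rewrite lte_fin ltrDl.
Qed.

Lemma calderon_tlin z : strip z -> tlin (F z).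
Proof. by have [M HM] := calderon_finite => /HM/sum_norm_bounded[]. Qed.

(** phi has finite energy for both exponents, so evaluation at phi is continuous for [sum_norm] and
    carries the regularity of F over to scalars. *)
Lemma calderon_eval phi : strip_regular (fun z => F z phi).
Proof.
have [k1 k10 w1] := finsupp_w1 G phi (lt_le_trans ltr01 r11).
have [k2 k20 w2] := finsupp_w1 G phi (lt_le_trans ltr01 r21).
pose C := (1 + K) * (k1 + k2); have C0 : 0 <= C by apply: mulr_ge0; [exact: ltW|exact: addr_ge0].
have C1 : 0 < C + 1 by rewrite ltr_wpDl.
have TC T B : (sum_norm N1 N2 T < B%:E)%E -> normc (T phi) <= C * B.
  by move=> /sum_norm_bounded[B0 _ /(_ phi k1 k2 k10 k20 w1 w2)]; rewrite mulrAC.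
have small e : 0 < e -> C * (e / (C + 1)) < e.
  by move=> e0; rewrite mulrA ltr_pdivrMr// mulrC ltr_pM2l// ltrDl.
split=> [|z sz e e0|z iz].
- by have [M HM] := calderon_finite; exists (C * M) => z /HM/TC.
- have [d d0 Hd] := cal_cont cF sz (divr_gt0 e0 C1); exists d => // w sw wz.
  exact: le_lt_trans (TC _ _ (Hd w sw wz)) (small e e0).
have [v _ Hv] := cal_analytic cF iz; exists (v phi) => e e0.
have [d d0 Hd] := Hv _ (divr_gt0 e0 C1); exists d => // w wz.
have [->|nwz] := eqVneq w z; first by rewrite !subrr mulr0 subr0 normc0E mulr0.
have := le_trans (TC _ _ (Hd w nwz wz)) (ltW (small e e0)).
set S := (X in normc (X phi)) => H; have wz0 : w - z != 0 by rewrite subr_eq0.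
have -> : F w phi - F z phi - v phi * (w - z) = S phi * (w - z).
  rewrite -[S phi]/((w - z)^-1 * (F w phi - F z phi) - v phi).
  by rewrite mulrBl mulrAC mulVf// mul1r.
by rewrite normcME ler_wpM2r ?normc_ge0.
Qed.

End CalderonBounds.

(** * Bounding the value at alpha of a function in Calderon's space *)

Section InterpolationBound.
Variables (R : realType) (Gamma : choiceType) (h mu : Gamma -> Gamma -> R).
Hypothesis G : weighted_graph h mu.
Variable K : R.
Hypothesis gK : graph_const h mu K.
Local Notation FV := (finsupp_fun R Gamma -> R[i]^o).
Local Notation W1 := (w1 h mu).
Implicit Types (T : FV) (phi : finsupp_fun R Gamma).

Variables p1 p p2 : R.
Hypotheses (p1_gt1 : 1 < p1) (p1p : p1 < p) (pp2 : p < p2).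
Local Notation N1 := (Wm1norm h mu p1).
Local Notation N2 := (Wm1norm h mu p2).
Local Notation r1 := (conj_exp p1).
Local Notation r := (conj_exp p).
Local Notation r2 := (conj_exp p2).
Local Notation al := (alpha p1 p p2).

Let p_gt1 : 1 < p. Proof. exact: lt_trans p1p. Qed.
Let p2_gt1 : 1 < p2. Proof. exact: lt_trans pp2. Qed.
Let K1 : 0 < 1 + K. Proof. by rewrite ltr_wpDr// ltW// (K_gt0 gK). Qed.
Let r1_gt1 : 1 < r1. Proof. exact: conj_exp_gt1. Qed.
Let r_gt1 : 1 < r. Proof. exact: conj_exp_gt1. Qed.
Let r2_gt1 : 1 < r2. Proof. exact: conj_exp_gt1. Qed.
Let rr1 : r < r1. Proof. exact: conj_exp_lt. Qed.
Let r2r : r2 < r. Proof. exact: conj_exp_lt. Qed.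

Let kap0 := r / r1 - 1.
Let kap1 := r / r2 - 1.

(** 1/r is the interpolate of 1/r1 and 1/r2 at alpha, as 1/p is of 1/p1 and 1/p2; multiplied by r,
    the interpolate of r/s - 1 is 0. *)
Lemma kap_alpha : kap0 + (kap1 - kap0) * al = 0.
Proof.
have e1 := conj_expV p1_gt1; have e := conj_expV p_gt1; have e2 := conj_expV p2_gt1.
have E1 : r1^-1 = 1 - p1^-1 by rewrite -e1 addrC addKr.
have E : r^-1 = 1 - p^-1 by rewrite -e addrC addKr.
have E2 : r2^-1 = 1 - p2^-1 by rewrite -e2 addrC addKr.
have r0 : r != 0 by rewrite gt_eqF// (lt_trans ltr01).
have pne : p1^-1 - p2^-1 != 0.
  rewrite subr_eq0 gt_eqF// ltf_pV2 ?posrE ?(lt_trans ltr01)//; exact: lt_trans pp2.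
have HD : (kap1 - kap0) * al = r * (p1^-1 - p^-1).
  rewrite /kap1 /kap0 /alpha E1 E2 opprB addrA subrK -mulrBr.
  rewrite (_ : 1 - p2^-1 - (1 - p1^-1) = p1^-1 - p2^-1); last by ring.
  by rewrite -mulrA [_ * (_ / _)]mulrCA mulfV// mulr1.
rewrite HD /kap0 E1 -{2}(mulfV r0) E; ring.
Qed.

(** The analytic power lam^(kap0 + (kap1 - kap0) z), whose modulus on each boundary line is the
    weight the decomposition admits. *)
Definition layer_coef (lam : R) z := (lam `^ kap0)%:C * cexp ((kap1 - kap0) * ln lam) z.

Lemma normc_layer_coef lam z : 0 < lam ->
  normc (layer_coef lam z) = lam `^ (kap0 + (kap1 - kap0) * complex.Re z).
Proof.
move=> l0; rewrite /layer_coef normcME normcR ger0_norm ?powR_ge0// normc_cexp.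
have -> : expR ((kap1 - kap0) * ln lam * complex.Re z) = lam `^ ((kap1 - kap0) * complex.Re z).
  by rewrite /powR (gt_eqF l0) mulrAC.
by rewrite -powRD// (gt_eqF l0) implybT.
Qed.

Lemma layer_coef_alpha lam : 0 < lam -> layer_coef lam al%:C = 1.
Proof.
move=> l0; rewrite /layer_coef cexp_real -rmorphM/=; congr (_%:C).
have -> : expR ((kap1 - kap0) * ln lam * al) = lam `^ ((kap1 - kap0) * al).
  by rewrite /powR (gt_eqF l0) mulrAC.
by rewrite -powRD ?kap_alpha ?powRr0// (gt_eqF l0) implybT.
Qed.

Variable D : R.
Hypothesis D0 : 0 <= D.
Hypothesis decomposition :
  forall (phi : finsupp_fun R Gamma) (f : Gamma -> R), sval phi = (fun x => (f x)%:C) ->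
    W1 r (sval phi) 1 -> forall e, 0 < e ->
  exists n (lam : nat -> R) (psi : nat -> finsupp_fun R Gamma), [/\ forall k, 0 < lam k,
    forall s, s \in [:: r1; r2] -> forall c : nat -> R[i],
      (forall k, normc (c k) <= lam k `^ (r / s - 1)) ->
      W1 s (fun x => \sum_(k < n) c k * sval (psi k) x) D &
    forall s, s \in [:: r1; r2] ->
      W1 s (fun x => sval phi x - \sum_(k < n) sval (psi k) x) e].

Variables (F : R[i] -> FV) (Kc : R).
Hypothesis cF : calderon N1 N2 F.
Hypothesis nF : (calderon_norm N1 N2 F < Kc%:E)%E.

Lemma calderon_left (t : R) : (N1 (F (0 +i* t)%R) < Kc%:E)%E.
Proof.
apply: le_lt_trans nF; rewrite /calderon_norm le_max; apply/orP; left.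
by apply: ereal_sup_ubound; exists t.
Qed.

Lemma calderon_right (t : R) : (N2 (F (1 +i* t)%R) < Kc%:E)%E.
Proof.
apply: le_lt_trans nF; rewrite /calderon_norm le_max; apply/orP; right.
by apply: ereal_sup_ubound; exists t.
Qed.

Lemma calderon_norm_ge0 : 0 <= Kc.
Proof. by have [] := Wm1norm_bounded G gK (ltW r1_gt1) (calderon_left 0). Qed.

Let C := (1 + K) * Kc * D.
Let C0 : 0 <= C. Proof. by rewrite !mulr_ge0 ?calderon_norm_ge0// ltW. Qed.

Lemma interp_bounded_unit phi (f : Gamma -> R) : sval phi = (fun x => (f x)%:C) ->
  W1 r (sval phi) 1 -> normc (F al%:C phi) <= C.
Proof.
move=> phiE wphi.
have /andP[al0 al1] := alpha01 p1_gt1 p1p pp2.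
have sal : strip al%:C by rewrite /strip /= !ltW.
(* The bound M in the sum space is only qualitative: it multiplies the arbitrary e and does not
   enter C. *)
have [M HM] := calderon_finite cF.
have [M0 Ftl Fbd] := sum_norm_bounded G gK p1_gt1 p2_gt1 (HM _ sal).
have B0 : 0 <= 2 * (1 + K) * M by rewrite !mulr_ge0// ltW.
rewrite -[C]mulr1; suff H e : 0 < e -> normc (F al%:C phi) <= C + 2 * (1 + K) * M * e.
  rewrite mulr1; apply/ler_addgt0Pr => e e0.
  have B1 : 0 < 2 * (1 + K) * M + 1 by rewrite ltr_wpDl.
  apply: le_trans (H _ (divr_gt0 e0 B1)) _; rewrite lerD2l mulrA ler_pdivrMr// mulrC.
  by rewrite ler_wpM2l ?lerDl// ltW.
move=> e0; have [n [lam [psi [lam0 Hc Hr]]]] := decomposition phiE wphi e0.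
pose c k z := layer_coef (lam k) z.
pose hh z := \sum_(k < n) c k z * F z (psi k).
have sreg : strip_regular hh.
  apply: (@strip_regular_sum _ n (fun k z => c k z * F z (psi k))) => k.
  apply: strip_regularM; last exact: (calderon_eval G gK p1_gt1 p2_gt1 cF).
  by apply: strip_regularM; [exact: strip_regular_cst|exact: strip_regular_cexp].
(* For fixed z the sum is F z at a single finitely supported function, whose W^{1,s} bound D is the
   first property of the decomposition. *)
have line z s : strip z -> s \in [:: r1; r2] -> tbd h mu s (F z) ((1 + K) * Kc) ->
    (forall k, normc (c k z) <= lam k `^ (r / s - 1)) -> normc (hh z) <= C.
  move=> sz s12 Fb Hcz.
  have [chi [chiE chiT]] := tlin_sum n (fun k => c k z) psi.
  rewrite /hh -(chiT _ (calderon_tlin G gK p1_gt1 p2_gt1 cF sz)).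
  apply: (Fb chi D D0); rewrite chiE; exact: (Hc s s12 (fun k => c k z) Hcz).
have hal : normc (hh al%:C) <= C.
  have [[M' hM] hc hd] := sreg.
  apply: maximum_modulus_strip hM hc hd _ _ _ => // [t|t|]; last by rewrite /= al0.
  - apply: (line _ r1); rewrite ?mem_head//; first by rewrite /strip /= lexx ler01.
      by have [] := Wm1norm_bounded G gK (ltW r1_gt1) (calderon_left t).
    by move=> k; rewrite normc_layer_coef//= mulr0 addr0.
  - apply: (line _ r2); rewrite ?inE ?eqxx ?orbT//; first by rewrite /strip /= lexx ler01.
      by have [] := Wm1norm_bounded G gK (ltW r2_gt1) (calderon_right t).
    by move=> k; rewrite normc_layer_coef//= mulr1 addrC subrK.
have [chi [chiE chiT]] := tlin_sum n (fun=> 1) psi.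
have hE : hh al%:C = F al%:C chi.
  rewrite chiT//; apply: eq_bigr => k _.
  by rewrite /c layer_coef_alpha.
pose rem := fslin (-1) chi phi.
have remE : sval rem = (fun x => sval phi x - \sum_(k < n) sval (psi k) x).
  apply/funext => x /=; rewrite chiE mulN1r addrC; congr (_ - _).
  by apply: eq_bigr => k _; rewrite mul1r.
have FE : F al%:C phi = hh al%:C + F al%:C rem by rewrite hE Ftl; ring.
rewrite FE; apply: le_trans (ler_normcD _ _) _; apply: lerD => //.
have := Fbd rem e e (ltW e0) (ltW e0); rewrite remE => /(_ (Hr _ (mem_head _ _)) (Hr _ _)).
move=> /(_ _)/le_trans; apply; first by rewrite !inE eqxx orbT.
by rewrite le_eqVlt; apply/orP; left; apply/eqP; ring.
Qed.

Lemma interp_bounded_real phi (f : Gamma -> R) k : sval phi = (fun x => (f x)%:C) ->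
  0 <= k -> W1 r (sval phi) k -> normc (F al%:C phi) <= C * k.
Proof.
move=> phiE k0 wphi; apply: le_forall_eps => // e e0.
have ke : 0 < k + e by rewrite ltr_wpDl.
have /andP[al0 al1] := alpha01 p1_gt1 p1p pp2.
have sal : strip al%:C by rewrite /strip /= !ltW.
have Ftl := calderon_tlin G gK p1_gt1 p2_gt1 cF sal.
have [S uS SP] := finsupp_seq phi.
have fs x : x \notin S -> ((k + e)^-1)%:C * sval phi x = 0 by move=> /SP->; rewrite mulr0.
have -> : F al%:C phi = (k + e)%:C * F al%:C (fsupp_seq fs).
  have z0 (x : Gamma) : x \notin [::] -> (fun=> 0 : R[i]) x = 0 by [].
  rewrite (tlin_comb (a := (k + e)%:C) (phi := fsupp_seq fs) (psi := fsupp_seq z0) Ftl).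
    by rewrite (tlin0 (phi := fsupp_seq z0) Ftl) ?addr0.
  apply/funext => x /=; rewrite addr0 mulrA -rmorphM mulfV ?gt_eqF// mul1r//.
rewrite normcME normcR (ger0_norm (ltW ke)) mulrC ler_wpM2r ?(ltW ke)//.
apply: (@interp_bounded_unit _ (fun x => (k + e)^-1 * f x)).
  by apply/funext => x /=; rewrite phiE rmorphM.
have := w1Z ((k + e)^-1)%:C k0 wphi; rewrite normcR ger0_norm ?invr_ge0 ?(ltW ke)//.
apply: w1_le; rewrite ?(ltW (lt_trans ltr01 r_gt1))// ?mulr_ge0 ?invr_ge0 ?(ltW ke)//.
by rewrite ler_pdivrMl// mulr1 lerDl ltW.
Qed.

(** McShane extensions concern real functions, so phi is split into real and imaginary parts, whose
    gradients are dominated by that of phi; hence the factor 2. *)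
Lemma interp_bounded : tlin (F al%:C) /\ tbd h mu r (F al%:C) (2 * C).
Proof.
have /andP[al0 al1] := alpha01 p1_gt1 p1p pp2.
have sal : strip al%:C by rewrite /strip /= !ltW.
have Ftl := calderon_tlin G gK p1_gt1 p2_gt1 cF sal.
split=> // phi k k0 wphi; have r0 : 0 <= r by rewrite ltW// (lt_trans ltr01).
have [S uS SP] := finsupp_seq phi.
have fR x : x \notin S -> (complex.Re (sval phi x))%:C = 0 by move=> /SP->.
have fI x : x \notin S -> (complex.Im (sval phi x))%:C = 0 by move=> /SP->.
have -> : F al%:C phi = 'i * F al%:C (fsupp_seq fI) + F al%:C (fsupp_seq fR).
  apply: tlin_comb => //; apply/funext => x /=.
  case: (sval phi x) => a b /=; apply: complex_eqP; rewrite !(ReD, ReM, ImD, ImM)/=; ring.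
apply: le_trans (ler_normcD _ _) _; rewrite normcME normc_i mul1r.
rewrite (_ : 2 * C * k = C * k + C * k); last by ring.
have part (g : R[i] -> R) : (forall a b, `|g a - g b| <= normc (a - b)) -> g 0 = 0 ->
    W1 r (fun x => (g (sval phi x))%:C) k.
  move=> gl g0; apply: bsumS wphi => p'; rewrite ler_wpM2r ?(wt_ge0 G)//.
  rewrite ge0_ler_powR ?nnegrE ?normc_ge0//; case: p' => x y; rewrite /grd/=.
  case: ifP => _; first by rewrite normcR; have := gl (sval phi x) 0; rewrite g0 !subr0.
  case: ifP => _ //; rewrite normcME [leRHS]normcME ler_wpM2l ?normc_ge0//.
  by rewrite -rmorphB normcR.
apply: lerD; [apply: (interp_bounded_real (f := fun x => complex.Im (sval phi x)))
             |apply: (interp_bounded_real (f := fun x => complex.Re (sval phi x)))] => //.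
- by apply: (part (@complex.Im R)) => // a b; rewrite -ImB normc_ge_absIm.
- by apply: (part (@complex.Re R)) => // a b; rewrite -ReB normc_ge_absRe.
Qed.

End InterpolationBound.

Section NormComparison.
Variable R : realType.

(** Quantifying over the reals B above y covers y = +oo vacuously, and the clause 0 <= B excludes y
    = -oo. *)
Lemma lee_scale (x y : \bar R) (C : R) : 0 < C ->
  (forall B : R, (y < B%:E)%E -> 0 <= B /\ (x <= (C * B)%:E)%E) -> (x <= C%:E * y)%E.
Proof.
move=> C0 H; case: y H => [y| |] H.
- rewrite -EFinM; apply/lee_addgt0Pr => e e0.
  have [|_] := H (y + C^-1 * e); first by rewrite lte_fin ltrDl mulr_gt0 ?invr_gt0.
  by rewrite mulrDr mulVKf ?gt_eqF.
- by rewrite gt0_muley ?lte_fin// leey.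
- by have [|+ _] := H (-1); [rewrite ltNyr|rewrite oppr_ge0 ler10].
Qed.

(** p < q0' amounts to q0 < p', and q0 is an infimum, so some admissible exponent lies below p'. The
    case q0 <= 1 is apart since p' > 1 always. *)
Lemma poincare_below_conj (Gamma : choiceType) (h mu : Gamma -> Gamma -> R) (q p : R) :
  1 <= q -> poincare h mu q -> 1 < p ->
  (p%:E < hoelder_conjugate (poincare_exponent h mu)%:E)%E ->
  exists q', [/\ 1 <= q', poincare h mu q' & q' < conj_exp p].
Proof.
move=> q1 Pq p1 H; suff Hr : poincare_exponent h mu < conj_exp p.
  have [|q' [q'1 Pq'] q'r] := inf_lt _ Hr; first by exists q.
  by exists q'.
move: (poincare_exponent h mu) H => q0.
have [q01 _|q01] := leP q0 1; first exact: le_lt_trans q01 (conj_exp_gt1 p1).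
rewrite /hoelder_conjugate /= eqe gt_eqF ?(lt_trans ltr01)//.
rewrite -EFinD inver subr_eq0 gt_eqF// -EFinM lte_fin conj_expE//.
have q010 : 0 < q0 - 1 by rewrite subr_gt0.
have p10 : 0 < p - 1 by rewrite subr_gt0.
rewrite !ltr_pdivlMr//; lra.
Qed.

End NormComparison.

Theorem theorem3p8 (R : realType) (Gamma : choiceType)
    (h mu : Gamma -> Gamma -> R)
    (graph : weighted_graph h mu)
    (D : doubling h mu)
    (q : R) (q_ge1 : 1 <= q) (Pq : poincare h mu q)
    (p1 p p2 : R)
    (p1_gt1 : 1 < p1) (p1_lt_p : p1 < p) (p_lt_p2 : p < p2)
    (p2_lt_q0' : (p2%:E < hoelder_conjugate (poincare_exponent h mu)%:E)%E)
    (dense : forall s : R, s \in [:: p1; p; p2] ->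
       finsupp_dense h mu (conj_exp s)) :
  equiv_norms
    (interp_norm (Wm1norm h mu p1) (Wm1norm h mu p2)
       ((p1^-1 - p^-1) / (p1^-1 - p2^-1)))
    (Wm1norm h mu p).
Proof.
have p_gt1 : 1 < p by exact: lt_trans p1_lt_p.
have p2_gt1 : 1 < p2 by exact: lt_trans p_lt_p2.
have [q' [q'1 Pq' q'r2]] := poincare_below_conj q_ge1 Pq p2_gt1 p2_lt_q0'.
have [K gK] := exists_graph_const graph.
have K1 : 0 < 1 + K by rewrite ltr_wpDr// ltW// (K_gt0 gK).
have [d1 d d2] : [/\ finsupp_dense h mu (conj_exp p1), finsupp_dense h mu (conj_exp p) &
    finsupp_dense h mu (conj_exp p2)].
  by split; apply: dense; rewrite !inE eqxx ?orbT.
(* Conjugation reverses the order of the exponents, so the density used here is at the largest one,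
   [conj_exp p1]. *)
have [D' D'0 dec] := layer_decomposition graph D q'1 Pq' q'r2
  (conj_exp_lt p_gt1 p_lt_p2) (conj_exp_lt p1_gt1 p1_lt_p) d1.
(* C1 combines [Wm1norm_bounded] with [interp_norm_Tu], and C2 combines [interp_bounded] with
   [bounded_Wm1norm]. *)
pose C1 := 4 * (1 + K) * (1 + K); pose C2 := (1 + K) * (2 * ((1 + K) * D')).
have C10 : 0 < C1 by rewrite !mulr_gt0.
have C20 : 0 <= C2 by apply: mulr_ge0 (ltW K1) _; rewrite mulr_ge0// mulr_ge0// ltW.
have C0 : 0 < C1 + C2 by rewrite ltr_wpDr.
exists (C1 + C2) => // T; split; apply: lee_scale => // B HB.
  have NT := Wm1norm_ge0 graph gK T p_gt1.
  have B0 : 0 < B by rewrite -lte_fin; exact: le_lt_trans HB.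
  have KB : 0 < (1 + K) * B by exact: mulr_gt0.
  have r_gt1 := conj_exp_gt1 p_gt1.
  have [_ Tl Tb] := Wm1norm_bounded graph gK (ltW r_gt1) HB.
  have [u uP uT] := representation graph p_gt1 r_gt1 (conj_expV p_gt1) (ltW KB) Tl Tb.
  split; first exact: ltW.
  (* The analytic family is built from a coefficient vector of energy at most 1, so the norm is
     moved into the scalar A = (1 + K) B. *)
  pose v j := (((1 + K) * B)^-1)%:C * u j.
  have vP : en (wt h mu) p v 1.
    have := en_k (((1 + K) * B)^-1)%:C (ltW KB) uP; rewrite normcR ger0_norm ?invr_ge0 ?(ltW KB)//.
    by rewrite mulVf ?gt_eqF// powR1.
  have -> : T = ((1 + K) * B)%:C *: Tu (h := h) (mu := mu) graph v.
    apply/funext => phi; rewrite (uT phi (gsupp graph phi) (gsupp_uniq graph phi)); last first.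
      by move=> j; exact: gsuppP.
    rewrite /v TuZ scalerA -rmorphM mulfV ?gt_eqF// scale1r//.
  apply: le_trans (interp_norm_Tu graph gK p1_gt1 p1_lt_p p_lt_p2 d1 d2 vP (ltW KB)) _.
  by rewrite lee_fin mulrA -/C1 ler_wpM2r ?(ltW B0)// lerDl.
have [_ [F [cF FT] <-] HF] := ereal_inf_lt HB.
have B0 := calderon_norm_ge0 graph gK p1_gt1 HF; split=> //.
have [] := interp_bounded graph gK p1_gt1 p1_lt_p p_lt_p2 D'0 dec cF HF.
rewrite /alpha FT => Tl Tb.
have C0' : 0 <= 2 * ((1 + K) * B * D') by rewrite !mulr_ge0// ltW.
apply: le_trans (bounded_Wm1norm graph gK (ltW (conj_exp_gt1 p_gt1)) d C0' Tl Tb) _.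
rewrite lee_fin (_ : _ * (2 * _) = C2 * B); last by rewrite /C2; ring.
by rewrite ler_wpM2r// lerDr ltW.
Qed.
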